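(* The outer billiard map $B:\mathcal{U}\to\mathcal{U}$ associated with a smooth, closed, quadratically convex surface $S$ in $\mathbb{R}^{3}$ preserves both the canonical Poisson structure $\mathcal{P}$ on $\mathcal{G}_{0}$ and its symplectic leaves, which are the submanifolds of parallel lines (oriented lines with a common direction). In particular, the restriction of $B$ to each such submanifold (intersected with $\mathcal{U}$) is a symplectomorphism.
   Context: $\mathcal{G}_0$ is the four-dimensional manifold of oriented straight lines of $\mathbb{R}^3$ (quotient of $T^1\mathbb{R}^3$ by the geodesic flow). For a unit speed line $\gamma$, the tangent space $T_{[\gamma]}\mathcal{G}_0$ is identified with the space $\mathfrak{J}_\gamma$ of Jacobi fields along $\gamma$ orthogonal to $\gamma'$, via $J\mapsto\frac{d}{ds}|_0[\gamma_s]$, where $\gamma_s$ is any variation of $\gamma$ by unit speed lines with variation field $J$. The complex structure is $\mathcal{J}_\ell(J)=\gamma'\times J$ for $\ell=[\gamma]$. The canonical Poisson bivector field on $\mathcal{G}_0$ is $\mathcal{P}(\ell)=J\wedge\mathcal{J}_\ell(J)$, where $J$ is any parallel Jacobi field along $\ell$, orthogonal to it, with $\|J\|\equiv1$ (independent of the choice of $J$). ''Smooth'' means $C^\infty$; a closed surface is a compact, connected, embedded surface without boundary; quadratically convex means that the shape operator is definite at every point. Outer billiard map. $\mathcal{U}$ is the set of oriented lines not intersecting $S$. For $\ell\in\mathcal{U}$, parametrized with unit speed by $\alpha$, there are exactly two planes $P_\pm$ containing $\ell$ and tangent to $S$, at points $p_\pm$. Let $q_\pm$ be the point of $\ell$ closest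 to $p_\pm$, $d_\pm=|p_\pm-q_\pm|$, $W_\pm=(p_\pm-q_\pm)/d_\pm$; the signs are chosen so that $\{W_+,W_-,\alpha'\}$ is a positively oriented basis of $\mathbb{R}^3$. Then $B:\mathcal{U}\to\mathcal{U}$ sends $\ell$ to the oriented line obtained by translating $\ell$ by $2d_+W_+$. *)

(* Defs.v *)
From HB Require Import structures.
From mathcomp Require Import all_boot all_order all_algebra.
From mathcomp Require Import all_classical all_reals all_analysis.
From mathcomp Require Import ring.
From Stdlib Require Import Relation_Operators.
Set Implicit Arguments.
Unset Strict Implicit.
Unset Printing Implicit Defensive.
Import Order.TTheory GRing.Theory Num.Theory.
Import numFieldNormedType.Exports.
Local Open Scope classical_set_scope.
Local Open Scope ring_scope.

(** * Euclidean space *)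

Section Euclidean.
Context {R : realType}.
Implicit Types u v w : 'rV[R]_3.

Definition dot u v : R := \sum_(i < 3) u 0 i * v 0 i.

(* The library norm [`|u|] on row vectors is the sup norm, which gives the right
   topology but not the Euclidean length. *)
Definition enorm u : R := Num.sqrt (dot u u).

Definition normalize u : 'rV[R]_3 := (enorm u)^-1 *: u.

(* Index arithmetic in 'I_3 is modulo 3. *)
Definition cross u v : 'rV[R]_3 :=
  \row_(i < 3) (u 0 (i + 1) * v 0 (i + 2) - u 0 (i + 2) * v 0 (i + 1)).

Definition positively_oriented u v w : Prop :=
  0 < \det (\matrix_(i < 3) [tuple u; v; w]`_i).

End Euclidean.

(** * C^oo maps between (finite-dimensional) normed spaces *)

Section Smooth.
Context {R : realType} {V W : normedModType R}.

(* [D] is meant to be open. *)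
Fixpoint Ck (k : nat) (D : set V) (f : V -> W) : Prop :=
  if k is k'.+1 then
    (forall x, D x -> differentiable f x) /\
    (forall v : V, Ck k' D (fun x => 'd f x v))
  else forall x, D x -> {for x, continuous f}.

Definition smooth_on (D : set V) (f : V -> W) : Prop := forall k, Ck k D f.

Definition smooth_at (f : V -> W) (x : V) : Prop :=
  exists D : set V, [/\ open D, D x & smooth_on D f].

End Smooth.

(** * Surfaces in R^3 *)

Section Surfaces.
Context {R : realType}.
Implicit Types (S : set 'rV[R]_3) (D : set 'rV[R]_2)
  (phi : 'rV[R]_2 -> 'rV[R]_3).

(* [phi], defined on the open set [D], is a regular local parametrization of
   [S]: smooth, immersive, and a homeomorphism onto an open subset of [S]. *)
Definition local_param S D phi : Prop :=
  [/\ open D, smooth_on D phi, forall u, D u -> injective ('d phi u),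
      exists2 O : set 'rV[R]_3, open O & phi @` D = S `&` O
    & exists2 psi : 'rV[R]_3 -> 'rV[R]_2,
        {within phi @` D, continuous psi} & {in D, cancel phi psi}].

Definition closed_surface S : Prop :=
  [/\ S !=set0, compact S, connected S
    & forall p, S p -> exists D phi, local_param S D phi /\ (phi @` D) p].

Definition tangent_space S (p : 'rV[R]_3) : set 'rV[R]_3 :=
  [set X | exists D phi u w,
     [/\ local_param S D phi, D u, phi u = p & X = 'd phi u w]].

Definition tangent_plane S (p : 'rV[R]_3) : set 'rV[R]_3 :=
  [set x | tangent_space S p (x - p)].

Definition unit_normal phi (u : 'rV[R]_2) : 'rV[R]_3 :=
  normalize (cross ('d phi u (delta_mx 0 0)) ('d phi u (delta_mx 0 1))).

(* The shape operator at [phi u], as a function of the coordinates [w] of the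
   tangent vector ['d phi u w]: X |-> - D_X N. *)
Definition shape_operator phi (u w : 'rV[R]_2) : 'rV[R]_3 :=
  - 'd (unit_normal phi) u w.

Definition definite_shape_operator phi (u : 'rV[R]_2) : Prop :=
  (forall w, w != 0 -> 0 < dot (shape_operator phi u w) ('d phi u w)) \/
  (forall w, w != 0 -> dot (shape_operator phi u w) ('d phi u w) < 0).

Definition quadratically_convex S : Prop :=
  forall D phi u, local_param S D phi -> D u -> definite_shape_operator phi u.

End Surfaces.

(** * The manifold of oriented lines

   The oriented line {x + t v} with |v| = 1 is encoded by (x0, v), where x0 is
   its point closest to the origin; [olines] is thus a cross section of the
   geodesic flow (x, v) |-> (x + t v, v) on T^1 R^3 ([line_of_eq] below).  The
   quotient map, extended to all (x, w) with w <> 0 as the line through x with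
   direction w, is the submersion [line_of].  Accordingly a map [f] on lines is
   smooth iff [f \o line_of] is, and its differential at l is the restriction
   to the tangent space at l of the differential of [f \o line_of]. *)

Section Lines.
Context {R : realType}.
Local Notation V3 := 'rV[R]_3.
Local Notation E := ('rV[R]_3 * 'rV[R]_3)%type.
Implicit Types (l : E) (S : set V3) (J : R -> V3) (X Y : E).

Definition olines : set E := [set l | enorm l.2 = 1 /\ dot l.1 l.2 = 0].

Definition line_of (x : E) : E :=
  let v := normalize x.2 in (x.1 - dot x.1 v *: v, v).

Definition points l : set V3 := range (fun t : R => l.1 + t *: l.2).

Definition parallel_lines (v : V3) : set E := [set l | olines l /\ l.2 = v].

Definition smooth_lines {W : normedModType R} (A : set E) (f : E -> W) : Prop :=
  forall l, A l -> smooth_at (f \o line_of) l.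

(* Jacobi fields along gamma(t) = l.1 + t l.2, orthogonal to gamma'. *)
Definition jacobi_field l J : Prop :=
  [/\ forall t, derivable J t 1, forall t, derivable (derive1 J) t 1,
      forall t, derive1 (derive1 J) t = 0 & forall t, dot (J t) l.2 = 0].

Definition parallel_field J : Prop := forall t : R, is_derive t 1 J 0.

Definition complex_structure l J : R -> V3 := fun t => cross l.2 (J t).

(* [X] is the tangent vector d/ds|_0 [gamma_s] corresponding to [J], where
   gamma_s(t) = p(s) + t w(s) is a variation of gamma by unit speed lines with
   variation field [J]. *)
Definition tangent_vector l J X : Prop :=
  exists p w : R -> V3,
    [/\ smooth_at p 0 /\ smooth_at w 0,
        forall s, enorm (w s) = 1,
        p 0 = l.1 /\ w 0 = l.2,
        forall t : R, is_derive (0 : R) 1 (fun s => p s + t *: w s) (J t)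
      & is_derive (0 : R) 1 (fun s => line_of (p s, w s)) X].

(** ** Bivectors and the canonical Poisson structure *)

(* A bivector is identified with the bilinear form it induces on covectors. *)
Definition covector := {linear E -> R^o}.
Definition bivector := covector -> covector -> R.

Definition wedge X Y : bivector := fun a b => a X * b Y - a Y * b X.

Definition pushforward (A : {linear E -> E}) (Pi : bivector) : bivector :=
  fun a b => Pi (a \o A) (b \o A).

Definition is_poisson_at l (Pi : bivector) : Prop :=
  exists J X Y,
    [/\ jacobi_field l J /\ parallel_field J, forall t, enorm (J t) = 1,
        tangent_vector l J X, tangent_vector l (complex_structure l J) Y
      & Pi = wedge X Y].

Definition poisson l : bivector := xget (fun _ _ => 0) (is_poisson_at l).

(** ** Poisson geometry of a bivector field [P] *)

Implicit Type P : E -> bivector.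

(* [f] maps [A] to itself and f_* P = P. *)
Definition preserves_bivector P (A : set E) (f : E -> E) : Prop :=
  [/\ forall l, A l -> A (f l), smooth_lines A f
    & forall l, A l -> pushforward ('d (f \o line_of) l) (P l) = P (f l)].

(* X = P^#(a), that is, b(X) = P(a, b) for all covectors b. *)
Definition is_sharp (Pi : bivector) (a : covector) X : Prop :=
  forall b : covector, b X = Pi a b.

(* [l'] is joined to [l] by an arc of an integral curve of the Hamiltonian
   vector field P^#(df) of a smooth function [f]. *)
Definition hamiltonian_arc P l l' : Prop :=
  exists (f : E -> R^o) (c : R -> E),
    [/\ smooth_lines olines f, c 0 = l, c 1 = l'
      & forall t : R, 0 <= t <= 1 -> olines (c t) /\
          exists2 X, is_derive t 1 c X
                   & is_sharp (P (c t)) ('d (f \o line_of) (c t)) X].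

Definition symplectic_leaf P l : set E :=
  [set l' | clos_refl_sym_trans E (hamiltonian_arc P) l l'].

(* The symplectic form of the leaf through [l]: w(P^# a, P^# b) = P(a, b). *)
Definition leaf_form P l X Y (r : R) : Prop :=
  exists a b, [/\ is_sharp (P l) a X, is_sharp (P l) b Y & r = P l a b].

(* Smoothness on an open subset [A] of [parallel_lines v], which is the quotient
   of R^3 by the translations along v. *)
Definition leaf_smooth (v : V3) (A : set E) (f : E -> E) : Prop :=
  forall l, A l -> smooth_at (fun x : V3 => f (line_of (x, v))) l.1.

(* [f] is a symplectomorphism of the open subset [A] of [parallel_lines v]; for
   [X] tangent to [parallel_lines v] at [l], the derivative along [X] of
   [f \o line_of] at [l] only involves the restriction of [f] to
   [parallel_lines v]. *)
Definition leaf_symplectomorphism P (v : V3) (A : set E) (f : E -> E) : Prop :=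
  (exists g : E -> E,
    [/\ forall l, A l -> A (f l) /\ A (g l),
        forall l, A l -> g (f l) = l /\ f (g l) = l,
        leaf_smooth v A f & leaf_smooth v A g]) /\
  (forall l X Y r, A l -> leaf_form P l X Y r ->
     leaf_form P (f l) ('D_X (f \o line_of) l) ('D_Y (f \o line_of) l) r).

(** ** The outer billiard map *)

Definition avoiding S : set E := [set l | olines l /\ points l `&` S = set0].

Definition closest_point l (p q : V3) : Prop :=
  points l q /\ forall x, points l x -> enorm (p - q) <= enorm (p - x).

(* [d] and [W] are the distance and the unit vector from [l] to the point of
   tangency [p] of a plane containing [l] and tangent to [S]. *)
Definition tangency S l (p : V3) (d : R) (W : V3) : Prop :=
  [/\ S p, points l `<=` tangent_plane S p
    & exists q, [/\ closest_point l p q, d = enorm (p - q)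
                  & W = d^-1 *: (p - q)]].

Definition is_outer_billiard S l l' : Prop :=
  exists pp dp Wp pm dm Wm,
    [/\ tangency S l pp dp Wp, tangency S l pm dm Wm,
        positively_oriented Wp Wm l.2
      & l' = line_of (l.1 + (2 * dp) *: Wp, l.2)].

Definition outer_billiard S l : E := xget l (is_outer_billiard S l).

End Lines.

(** * Basic facts *)

Section EuclideanLemmas.
Context {R : realType}.
Implicit Types (u v w : 'rV[R]_3).

Lemma dotC u v : dot u v = dot v u.
Proof. by apply: eq_bigr => i _; rewrite mulrC. Qed.

Lemma dotDl u v w : dot (u + v) w = dot u w + dot v w.
Proof. by rewrite -big_split; apply: eq_bigr => i _; rewrite mxE mulrDl. Qed.

Lemma dotZl (a : R) u v : dot (a *: u) v = a * dot u v.
Proof. by rewrite /dot mulr_sumr; apply: eq_bigr => i _; rewrite mxE mulrA. Qed.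

Lemma dotE u v : dot u v = u 0 0 * v 0 0 + u 0 1 * v 0 1 + u 0 2 * v 0 2.
Proof.
rewrite /dot !big_ord_recl big_ord0 addr0 !addrA.
by congr (_ * _ + _ * _ + _ * _); congr (_ _ _); apply: val_inj.
Qed.

Lemma crossE u v : 
  [/\ cross u v 0 0 = u 0 1 * v 0 2 - u 0 2 * v 0 1,
      cross u v 0 1 = u 0 2 * v 0 0 - u 0 0 * v 0 2 &
      cross u v 0 2 = u 0 0 * v 0 1 - u 0 1 * v 0 0].
Proof.
by rewrite !mxE; split; congr (_ * _ - _ * _); congr (_ _ _); apply: val_inj.
Qed.

Lemma eqrV3 u v : u 0 0 = v 0 0 -> u 0 1 = v 0 1 -> u 0 2 = v 0 2 -> u = v.
Proof.
move=> h0 h1 h2; apply/rowP => -[[|[|[|//]]] hi].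
- by rewrite (_ : Ordinal hi = 0) //; apply: val_inj.
- by rewrite (_ : Ordinal hi = 1) //; apply: val_inj.
- by rewrite (_ : Ordinal hi = 2) //; apply: val_inj.
Qed.

Lemma enormK u : enorm u = 1 <-> dot u u = 1.
Proof.
have du : 0 <= dot u u by apply: sumr_ge0 => i _; rewrite -expr2 sqr_ge0.
split=> [h|h]; last by rewrite /enorm h sqrtr1.
by rewrite -(sqr_sqrtr du) -/(enorm u) h expr1n.
Qed.

Lemma orthonormal_plane v a b : enorm v = 1 -> enorm a = 1 -> dot a v = 0 ->
  enorm b = 1 -> dot b v = 0 ->
  exists c s, [/\ c ^+ 2 + s ^+ 2 = 1, b = c *: a + s *: cross v a
    & cross v b = c *: cross v a - s *: a].
Proof.
move=> /enormK v1 /enormK a1 av /enormK b1 bv.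
have [n0 n1 n2] := crossE v a.
have nv : dot (cross v a) v = 0 by rewrite dotE n0 n1 n2; ring.
have na : dot (cross v a) a = 0 by rewrite dotE n0 n1 n2; ring.
have nn : dot (cross v a) (cross v a) = 1.
  transitivity (dot v v * dot a a - dot a v ^+ 2); last by rewrite v1 a1 av; ring.
  by rewrite !dotE n0 n1 n2; ring.
pose M : 'M[R]_3 := \matrix_(i < 3) [tuple a; cross v a; v]`_i.
have MM : M *m M^T = 1%:M.
  apply/matrixP => i j; rewrite !mxE.
  rewrite (_ : \sum_k _ = dot [tuple a; cross v a; v]`_i [tuple a; cross v a; v]`_j).
    by case: i j => [[|[|[|//]]] ?] [[|[|[|//]]] ?] //=; rewrite ?(dotC a) ?(dotC v) // dotC.
  by apply: eq_bigr => k _; rewrite !mxE.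
have bE : b = dot b a *: a + dot b (cross v a) *: cross v a.
  have : b *m (M^T *m M) = b by rewrite (mulmx1C MM) mulmx1.
  rewrite mulmxA => bM; rewrite -[LHS]bM; apply/rowP => i.
  have bT k : (b *m M^T) 0 k = dot b [tuple a; cross v a; v]`_k.
    by rewrite mxE; apply: eq_bigr => j _; rewrite !mxE.
  have Mk k : M k i = [tuple a; cross v a; v]`_k 0 i by rewrite mxE.
  rewrite mxE !big_ord_recl big_ord0 !bT !Mk /= bv mul0r !addr0.
  by rewrite [RHS]mxE; congr (_ + _); rewrite [RHS]mxE.
exists (dot b a), (dot b (cross v a)); split => //.
  transitivity (dot b b); last by [].
  by rewrite {3}bE dotDl !dotZl; rewrite (dotC a) (dotC (cross v a)); ring.
have cc : cross v (cross v a) = dot a v *: v - dot v v *: a.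
  have [c0 c1 c2] := crossE v (cross v a).
  by apply: eqrV3; rewrite ?c0 ?c1 ?c2 ?n0 ?n1 ?n2 !dotE !mxE; ring.
rewrite {1}bE; move: (dot b a) (dot b (cross v a)) => c s.
rewrite (_ : cross v _ = c *: cross v a + s *: cross v (cross v a)); last first.
  by apply/rowP => i; rewrite !mxE; ring.
by rewrite cc av v1 scale0r sub0r scale1r scalerN.
Qed.

Lemma normalize1 u : enorm u = 1 -> normalize u = u.
Proof. by rewrite /normalize => ->; rewrite invr1 scale1r. Qed.
End EuclideanLemmas.

Section LinesLemmas.
Context {R : realType}.
Implicit Types (u v w x y : 'rV[R]_3) (l : 'rV[R]_3 * 'rV[R]_3).

Lemma olines_line_of (x : 'rV[R]_3 * 'rV[R]_3) : x.2 != 0 -> olines (line_of x).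
Proof.
move=> x2.
have e : enorm (normalize x.2) = 1.
  apply/enormK; rewrite /normalize dotZl dotC dotZl.
  have d : 0 < dot x.2 x.2.
    rewrite lt_neqAle; apply/andP; split; last by apply: sumr_ge0 => i _; rewrite -expr2 sqr_ge0.
    apply: contraNneq x2 => /esym/eqP; rewrite psumr_eq0; last by move=> i _; rewrite -expr2 sqr_ge0.
    by move=> /allP h; apply/eqP/rowP => i; have := h i (mem_index_enum i); rewrite mulf_eq0 orbb mxE => /eqP.
  rewrite mulrA -invfM -expr2 sqr_sqrtr ?ltW // mulVf ?gt_eqF //.
split=> //=; rewrite dotDl -scaleNr dotZl.
by have /enormK -> := e; rewrite mulr1 subrr.
Qed.

Lemma line_of_id l : olines l -> line_of l = l.
Proof. by case: l => x v [/= v1 xv]; rewrite /line_of /= normalize1 // xv scale0r subr0. Qed.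

(* [line_of] identifies two unit vectors exactly when they are on the same orbit
   of the geodesic flow. *)
Lemma line_of_eq x y v w : enorm v = 1 -> enorm w = 1 ->
  line_of (x, v) = line_of (y, w) <-> v = w /\ exists t, y = x + t *: v.
Proof.
move=> v1 w1; rewrite /line_of /= !normalize1 //; split=> [[h e]|[<- [t ->]]].
  subst w; split=> //; exists (dot y v - dot x v).
  by rewrite scalerBl addrCA h [RHS]addrC subrK.
congr pair; rewrite dotDl dotZl; have /enormK -> := v1.
by rewrite mulr1 scalerDl opprD addrACA subrr addr0.
Qed.


Lemma is_derive_rV (f : R -> 'rV[R]_3) (t : R) df : is_derive t 1 f df <->
  forall i, is_derive t 1 (fun s => f s 0 i : R) (df 0 i).
Proof.
split=> [[d <-] i|h].
  by split; [exact: (derivable_mxP _ _ _).1 | rewrite derive_mx // mxE].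
have d : derivable f t 1 by apply/derivable_mxP => i j; rewrite (ord1 i); have [] := h j.
split=> //; apply/rowP => i; rewrite derive_mx // mxE.
by have [_ ->] := h i.
Qed.

Lemma is_derive_dot (f g : R -> 'rV[R]_3) (t : R) df dg :
  is_derive t 1 f df -> is_derive t 1 g dg ->
  is_derive t 1 (fun s => dot (f s) (g s) : R) (dot df (g t) + dot (f t) dg).
Proof.
move=> hf hg.
have coord (h : R -> 'rV[R]_3) dh i : is_derive t 1 h dh ->
    is_derive t 1 (fun s => h s 0 i : R) (dh 0 i).
  by move/is_derive_rV; apply.
have := @is_derive_sum R R R 3 (fun i s => f s 0 i * g s 0 i) t 1
  (fun i => f t 0 i *: dg 0 i + g t 0 i *: df 0 i)
  (fun i => is_deriveM (coord f df i hf) (coord g dg i hg)).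
rewrite fct_sumE => /is_derive_eq; apply.
by rewrite /dot -big_split; apply: eq_bigr => i _; rewrite /= addrC; congr (_ + _); rewrite mulrC.
Qed.

Lemma is_derive_pair (V W : normedModType R) (f : R -> V) (g : R -> W)
    (t : R) df dg :
  is_derive t 1 f df -> is_derive t 1 g dg ->
  is_derive t 1 (fun s => (f s, g s)) (df, dg).
Proof.
move=> [cf <-] [cg <-].
have h : (fun h : R => (h^-1 *: ((f \o shift t) (h *: (1 : R)) - f t),
    h^-1 *: ((g \o shift t) (h *: (1 : R)) - g t))) @ 0^' -->
    ('D_1 f t, 'D_1 g t) by exact: cvg_pair.
split; first by apply/cvg_ex; exists ('D_1 f t, 'D_1 g t).
exact: (@norm_cvg_lim R (V * W)%type _ _ _ h).
Qed.

Lemma Ck_cst (V W : normedModType R) k (D : set V) (c : W) : Ck k D (cst c).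
Proof.
elim: k c => [|k IH] c /=; first by move=> x _; exact: cst_continuous.
split=> // v; have -> : (fun z => 'd (cst c : V -> W) z v) = cst 0 => //.
by apply/funext => z; rewrite diff_cst.
Qed.

Lemma is_diff_affine (c a : 'rV[R]_3) (t : R) :
  is_diff t (fun s : R => c + s *: a) (fun s => s *: a).
Proof.
have h := is_diffD (is_diff_cst c t) (is_diff_scalel t a).
by rewrite add0r in h; exact: h.
Qed.

Lemma is_derive_affine (c a : 'rV[R]_3) (t : R) :
  is_derive t 1 (fun s : R => c + s *: a) a.
Proof.
have [d e] := is_diff_affine c a t.
by split; [exact: diff_derivable | rewrite deriveE // e scale1r].
Qed.

Lemma smooth_at_affine (c a : 'rV[R]_3) (t : R) :
  smooth_at (fun s : R => c + s *: a) t.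
Proof.
exists setT; split=> //; first exact: openT.
have df := is_diff_affine c a.
case=> [|k] /=.
  by move=> s _; apply: differentiable_continuous; have [] := df s.
split=> [s _|v]; first by have [] := df s.
have -> : (fun s => 'd (fun s : R => c + s *: a) s v) = cst (v *: a).
  by apply/funext => s; rewrite diff_val.
exact: Ck_cst.
Qed.

Lemma tangent_vector_parallelP l (a : 'rV[R]_3) X : olines l -> dot a l.2 = 0 ->
  tangent_vector l (cst a) X <-> X = (a, 0).
Proof.
case: l => x v [/= v1 xv] av; split.
  move=> [p [w [_ /= w1 [p0 w0] hJ [_ <-]]]].
  have dp : is_derive (0 : R) 1 p a.
    rewrite (_ : p = fun s => p s + (0 : R) *: w s) //.
    by apply/funext => s; rewrite scale0r addr0.
  have dw : is_derive (0 : R) 1 w 0.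
    rewrite (_ : w = (fun s => p s + (1 : R) *: w s) - p).
      by apply: is_derive_eq; rewrite subrr.
    by apply/funext => s /=; rewrite fctE scale1r addrAC subrr add0r.
  have dd := is_derive_dot dp dw.
  rewrite (_ : (fun s => _) = (fun s => (p s - dot (p s) (w s) *: w s, w s))); last first.
    by apply/funext => s; rewrite /line_of /= normalize1.
  have dZ : is_derive (0 : R) 1 (fun s => dot (p s) (w s) *: w s) 0.
    apply/is_derive_rV => i.
    rewrite (_ : (fun s => _) = (fun s => dot (p s) (w s) : R) * (fun s => w s 0 i : R)).
      have dwi := (is_derive_rV _ _ _).1 dw i.
      apply: (is_derive_eq (is_deriveM dd dwi)).
      rewrite w0 p0 mxE av scaler0 !add0r /dot big1 ?scaler0 // => j _.
      by rewrite mxE mulr0.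
    by apply/funext => s; rewrite mxE.
  by have [_ ->] := is_derive_pair (is_deriveB dp dZ) dw; rewrite subr0.
move=> ->; exists (fun s => x + s *: a), (fun s => v + s *: 0); split => //=.
- by split; exact: smooth_at_affine.
- by move=> s; rewrite scaler0 addr0.
- by rewrite !scale0r !addr0.
- move=> t; rewrite (_ : (fun s => _) = (fun s : R => (x + t *: v) + s *: a)).
    exact: is_derive_affine.
  by apply/funext => s; rewrite scaler0 addr0 addrAC.
rewrite (_ : (fun s => _) = (fun s : R => (x + s *: a, v))); last first.
  apply/funext => s; rewrite /line_of /= scaler0 addr0 normalize1 //.
  by rewrite dotDl dotZl av mulr0 addr0 xv scale0r subr0.
by apply: is_derive_pair; exact: is_derive_affine.
Qed.

(* The canonical Poisson bivector does not depend on the choice of [J]. *)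
Lemma poissonE l (a : 'rV[R]_3) : olines l -> enorm a = 1 -> dot a l.2 = 0 ->
  poisson l = wedge (a, 0) (cross l.2 a, 0).
Proof.
move=> ol a1 av.
have dc : forall b, dot (cross l.2 b) l.2 = 0.
  by move=> b; rewrite dotE; have [-> -> ->] := crossE l.2 b; ring.
have ex : is_poisson_at l (wedge (a, 0) (cross l.2 a, 0)).
  exists (cst a), (a, 0), (cross l.2 a, 0); split=> //.
  - split; last by move=> t; exact: is_derive_cst.
    have d1 (b : 'rV[R]_3) : derive1 (cst b : R -> _) = cst 0.
      by apply/funext => t; rewrite derive1E derive_cst.
    split=> //= [t|t]; rewrite d1 ?d1 //; exact: derivable_cst.
  - exact/tangent_vector_parallelP.
  - exact/(tangent_vector_parallelP _ ol (dc a)).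
have : is_poisson_at l (poisson l) by apply: xgetPex; exists (wedge (a, 0) (cross l.2 a, 0)).
move=> [J [X [Y [[[_ _ _ Jv] Jpar] J1 XJ YJ ->]]]].
have JE : J = cst (J 0).
  apply/funext => t; apply/rowP => i.
  by apply: (@is_derive_0_is_cst _ (fun s => J s 0 i)) => s;
    have := (is_derive_rV _ _ _).1 (Jpar s) i; rewrite mxE.
move: (Jv 0) (J1 0) XJ YJ; rewrite JE /=; move: (J 0) => b bv b1.
move=> /(tangent_vector_parallelP _ ol bv) ->.
move=> /(tangent_vector_parallelP _ ol (dc b)) ->.
have [c [s [cs bE nE]]] := orthonormal_plane ol.1 a1 av b1 bv.
apply/funext => al; apply/funext => be; rewrite /wedge.
have E (f : {linear ('rV[R]_3 * 'rV[R]_3)%type -> R^o}) :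
    f (b, 0) = c * f (a, 0) + s * f (cross l.2 a, 0) /\
    f (cross l.2 b, 0) = c * f (cross l.2 a, 0) - s * f (a, 0).
  have P z z' p q : f (p *: z + q *: z', 0) = p * f (z, 0) + q * f (z', 0).
    rewrite -[p * _]/(p *: _) -[q * _]/(q *: _) -!linearZ -linearD; congr (f _).
    by congr pair; rewrite /= !scaler0 addr0.
  by split; [rewrite {1}bE P | rewrite nE -scaleNr P mulNr].
have [-> ->] := E al; have [-> ->] := E be.
transitivity ((c ^+ 2 + s ^+ 2) * (al (a, 0) * be (cross l.2 a, 0) -
   al (cross l.2 a, 0) * be (a, 0))); first by ring.
by rewrite cs mul1r.
Qed.
End LinesLemmas.

(* Main.v *)
From HB Require Import structures.
Require Import Defs.
From mathcomp Require Import all_boot all_order all_algebra.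
From mathcomp Require Import all_classical all_reals all_analysis.
From mathcomp Require Import perm ring lra.
From Stdlib Require Import Relation_Operators.
Set Implicit Arguments.
Unset Strict Implicit.
Unset Printing Implicit Defensive.
Import Order.TTheory GRing.Theory Num.Theory.
Import numFieldNormedType.Exports.
Local Open Scope classical_set_scope.
Local Open Scope ring_scope.

(* On the leaf of lines with direction [v], i.e. in the plane orthogonal to [v],
   the billiard map is [x |-> 2 p(x) - x], where [p(x)] is the (projected) point
   of tangency.  Moving [x] along the tangent line does not change [p], and [dp]
   has its values in the direction of that line, so [dp] is nilpotent on the
   leaf and the differential [2 dp - 1] has determinant 1.  As directions are
   preserved, this gives the invariance of the Poisson bivector.

   The points of tangency exist and are unique because [S] lies strictly on one
   side of each of its tangent planes (Hadamard).  Indeed all critical points of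
   a height function on [S] are nondegenerate extrema, so by a mountain pass
   argument a height function has only one local minimum.  A line avoiding [S]
   is separated from [S] by a plane, and the point of tangency is found by
   minimizing a slope over [S].  It depends smoothly on the line by implicit
   differentiation, the relevant partial differential being the second
   fundamental form. *)

(** * Mountain passes *)

(** Tangency is used in the form [0 <= trip w (p - x) (y - x)] for all [y] in [S]: the plane through
    the line and [p] has [S] on one side, and the sign selects [p_+]. The condition depends only on
    the oriented line and makes sense for all [w <> 0], that is, on an open set of pairs, where
    smoothness of a map composed with [line_of] is tested.

    The hypothesis on [S] is purely local, so convexity has to be proved, and with it what outside
    means: a point [z] is outside if [S] lies beyond the plane through its nearest point [p] of [S],
    orthogonal to [p - z].

    At [l] the Poisson bivector is the wedge of two vectors tangent to the leaf. Its push-forward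
    therefore involves only derivatives of the billiard map along the leaf, and since the direction
    of the line is kept, one orthonormal frame serves at [l] and at its image.

    Reversing the orientation of a line exchanges [p_+] and [p_-]. Hence the inverse of the billiard
    map is its conjugate by the reversal, and inherits smoothness from it. *)

Section MountainPass.
Context {R : realType} {T : pseudoMetricType R}.
Implicit Types (S C F G : set T) (h : T -> R) (y z p q : T).

(** Connected sets replace paths, so joining is transitive by union. The single level [e] keeps the
    whole set away from [c], which lets it contradict an infimum. *)
Definition joined_below S h (c : R) y z : Prop :=
  exists C, [/\ connected C, C `<=` S, C y, C z &
    exists2 e, e < c & forall x, C x -> h x <= e].

Definition strict_local_min S h y : Prop :=
  exists N, open_nbhs y N /\ forall z, S z -> N z -> z <> y -> h y < h z.

(* Satisfied by regular points and strict local maxima, but not by saddles. *)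
Definition passable S h y : Prop :=
  exists N, [/\ open_nbhs y N,
    forall z, S z -> N z -> h z <= h y -> closure (S `&` [set x | h x < h y]) z
    & forall z z', S z -> S z' -> N z -> N z' -> h z < h y -> h z' < h y ->
        joined_below S h (h y) z z'].

Lemma joined_below_sym S h c y z :
  joined_below S h c y z -> joined_below S h c z y.
Proof. by move=> [C [cC CS Cy Cz he]]; exists C. Qed.

Lemma joined_below_trans S h c x y z :
  joined_below S h c x y -> joined_below S h c y z -> joined_below S h c x z.
Proof.
move=> [C [cC CS Cx Cy [e ec he]]] [C' [cC' CS' Cy' Cz' [e' ec' he']]].
exists (C `|` C'); split.
- by apply: connectedU => //; exists y.
- by rewrite subUset.
- by left.
- by right.
exists (Num.max e e'); first by rewrite gt_max ec.
by move=> t [/he|/he'] ht; rewrite le_max ht ?orbT.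
Qed.

(** By normality [F] and [G] have disjoint open neighborhoods. The part of [S] outside both is
    compact, so [h] has a minimum there, larger than [c]; below a level in between, a connected set
    stays in one of the neighborhoods. *)
Lemma sublevel_separation S h F G (c : R) p q :
  compact S -> continuous h -> closed F -> closed G -> F `&` G = set0 ->
  (forall y, S y -> h y <= c -> F y \/ G y) -> F p -> G q ->
  exists2 e, c < e & forall C, connected C -> C `<=` S ->
    (forall x, C x -> h x <= e) -> C p -> C q -> False.
Proof.
move=> cS hc cF cG FG0 FG Fp Gq.
have [U [V [oU oV FU GV UV0]]] :=
  (normal_openP (R := R)).1 (@pseudometric_normal R T) F G cF cG FG0.
have cK : compact (S `&` ~` (U `|` V)).
  by apply: compact_closedI => //; exact/open_closedC/openU.
have CU (e : R) : (forall x, S x -> h x <= e -> U x \/ V x) ->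
    forall C, connected C -> C `<=` S -> (forall x, C x -> h x <= e) ->
    C p -> C q -> False.
  move=> eUV C conC CS Ce Cp Cq.
  have sUV : separated U V.
    split; apply: contrapT => /eqP/set0P[x [xU xV]].
      have [t [Ut Vt]] := xU V (open_nbhs_nbhs (conj oV xV)).
      by have : (U `&` V) t by []; rewrite UV0.
    have [t [Vt Ut]] := xV U (open_nbhs_nbhs (conj oU xU)).
    by have : (U `&` V) t by []; rewrite UV0.
  have [] := connected_subset (C := C) sUV _ conC.
  - by move=> x Cx; exact: eUV (CS _ Cx) (Ce _ Cx).
  - by move=> CU'; have [] : set0 q by rewrite -UV0; split; [exact: CU'|exact: GV].
  - by move=> CV; have [] : set0 p by rewrite -UV0; split; [exact: FU|exact: CV].
have [K0|/set0P K0] := eqVneq (S `&` ~` (U `|` V)) set0.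
  (* If [U] and [V] already cover [S], any level above [c] will do. *)
  exists (c + 1); first by rewrite ltrDl.
  apply: CU => x Sx _; apply: contrapT => xUV.
  by have : (S `&` ~` (U `|` V)) x by []; rewrite K0.
have [m /set_mem[Sm mUV] hm] := compact_EVT_min K0 cK
  (continuous_subspaceT hc).
have cm : c < h m.
  rewrite ltNge; apply/negP => /(FG _ Sm) [/FU|/GV] ?; apply: mUV; by [left|right].
exists ((c + h m) / 2); first by rewrite (midf_lt cm).1.
apply: CU => x Sx hx; apply: contrapT => xUV.
have := le_trans (hm x (mem_set (conj Sx xUV))) hx.
by rewrite leNgt (midf_lt cm).2.
Qed.

(* Mountain pass: let [c] be the infimum of the levels below which [p] and [q]
   are joined, and [U] the set of points joined to [p] strictly below [c].  As no
   point at level [c] is a saddle, [closure U] and its complement in the sublevel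
   set [h <= c] are both closed, so [p] and [q] stay separated slightly above [c]. *)
Lemma strict_local_min_unique S h p q :
  hausdorff_space T -> compact S -> connected S -> continuous h ->
  (forall y, S y -> forall e, h y < e -> exists2 N, nbhs y N &
     forall z, S z -> N z -> exists C, [/\ connected C, C `<=` S, C y, C z &
       forall x, C x -> h x <= e]) ->
  (forall y, S y -> strict_local_min S h y \/ passable S h y) ->
  S p -> S q -> strict_local_min S h p -> strict_local_min S h q -> p = q.
Proof.
move=> hT cS conS hc loc alt Sp Sq minp minq; apply: contrapT => pq.
have clS := compact_closed hT cS.
have cl1 (x : T) : closed [set x].
  exact: (accessible_closed_set1 (hausdorff_accessible hT)).
pose E := [set c | exists C, [/\ connected C, C `<=` S, C p, C q &
       forall x, C x -> h x <= c]].
have Elb c : E c -> h p <= c /\ h q <= c.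
  by move=> [C [_ _ Cp Cq hC]]; split; exact: hC.
have E0 : E !=set0.
  have [m _ hm] := compact_EVT_max (ex_intro _ p Sp) cS (continuous_subspaceT hc).
  by exists (h m), S; split=> // x Sx; apply: hm; exact: mem_set.
have Einf : has_inf E by split=> //; exists (h p) => c /Elb[].
pose c := inf E; pose X := S `&` [set x | h x <= c].
have hpc : h p <= c by apply: lb_le_inf => // x /Elb[].
have hqc : h q <= c by apply: lb_le_inf => // x /Elb[].
have Ec x : E x -> c <= x by move=> Ex; apply: ge_inf => //; have [] := Einf.
have clX : closed X.
  apply: closedI => //; apply: (closed_comp (f := h) (D := [set x | x <= c])).
    by move=> x _; exact: hc.
  exact: closed_le.
(* Since [c] is an infimum, [p] and [q] are joined below any level above [c]; so [X] cannot be split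
   into disjoint closed sets, one around [p] and one around [q]. *)
have key F G : closed F -> closed G -> F `&` G = set0 ->
    (forall y, X y -> F y \/ G y) -> F p -> G q -> False.
  move=> cF cG FG0 FG Fp Gq.
  have [e ce he] := sublevel_separation cS hc cF cG FG0
    (fun y Sy hy => FG y (conj Sy hy)) Fp Gq.
  have [x [C [conC CS Cp Cq hC]] xe] := inf_lt E0 ce.
  by apply: (he C) => // y /hC/le_trans; apply; exact: ltW.
(* A strict local minimum at level [c] is an isolated point of [X]. This settles the cases where [c]
   equals [h p] or [h q]. *)
have isolated x : strict_local_min S h x -> h x = c ->
    exists2 G, closed G & [set x] `&` G = set0 /\ forall y, X y -> y = x \/ G y.
  move=> [N [[oN Nx] hN]] hx; exists (X `&` ~` N).
    by apply: closedI => //; exact: open_closedC.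
  split; first by apply/seteqP; split=> // z [-> []].
  move=> y [Sy hy]; have [->|yx] := pselect (y = x); [by left | right].
  by split=> // Ny; have := hN y Sy Ny yx; rewrite hx ltNge hy.
have [hpe|hpn] := eqVneq (h p) c.
  have [G cG [pG XG]] := isolated p minp hpe.
  apply: (key [set p] G) => //.
  by have [/esym|] := XG q (conj Sq hqc).
have [hqe|hqn] := eqVneq (h q) c.
  have [G cG [qG XG]] := isolated q minq hqe.
  apply: (key G [set q]) => //; first by rewrite setIC.
    by move=> y /XG[]; [right|left].
  by have [|] := XG p (conj Sp hpc).
have {hpn}hpc' : h p < c by rewrite lt_neqAle hpn.
have {hqn}hqc' : h q < c by rewrite lt_neqAle hqn.
pose J := joined_below S h c; pose U := [set y | J p y].
have US y : U y -> S y /\ h y < c.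
  by move=> [C [_ CS _ Cy [e ec he]]]; split; [exact: CS | apply: le_lt_trans ec; exact: he].
have locJ y : S y -> h y < c -> exists2 N, nbhs y N & forall z, S z -> N z -> J y z.
  move=> Sy hy; have [|N nN hN] := loc y Sy ((h y + c) / 2); first by rewrite (midf_lt hy).1.
  exists N => // z Sz /(hN z Sz)[C [conC CS Cy Cz hC]]; exists C; split=> //.
  by exists ((h y + c) / 2); rewrite ?(midf_lt hy).2.
have UX : closure U `<=` X.
  rewrite (_ : X = closure X); last exact: (iffLR (closure_id _)).
  by apply: closureS => y /US[? /ltW].
have closureU y : S y -> h y < c -> closure U y -> U y.
  move=> Sy hy Fy; have [N nN hN] := locJ y Sy hy.
  have [z [Uz Nz]] := Fy N nN.
  apply: (joined_below_trans Uz); apply: joined_below_sym.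
  by apply: hN => //; have [] := US z Uz.
apply: (key (closure U) (X `\` closure U)).
- exact: closed_closure.
(* A point [y] adherent to both pieces has level [c]: below [c] it would be joined to each of them.
   A strict minimum has no lower points nearby, and a passable point joins the lower points of the
   two pieces. *)
- move=> y Gy.
  have [Sy hy] : X y by apply: clX; exact: closureS Gy => ? [].
  split=> // Fy; have [hyc|hyc] := ltrP (h y) c.
    have Uy := closureU y Sy hyc Fy; have [N nN hN] := locJ y Sy hyc.
    have [z [[[Sz _] nFz] Nz]] := Gy N nN; apply: nFz; apply: subset_closure.
    exact: (joined_below_trans Uy (hN z Sz Nz)).
  have {hyc}hyc : h y = c by apply/eqP; rewrite eq_le hyc andbT.
  have [[N [nN hN]]|[N [nN Ncl NJ]]] := alt y Sy.
    have [z [Uz Nz]] := Fy N (open_nbhs_nbhs nN).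
    have [Sz hz] := US z Uz.
    have := hN z Sz Nz; rewrite hyc => hz'.
    have : z <> y by move=> zy; rewrite zy hyc ltxx in hz.
    by move=> /hz'; rewrite ltNge ltW.
  have [z [Uz Nz]] := Fy N (open_nbhs_nbhs nN).
  have [z' [[[Sz' hz'] nFz'] Nz']] := Gy N (open_nbhs_nbhs nN).
  have [Sz hz] := US z Uz.
  apply: nFz' => B nB; rewrite -hyc in hz'.
  have [|t [[St ht] [Bt Nt]]] := Ncl z' Sz' Nz' hz' (B `&` N).
    by apply: filterI => //; apply: open_nbhs_nbhs; split=> //; have [] := nN.
  exists t; split=> //; apply: (joined_below_trans Uz); rewrite /J -hyc.
  by apply: NJ => //; rewrite hyc.
- by rewrite setDE setICA setICr setI0.
- by move=> y Xy; have [|] := pselect (closure U y); [left|right].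
- apply: subset_closure; exists [set p]; split=> //.
  + exact: connected1.
  + by move=> _ ->.
  + by exists (h p) => // _ ->.
- split; first by split.
  move=> /(closureU q Sq hqc')[C [conC CS Cp Cq [e ec he]]].
  by have := Ec e (ex_intro _ C (And5 conC CS Cp Cq he)); rewrite leNgt ec.
Qed.
End MountainPass.

(** * Calculus of C^k maps *)

Section DiffCriteria.
Context {R : realType} {V W : normedModType R}.
Implicit Types (f g : V -> W) (x : V).

Lemma is_diff_epsP f (L : {linear V -> W}) x : continuous L ->
  is_diff x f L <->
  forall e : R, 0 < e -> \forall h \near (0 : V), `|f (h + x) - f x - L h| <= e * `|h|.
Proof.
move=> cL; split.
  move=> [df dL] e e0.
  have /diff_locally/eqaddoP/(_ e e0) := df; rewrite dL => E.
  near=> h; have : `|(f \o shift x - (cst (f x) + L)) h| <= e * `|h|.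
    by near: h; exact: E.
  by rewrite /= opprD addrA.
move=> H.
have E : f \o shift x = cst (f x) + L +o_ 0 id.
  apply/eqaddoP => e e0; near=> h.
  rewrite /= opprD addrA; near: h; exact: H.
have dE := diff_unique cL E.
by split => //; apply/diff_locallyP; rewrite dE; split.
Unshelve. all: by end_near. Qed.

Lemma near_is_diff f g x df : {near x, f =1 g} -> is_diff x f df -> is_diff x g df.
Proof.
move=> fg dfx; have [ef ed] := dfx; rewrite -ed in dfx *.
have cL := diff_continuous ef.
apply/(is_diff_epsP _ _ cL) => e e0.
have /(is_diff_epsP _ _ cL)/(_ e e0) H := dfx.
have fgx := nbhs_singleton fg.
have : \forall h \near (0 : V), f (h + x) = g (h + x).
  have : (fun h : V => h + x) @ (0 : V) --> x.
    rewrite -[X in _ --> X]add0r; apply: cvgD; [exact: cvg_id|exact: cvg_cst].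
  by move=> /(_ _ fg).
move=> fg0; near=> h.
by rewrite -fgx -(near fg0 h)//; near: h; exact: H.
Unshelve. all: by end_near. Qed.

End DiffCriteria.

Section CkCalculus.
Context {R : realType}.
Implicit Types (V W : normedModType R) (k : nat).

Lemma Ck_ext V W k (D : set V) (f g : V -> W) :
  open D -> {in D, f =1 g} -> Ck k D f -> Ck k D g.
Proof.
move=> oD; elim: k f g => [|k IH] f g fg.
  move=> cf x Dx.
  have nfg : {near x, f =1 g}.
    by apply: filterS (open_nbhs_nbhs (conj oD Dx)) => y Dy; apply/fg/mem_set.
  have := cf x Dx; rewrite /prop_for /continuous_at (fg x (mem_set Dx)).
  by apply: cvg_trans; apply: near_eq_cvg; apply: filterS nfg => y ->.
move=> [df Cf].
have dg x : D x -> is_diff x g ('d f x).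
  move=> Dx; apply: near_is_diff (differentiableP (df x Dx)).
  by apply: filterS (open_nbhs_nbhs (conj oD Dx)) => y Dy; apply/fg/mem_set.
split=> [x /dg[]//|v]; apply: IH (Cf v) => x /set_mem/dg[_ ->//].
Qed.

Lemma Ck_sub V W k (D D' : set V) (f : V -> W) : D' `<=` D -> Ck k D f -> Ck k D' f.
Proof.
move=> DD; elim: k f => [|k IH] f /= => [cf x /DD/cf//|[df Cf]].
by split=> [x /DD/df//|v]; exact: IH.
Qed.

Lemma Ck_continuous V W k (D : set V) (f : V -> W) x :
  Ck k D f -> D x -> {for x, continuous f}.
Proof.
case: k => [|k] /= => [cf /cf//|[df _] /df].
exact: differentiable_continuous.
Qed.

Lemma CkS V W k (D : set V) (f : V -> W) : Ck k.+1 D f -> Ck k D f.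
Proof.
elim: k f => [|k IH] f Cf; first by move=> x; exact: Ck_continuous Cf.
by case: Cf => df Cf; split=> // v; exact: IH.
Qed.

(** The differential is given by a formula valid on [D], the form in which the closure rules below
    run their inductions. *)
Lemma CkS_is_diff V W k (D : set V) (f : V -> W) (df : V -> V -> W) :
  open D -> (forall x, D x -> is_diff x f (df x)) ->
  (forall v, Ck k D (fun x => df x v)) -> Ck k.+1 D f.
Proof.
move=> oD dfx Cdf; split=> [x /dfx[]//|v].
by apply: Ck_ext (Cdf v) => // x /set_mem/dfx[_ ->].
Qed.

Lemma CkD V W k (D : set V) (f g : V -> W) : open D ->
  Ck k D f -> Ck k D g -> Ck k D (f + g).
Proof.
move=> oD; elim: k f g => [|k IH] f g /=.
  by move=> cf cg x Dx; apply: continuousD; [exact: cf|exact: cg].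
move=> [df Cf] [dg Cg].
refine (@CkS_is_diff V W k D (f + g) (fun x v => 'd f x v + 'd g x v) oD _ _).
  move=> x Dx; have := differentiableP (df x Dx); have := differentiableP (dg x Dx).
  by move=> ? ?; exact: is_diffD.
by move=> v; exact: IH.
Qed.

Lemma Ck_sum V W k (D : set V) n (f : 'I_n -> V -> W) : open D ->
  (forall i, Ck k D (f i)) -> Ck k D (fun x => \sum_i f i x).
Proof.
move=> oD; elim: n f => [|n IH] f Cf.
  rewrite (_ : (fun x => _) = cst 0); first exact: Ck_cst.
  by apply/funext => x; rewrite big_ord0.
rewrite (_ : (fun x => _) = (fun x => \sum_(i < n) f (widen_ord (leqnSn n) i) x) + f ord_max).
  by apply: CkD => //; exact: IH.
by apply/funext => x; rewrite big_ord_recr.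
Qed.

Lemma Ck_linear V W (Z : normedModType R) k (D : set V) (f : V -> W)
    (L : {linear W -> Z}) : open D -> continuous L ->
  Ck k D f -> Ck k D (L \o f).
Proof.
move=> oD cL; elim: k f => [|k IH] f /=.
  by move=> cf x Dx; apply: continuous_comp; [exact: cf|exact: cL].
move=> [df Cf]; apply: (CkS_is_diff (df := fun x => L \o 'd f x)) => //.
  move=> x Dx; have dfx := differentiableP (df x Dx).
  have dL : is_diff (f x) L L.
    by split; [exact: linear_differentiable | exact: diff_lin].
  exact: is_diff_comp.
by move=> v; exact: IH.
Qed.

Lemma CkB V W k (D : set V) (f g : V -> W) : open D ->
  Ck k D f -> Ck k D g -> Ck k D (f - g).
Proof.
move=> oD Cf Cg; apply: CkD => //.
rewrite (_ : - g = (-%R : W -> W) \o g) //.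
by apply: Ck_linear => //; exact: opp_continuous.
Qed.

Lemma Ck_affine V W k (D : set V) (L : {linear V -> W}) (c : W) : open D -> continuous L ->
  Ck k D (fun x => c + L x).
Proof.
move=> oD cL; apply: (@CkD _ _ _ _ (cst c) L) => //; first exact: Ck_cst.
case: k => [x _|k]; first exact: cL.
apply: (CkS_is_diff (df := fun x => L)) => //.
  by move=> x Dx; split; [exact: linear_differentiable | exact: diff_lin].
by move=> v; exact: Ck_cst.
Qed.

Lemma Ck_id V k (D : set V) : open D -> Ck k D id.
Proof.
move=> oD; have cid : continuous (idfun : V -> V) by move=> x; exact: cvg_id.
have := @Ck_affine V V k D idfun 0 oD cid.
by rewrite (_ : (fun x => _) = id) //; apply/funext => x; rewrite add0r.
Qed.

(** With an affine inner map, the differential in direction [v] is a composite of the same shape,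
    with the constant vector [L v]; so the induction closes in arbitrary normed spaces. *)
Lemma Ck_comp_affine V W (Z : normedModType R) k (D : set W) (f : W -> Z)
    (L : {linear V -> W}) (c : W) : open D -> continuous L ->
  Ck k D f -> Ck k [set x | D (c + L x)] (fun x => f (c + L x)).
Proof.
move=> oD cL.
have dA x : is_diff x (fun x => c + L x) L.
  have dL : is_diff x L L.
    by split; [exact: linear_differentiable | exact: diff_lin].
  by have := is_diffD (is_diff_cst c x) dL; rewrite add0r; exact.
have cA : continuous (fun x => c + L x).
  by move=> x; apply: differentiable_continuous; have [] := dA x.
have oD' : open [set x | D (c + L x)] by apply: open_comp => // x _; exact: cA.
elim: k f => [|k IH] f /=.
  by move=> cf x Dx; apply: (continuous_comp (f := fun x => c + L x)); [exact: cA|exact: cf].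
move=> [df Cf].
apply: (CkS_is_diff (df := fun x => 'd f (c + L x) \o L)) => //.
  move=> x Dx; have dfx := differentiableP (df _ Dx).
  by have dAx := dA x; exact: (is_diff_comp dAx dfx).
by move=> v; exact: (IH (fun y => 'd f y (L v))).
Qed.

Lemma Ck_pair V W (Z : normedModType R) k (D : set V) (f : V -> W) (g : V -> Z) :
  open D -> Ck k D f -> Ck k D g -> Ck k D (fun x => (f x, g x)).
Proof.
move=> oD; elim: k f g => [|k IH] f g /=.
  by move=> cf cg x Dx; apply: cvg_pair; [exact: cf|exact: cg].
move=> [df Cf] [dg Cg].
apply: (CkS_is_diff (df := fun x y => ('d f x y, 'd g x y))) => //.
  move=> x Dx; have dfx := differentiableP (df x Dx).
  by have dgx := differentiableP (dg x Dx); exact: is_diff_pair.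
by move=> v; exact: IH.
Qed.

Lemma CkM V k (D : set V) (f g : V -> R) : open D ->
  Ck k D f -> Ck k D g -> Ck k D (f * g).
Proof.
move=> oD; elim: k f g => [|k IH] f g.
  by move=> cf cg x Dx; apply: continuousM; [exact: cf|exact: cg].
move=> Cf Cg; have [df Cdf] := Cf; have [dg Cdg] := Cg.
refine (@CkS_is_diff V R k D (f * g)
  (fun x v => f x * 'd g x v + g x * 'd f x v) oD _ _).
  move=> x Dx; have dfx := differentiableP (df x Dx).
  by have dgx := differentiableP (dg x Dx); exact: is_diffM.
move=> v; apply: (@CkD V R k D (f * (fun x => 'd g x v)) (g * (fun x => 'd f x v)) oD).
  by apply: IH; [exact: CkS|exact: Cdg].
by apply: IH; [exact: CkS|exact: Cdf].
Qed.

(** The differential is a polynomial in the inverse itself and ['d f]; the class of the former is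
    the induction hypothesis. *)
Lemma CkV V k (D : set V) (f : V -> R) : open D -> (forall x, D x -> f x != 0) ->
  Ck k D f -> Ck k D (fun x => (f x)^-1).
Proof.
move=> oD f0; elim: k => [|k IH] Cf.
  by move=> x Dx; apply: continuousV; [exact: f0|exact: Cf].
have [df Cdf] := Cf.
refine (@CkS_is_diff V R k D _ (fun x v => - (f x) ^- 2 * 'd f x v) oD _ _).
  move=> x Dx; split; first exact: differentiableV (df x Dx) (f0 x Dx).
  by rewrite diffV//; [exact: df|exact: f0].
move=> v; have Ci := IH (CkS Cf).
apply: Ck_ext (CkM oD (CkB oD (Ck_cst _ _ 0) (CkM oD Ci Ci)) (Cdf v)) => // x _.
by rewrite -exprVn expr2 -[- _ in RHS]sub0r.
Qed.

Lemma Ck_sqrt V k (D : set V) (f : V -> R) : open D -> (forall x, D x -> 0 < f x) ->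
  Ck k D f -> Ck k D (fun x => Num.sqrt (f x)).
Proof.
move=> oD f0; elim: k => [|k IH] Cf.
  by move=> x Dx; apply: continuous_comp; [exact: Cf|exact: sqrt_continuous].
have [df Cdf] := Cf; have Cs := IH (CkS Cf).
refine (@CkS_is_diff V R k D _ (fun x v => 'd f x v * (2 * Num.sqrt (f x))^-1) oD _ _).
  move=> x Dx; have dfx := differentiableP (df x Dx).
  have [ds es] := is_derive1_sqrt (f0 x Dx).
  have dsx : is_diff (f x) (@Num.sqrt R) ( *:%R^~ (2 * Num.sqrt (f x))^-1).
    by split; [exact/derivable1_diffP | rewrite deriv1E// derive1E es].
  exact: (is_diff_comp dfx dsx).
move=> v; apply: (CkM oD (Cdf v)); apply: CkV => //.
  by move=> x Dx; rewrite mulf_neq0// gt_eqF// sqrtr_gt0 f0.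
apply: (CkM oD) => //; exact: Ck_cst.
Qed.

End CkCalculus.

(** * Coordinates of row vectors and the chain rule through them *)

Section RowVectors.
Context {R : realType}.
Implicit Types (V W : normedModType R) (k n : nat).

Definition coordinate n (i : 'I_n) (u : 'rV[R]_n) : R := u 0 i.

Lemma coordinate_is_linear n (i : 'I_n) : linear (coordinate i).
Proof. by move=> a u v; rewrite /coordinate !mxE. Qed.

HB.instance Definition _ n (i : 'I_n) :=
  GRing.isLinear.Build R 'rV[R]_n R *:%R (coordinate i) (@coordinate_is_linear n i).

Definition scale_vector V (w : V) (a : R) : V := a *: w.

Lemma scale_vector_is_linear V (w : V) : linear (scale_vector w).
Proof. by move=> a u v; rewrite /scale_vector scalerDl scalerA. Qed.

HB.instance Definition _ V (w : V) :=
  GRing.isLinear.Build R R V *:%R (scale_vector w) (@scale_vector_is_linear V w).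

Lemma Ck_coordinate V k n (D : set V) (f : V -> 'rV[R]_n) (i : 'I_n) : open D ->
  Ck k D f -> Ck k D (fun x => f x 0 i : R).
Proof.
move=> oD; apply: (@Ck_linear R V _ R k D f (coordinate i)) => //.
exact: coord_continuous.
Qed.

Lemma Ck_scale_vector V W k (D : set V) (f : V -> R) (w : W) : open D ->
  Ck k D f -> Ck k D (fun x => f x *: w).
Proof.
move=> oD; apply: (@Ck_linear R V _ W k D f (scale_vector w)) => //.
exact: scalel_continuous.
Qed.

Lemma Ck_row V k n (D : set V) (f : V -> 'rV[R]_n) : open D ->
  (forall i, Ck k D (fun x => f x 0 i : R)) -> Ck k D f.
Proof.
move=> oD Cf; rewrite (_ : f = fun x => \sum_i f x 0 i *: delta_mx 0 i).
  by apply: Ck_sum => // i; exact: Ck_scale_vector.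
by apply/funext => x; exact: row_sum_delta.
Qed.

(** In ['d g (f x) ('d f x v)] the vector argument moves with [x]. Expanding it in coordinates
    leaves differentials of [g] along fixed vectors, to which the induction hypothesis applies. *)
Lemma Ck_comp_row V k n (D : set V) (E : set 'rV[R]_n) (f : V -> 'rV[R]_n)
    (g : 'rV[R]_n -> R) : open D -> open E -> (forall x, D x -> E (f x)) ->
  Ck k D f -> Ck k E g -> Ck k D (g \o f).
Proof.
move=> oD oE DE; elim: k g => [|k IH] g.
  by move=> cf cg x Dx; apply: continuous_comp; [exact: cf|apply: cg; exact: DE].
move=> Cf Cg; have [df Cdf] := Cf; have [dg Cdg] := Cg.
refine (@CkS_is_diff R V R k D _
  (fun x v => \sum_i 'd f x v 0 i * 'd g (f x) (delta_mx 0 i)) oD _ _).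
  move=> x Dx; have dfx := differentiableP (df x Dx).
  have dgx := differentiableP (dg _ (DE x Dx)).
  have [d e] := is_diff_comp dfx dgx; split=> //.
  rewrite e; apply/funext => v /=.
  rewrite [in LHS](row_sum_delta ('d f x v)) linear_sum; apply: eq_bigr => i _.
  by rewrite linearZ.
move=> v; apply: Ck_sum => // i.
apply: (@CkM R V k D (fun x => 'd f x v 0 i) (fun x => 'd g (f x) (delta_mx 0 i)) oD).
  by apply: Ck_coordinate => //; exact: Cdf.
exact: (IH _ (CkS Cf) (Cdg _)).
Qed.

End RowVectors.

(** * Vector algebra in dimension 3 and smoothness of [line_of] *)

Section Vectors3.
Context {R : realType}.
Local Notation V3 := 'rV[R]_3.
Local Notation E := (V3 * V3)%type.
Implicit Types (V : normedModType R) (k : nat) (u v w a b : V3).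

(** The determinant of [w], [a], [b]. With [w] the direction of a line, its sign orders [a] and [b]
    around the line. *)
Definition trip w a b : R := dot (cross w a) b.

Lemma Ck_dot V k (D : set V) (f g : V -> V3) : open D ->
  Ck k D f -> Ck k D g -> Ck k D (fun x => dot (f x) (g x) : R).
Proof.
move=> oD Cf Cg; apply: Ck_sum => // i.
by apply: (CkM oD); exact: Ck_coordinate.
Qed.

Lemma Ck_scale V k n (D : set V) (f : V -> R) (g : V -> 'rV[R]_n) : open D ->
  Ck k D f -> Ck k D g -> Ck k D (fun x => f x *: g x).
Proof.
move=> oD Cf Cg; apply: Ck_row => // i.
rewrite (_ : (fun x => _) = f * (fun x => g x 0 i)).
  by apply: (CkM oD) => //; exact: Ck_coordinate.
by apply/funext => x; rewrite mxE.
Qed.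

Lemma Ck_cross V k (D : set V) (f g : V -> V3) : open D ->
  Ck k D f -> Ck k D g -> Ck k D (fun x => cross (f x) (g x)).
Proof.
move=> oD Cf Cg; apply: Ck_row => // i.
rewrite (_ : (fun x => _) = (fun x => f x 0 (i + 1)) * (fun x => g x 0 (i + 2)) -
  (fun x => f x 0 (i + 2)) * (fun x => g x 0 (i + 1))).
  by apply: CkB => //; apply: CkM => //; exact: Ck_coordinate.
by apply/funext => x; rewrite mxE.
Qed.

Lemma Ck_trip V k (D : set V) (f g h : V -> V3) : open D ->
  Ck k D f -> Ck k D g -> Ck k D h -> Ck k D (fun x => trip (f x) (g x) (h x) : R).
Proof. by move=> oD Cf Cg Ch; apply: Ck_dot => //; exact: Ck_cross. Qed.

Lemma dot_ge0 u : 0 <= dot u u.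
Proof. by apply: sumr_ge0 => i _; rewrite -expr2 sqr_ge0. Qed.

Lemma dot_eq0 u : (dot u u == 0) = (u == 0).
Proof.
apply/eqP/eqP => [|->]; last by rewrite /dot big1 // => i _; rewrite mxE mul0r.
move/eqP; rewrite psumr_eq0; last by move=> i _; rewrite -expr2 sqr_ge0.
move=> /allP h; apply/rowP => i; have := h i (mem_index_enum i).
by rewrite mulf_eq0 orbb mxE => /eqP.
Qed.

Lemma dot_gt0 u : (0 < dot u u) = (u != 0).
Proof. by rewrite lt_neqAle dot_ge0 andbT eq_sym dot_eq0. Qed.

Lemma Ck_normalize V k (D : set V) (f : V -> V3) : open D ->
  (forall x, D x -> f x != 0) -> Ck k D f -> Ck k D (fun x => normalize (f x)).
Proof.
move=> oD f0 Cf; apply: Ck_scale => //; apply: CkV => //.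
  by move=> x Dx; rewrite gt_eqF// sqrtr_gt0 dot_gt0 f0.
apply: Ck_sqrt => //; first by move=> x Dx; rewrite dot_gt0 f0.
exact: Ck_dot.
Qed.

Lemma Ck_fst V (W : normedModType R) k (D : set (V * W)) : open D -> Ck k D fst.
Proof.
move=> oD; apply: (Ck_ext oD (f := fun x => 0 + fst x)).
  by move=> x _; rewrite add0r.
by apply: Ck_affine => // x; exact: cvg_fst.
Qed.

Lemma Ck_snd V (W : normedModType R) k (D : set (V * W)) : open D -> Ck k D snd.
Proof.
move=> oD; apply: (Ck_ext oD (f := fun x => 0 + snd x)).
  by move=> x _; rewrite add0r.
by apply: Ck_affine => // x; exact: cvg_snd.
Qed.

Lemma open_snd_neq0 : open [set x : E | x.2 != 0].
Proof.
apply: (@open_comp E V3 snd [set v | v != 0]).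
  by move=> x _; exact: cvg_snd.
rewrite (_ : [set v | _] = ~` [set 0]); last by apply/seteqP; split=> v /eqP.
exact/closed_openC/(accessible_closed_set1 (hausdorff_accessible (@norm_hausdorff _ _))).
Qed.

Lemma Ck_line_of V k (D : set V) (f g : V -> V3) : open D ->
  (forall x, D x -> g x != 0) ->
  Ck k D f -> Ck k D g -> Ck k D (fun x => line_of (f x, g x)).
Proof.
move=> oD g0 Cf Cg.
have Cn := Ck_normalize oD g0 Cg.
apply: Ck_pair => //; apply: (CkB oD) => //.
by apply: Ck_scale => //; exact: Ck_dot.
Qed.

End Vectors3.

(** * Implicit functions *)

Section ImplicitDifferentiation.
Context {R : realType}.

Lemma cvg_to_pair (T V W : normedModType R) (F : set_system T) (FF : Filter F)
    (f : T -> V) (g : T -> W) (a : V) (b : W) :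
  f @ F --> a -> g @ F --> b -> (fun x => (f x, g x)) @ F --> ((a, b) : V * W).
Proof. by move=> fa gb; apply: cvg_pair; [exact: fa|exact: gb]. Qed.

Lemma row_linear_continuous n (W : normedModType R) (L : {linear 'rV[R]_n -> W}) :
  continuous L.
Proof.
have : Ck 0 setT (fun u : 'rV[R]_n => \sum_i u 0 i *: L (delta_mx 0 i)).
  apply: Ck_sum => [|i]; first exact: openT.
  apply: Ck_scale_vector; first exact: openT.
  by apply: Ck_coordinate; [exact: openT|apply: Ck_id; exact: openT].
rewrite (_ : (fun u => _) = L) => [cL u|]; first exact: cL.
apply/funext => u; rewrite [in RHS](row_sum_delta u) linear_sum.
by apply: eq_bigr => i _; rewrite linearZ.
Qed.

(* As the implicit function is given and continuous, no fixed point argument is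
   needed: [A h + B d = o(|h| + |d|)] with [B] invertible determines the
   increment [d] of [U] up to [o(|h|)]. *)
Lemma implicit_differentiable (V : normedModType R) n (U : V -> 'rV[R]_n)
    (F : V * 'rV[R]_n -> 'rV[R]_n) (z : V) :
  {for z, continuous U} -> differentiable F (z, U z) ->
  (\forall y \near z, F (y, U y) = 0) ->
  (forall h, 'd F (z, U z) (0, h) = 0 -> h = 0) ->
  differentiable U z.
Proof.
move=> cU dF FU injF.
pose A v : 'rV[R]_n := 'd F (z, U z) (v, 0).
pose B h : 'rV[R]_n := 'd F (z, U z) (0, h).
have linB : linear B.
  move=> a h h'; rewrite /B -linearP; congr ('d F _ _).
  by congr pair; rewrite /= scaler0 addr0.
pose BL : {linear 'rV[R]_n -> 'rV[R]_n} := HB.pack B (GRing.isLinear.Build _ _ _ _ _ linB).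
have FAB v h : 'd F (z, U z) (v, h) = A v + B h.
  rewrite /A /B -linearD; congr ('d F _ _).
  by congr pair; rewrite /= ?addr0 ?add0r.
pose M := lin1_mx BL.
have MB h : h *m M = B h by rewrite mul_rV_lin1.
have uM : M \in unitmx.
  rewrite -row_free_unit -kermx_eq0; apply/rowV0P => h /sub_kermxP.
  by rewrite MB => /injF.
pose Bi (y : 'rV[R]_n) := y *m invmx M.
have BiB h : Bi (B h) = h by rewrite /Bi -MB mulmxK.
have linBi : linear Bi by move=> a y y'; rewrite /Bi mulmxDl scalemxAl.
pose BiL : {linear 'rV[R]_n -> 'rV[R]_n} := HB.pack Bi (GRing.isLinear.Build _ _ _ _ _ linBi).
have cBi : continuous Bi := row_linear_continuous (L := BiL).
pose L v := - Bi (A v).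
have linA : linear A.
  move=> a h h'; rewrite /A -linearP; congr ('d F _ _).
  by congr pair; rewrite /= scaler0 addr0.
have linL : linear L.
  by move=> a v v'; rewrite /L linA linBi opprD scalerN.
pose LL : {linear V -> 'rV[R]_n} := HB.pack L (GRing.isLinear.Build _ _ _ _ _ linL).
have cA : continuous A.
  move=> v; apply: (continuous_comp (f := fun v => (v, 0 : 'rV[R]_n)) (g := 'd F (z, U z))).
    apply: differentiable_continuous; apply: differentiable_pair.
      by have [] := is_diff_id v.
    exact: differentiable_cst.
  exact: (diff_continuous dF).
have cL : continuous L.
  move=> v; apply: continuous_comp; last exact: opp_continuous.
  by apply: (continuous_comp (f := A) (g := Bi)); [exact: cA|exact: cBi].
have [C C0 BiC] := linear_lipschitz (f := BiL) cBi.
have [K K0 LK] := linear_lipschitz (f := LL) cL.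
suff [] : is_diff z U LL by [].
refine (iffRL (@is_diff_epsP R V 'rV[R]_n U LL z cL) _) => e e0.
(* The first bound gives [C * e' <= 1/2], which absorbs the norm of [d] and bounds it by [1 + 2 * K]
   times that of [h]; the second then brings the error below [e] times the norm of [h]. *)
pose e' := Num.min (2^-1 / C) (e / (C * (2 * K + 3))).
have e'0 : 0 < e' by rewrite lt_min !divr_gt0// ?mulr_gt0// ?invr_gt0//; lra.
have H := iffLR (@is_diff_epsP R _ _ F ('d F (z, U z)) (z, U z) (diff_continuous dF))
  (differentiableP dF) e' e'0.
have hz : (fun h : V => h + z) @ (0 : V) --> z.
  by rewrite -[X in _ --> X]add0r; apply: cvgD; [exact: cvg_id|exact: cvg_cst].
have U0 : (fun h => (h, U (h + z) - U z)) @ (0 : V) --> ((0, 0) : V * 'rV[R]_n).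
  apply: cvg_to_pair; first exact: cvg_id.
  have hU : (fun h => U (h + z)) @ (0 : V) --> U z 
    by apply: (@cvg_comp _ _ _ (fun h : V => h + z) U (nbhs (0 : V)) (nbhs z));
      [exact: hz|exact: cU].
  by rewrite -[X in _ --> X](subrr (U z)); apply: cvgB; [exact: hU|exact: cvg_cst].
have FU0 : \forall h \near (0 : V), F (h + z, U (h + z)) = 0 := hz _ FU.
have H1 : \forall h \near (0 : V),
    `|F ((h, U (h + z) - U z) + (z, U z)) - F (z, U z) - 'd F (z, U z) (h, U (h + z) - U z)|
      <= e' * `|(h, U (h + z) - U z)| := U0 _ H.
move: H1 FU0; apply: filterS2 => h H1 Fh.
set d := U (h + z) - U z.
have Hd : `|A h + B d| <= e' * `|(h, d)|.
  have : `|F ((h, d) + (z, U z)) - F (z, U z) - 'd F (z, U z) (h, d)| <= e' * `|(h, d)| := H1.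
  rewrite (_ : (h, d) + (z, U z) = (h + z, U (h + z))); last first.
    by congr pair; rewrite /= /d subrK.
  by rewrite Fh (nbhs_singleton FU) subrr sub0r normrN FAB.
have dL : d - L h = Bi (A h + B d).
  by rewrite /L opprK /Bi mulmxDl -!/(Bi _) BiB addrC.
have e'C : C * e' <= 2^-1.
  by rewrite mulrC -ler_pdivlMr// ge_min lexx.
have e'e : C * e' * (2 * K + 3) <= e.
  rewrite mulrAC mulrC -ler_pdivlMr ?mulr_gt0//; last by lra.
  by rewrite ge_min lexx orbT.
have hd : `|(h, d)| <= `|h| + `|d| by rewrite prod_normE ge_max lerDl lerDr !normr_ge0.
have G : `|d - L h| <= C * e' * (`|h| + `|d|).
  rewrite dL; apply: le_trans (BiC _) _; rewrite -mulrA ler_pM2l//.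
  by apply: le_trans Hd _; rewrite ler_pM2l.
have D : `|d| <= `|d - L h| + K * `|h|.
  by rewrite -{1}(subrK (L h) d); apply: le_trans (ler_normD _ _) _; rewrite lerD2l LK.
rewrite -/d /=; move: G D (normr_ge0 h) (normr_ge0 d) e'C e'e.
have : 0 < C * e' by rewrite mulr_gt0.
move: (C * e') `|h| `|d| `|d - L h| => x y D G x0 hG hD y0 D0 hx hxe.
have hD' : D <= (1 + 2 * K) * y by nra.
by nra.
Qed.

End ImplicitDifferentiation.

(** * Higher smoothness of implicit functions *)

Section ImplicitSmoothness.
Context {R : realType}.
Implicit Types (V : normedModType R) (k n : nat).

Lemma Ck_bigsum V k (D : set V) I (s : seq I) (f : I -> V -> R) : open D ->
  (forall i, Ck k D (f i)) -> Ck k D (fun x => \sum_(i <- s) f i x).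
Proof.
move=> oD Cf; elim: s => [|i s IH].
  rewrite (_ : (fun x => _) = cst 0); first exact: Ck_cst.
  by apply/funext => x; rewrite big_nil.
rewrite (_ : (fun x => _) = f i + (fun x => \sum_(i <- s) f i x)); first exact: CkD.
by apply/funext => x; rewrite big_cons.
Qed.

Lemma Ck_bigprod V k (D : set V) I (s : seq I) (f : I -> V -> R) : open D ->
  (forall i, Ck k D (f i)) -> Ck k D (fun x => \prod_(i <- s) f i x).
Proof.
move=> oD Cf; elim: s => [|i s IH].
  rewrite (_ : (fun x => _) = cst 1); first exact: Ck_cst.
  by apply/funext => x; rewrite big_nil.
rewrite (_ : (fun x => _) = f i * (fun x => \prod_(i <- s) f i x)); first exact: CkM.
by apply/funext => x; rewrite big_cons.
Qed.

Lemma Ck_det V k n (D : set V) (M : V -> 'M[R]_n) : open D ->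
  (forall i j, Ck k D (fun x => M x i j : R)) -> Ck k D (fun x => \det (M x) : R).
Proof.
move=> oD CM; apply: Ck_bigsum => // s.
apply: (@CkM R V k D (fun=> (-1) ^+ s : R)
  (fun x => \prod_i M x i (s i) : R) oD).
  exact: Ck_cst.
exact: Ck_bigprod.
Qed.

Lemma Ck_invmx V k n (D : set V) (M : V -> 'M[R]_n) i j : open D ->
  (forall x, D x -> M x \in unitmx) ->
  (forall i j, Ck k D (fun x => M x i j : R)) -> Ck k D (fun x => invmx (M x) i j : R).
Proof.
move=> oD uM CM.
have Cdet : Ck k D (fun x => (\det (M x))^-1 : R).
  apply: CkV => //; last exact: Ck_det.
  by move=> x /uM; rewrite unitmxE unitfE.
have Ccof : Ck k D (fun x => (-1) ^+ (j + i) * \det (row' j (col' i (M x))) : R).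
  apply: (@CkM R V k D (fun=> (-1) ^+ (j + i) : R) 
    (fun x => \det (row' j (col' i (M x))) : R) oD); first exact: Ck_cst.
  apply: Ck_det => // i' j'.
  by rewrite (_ : (fun x => _) = fun x => M x (lift j i') (lift i j')) //;
    apply/funext => x; rewrite !mxE.
apply: Ck_ext (CkM oD Cdet Ccof) => // x /set_mem/uM uMx.
by rewrite /invmx uMx !mxE.
Qed.

Lemma pair_sum_delta V n (h : 'rV[R]_n) :
  ((0, h) : V * 'rV[R]_n) = \sum_i h 0 i *: (0, delta_mx 0 i).
Proof.
transitivity (\sum_i ((0, h 0 i *: delta_mx 0 i) : V * 'rV[R]_n)); last first.
  by apply: eq_bigr => i _; congr pair; rewrite /= scaler0.
rewrite {1}(row_sum_delta h).
apply: (big_morph (fun h => ((0, h) : V * 'rV[R]_n))) => // a b.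
by congr pair; rewrite /= addr0.
Qed.

(** As in [Ck_comp_row], but only the second component of the vector argument moves with [x], so
    only that one is expanded in coordinates and [V] may be any normed space. *)
Lemma Ck_comp_graph V k n (D : set V) (Om : set (V * 'rV[R]_n)) (U : V -> 'rV[R]_n)
    (g : V * 'rV[R]_n -> R) : open D -> open Om -> (forall x, D x -> Om (x, U x)) ->
  Ck k D U -> Ck k Om g -> Ck k D (fun x => g (x, U x)).
Proof.
move=> oD oO DO; elim: k g => [|k IH] g.
  move=> cU cg x Dx; apply: (continuous_comp (f := fun x => (x, U x))).
    by apply: cvg_to_pair; [exact: cvg_id|exact: cU].
  by apply: cg; exact: DO.
move=> CU Cg; have [dU CdU] := CU; have [dg Cdg] := Cg.
refine (@CkS_is_diff R V R k D _ (fun x v => 'd g (x, U x) (v, 0) +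
  \sum_i 'd U x v 0 i * 'd g (x, U x) (0, delta_mx 0 i)) oD _ _).
  move=> x Dx; have dUx := differentiableP (dU x Dx).
  have dgx := differentiableP (dg _ (DO x Dx)).
  have [d e] := is_diff_comp (is_diff_pair (is_diff_id x) dUx) dgx.
  split=> //; rewrite e; apply/funext => v /=.
  have vE : (v, 'd U x v) = (v, 0) + (0, 'd U x v) :> V * 'rV[R]_n.
    by congr pair; rewrite /= ?addr0 ?add0r.
  rewrite vE linearD; apply: (congr1 (+%R _)).
  rewrite [in LHS](pair_sum_delta V ('d U x v)) linear_sum; apply: eq_bigr => i _.
  by rewrite linearZ.
move=> v; apply: (@CkD R V R k D (fun x => 'd g (x, U x) (v, 0))) => //.
  exact: (IH _ (CkS CU) (Cdg _)).
apply: Ck_sum => // i.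
apply: (@CkM R V k D (fun x => 'd U x v 0 i)
  (fun x => 'd g (x, U x) (0, delta_mx 0 i)) oD).
  by apply: Ck_coordinate => //; exact: CdU.
exact: (IH _ (CkS CU) (Cdg _)).
Qed.

(** Bootstrapping: differentiating [F (x, U x) = 0] expresses ['d U] through the partial
    differentials of [F] along the graph and an inverse matrix, so it is of class [k] as soon as [U]
    is. *)
Lemma implicit_smooth V n (D : set V) (Om : set (V * 'rV[R]_n)) (U : V -> 'rV[R]_n)
    (F : V * 'rV[R]_n -> 'rV[R]_n) : open D -> open Om ->
  smooth_on Om F -> (forall x, D x -> Om (x, U x)) ->
  (forall x, D x -> {for x, continuous U}) ->
  (forall x, D x -> F (x, U x) = 0) ->
  (forall x h, D x -> 'd F (x, U x) (0, h) = 0 -> h = 0) ->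
  smooth_on D U.
Proof.
move=> oD oO CF DO cU FU injF.
have dF x : D x -> differentiable F (x, U x).
  by move=> Dx; have [+ _] := CF 1%N; apply; exact: DO.
have dU x : D x -> differentiable U x.
  move=> Dx; apply: (implicit_differentiable (F := F)).
  - exact: cU.
  - exact: dF.
  - by apply: filterS (open_nbhs_nbhs (conj oD Dx)) => y; exact: FU.
  - by move=> h; exact: injF.
pose M x : 'M[R]_n := \matrix_(i, j) 'd F (x, U x) (0, delta_mx 0 i) 0 j.
have ME x (h : 'rV[R]_n) : h *m M x = 'd F (x, U x) (0, h).
  rewrite (pair_sum_delta V h) linear_sum; apply/rowP => j.
  rewrite mxE summxE; apply: eq_bigr => i _.
  by rewrite linearZ !mxE.
have uM x : D x -> M x \in unitmx.
  move=> Dx; rewrite -row_free_unit -kermx_eq0; apply/rowV0P => h /sub_kermxP.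
  by rewrite ME; exact: injF.
have dUE x v : D x -> 'd U x v = (- 'd F (x, U x) (v, 0)) *m invmx (M x).
  move=> Dx; apply: (canRL (mulmxK (uM x Dx))); rewrite ME.
  have dUx := differentiableP (dU x Dx); have dFx := differentiableP (dF x Dx).
  have dc := is_diff_comp (is_diff_pair (is_diff_id x) dUx) dFx.
  have d0 : is_diff x (F \o (fun y => (y, U y))) 0.
    apply: near_is_diff (is_diff_cst 0 x).
    by apply: filterS (open_nbhs_nbhs (conj oD Dx)) => y Dy /=; rewrite FU.
  have E : 'd F (x, U x) (v, 'd U x v) = 0.
    have [_ e1] := dc; have [_ e2] := d0.
    by have := congr1 (@^~ v) (etrans (esym e1) e2).
  apply/eqP; rewrite -addr_eq0 -linearD; apply/eqP; rewrite -[RHS]E.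
  by congr ('d F _ _); congr pair; rewrite /= ?addr0 ?add0r.
elim=> [|k IH]; first exact: cU.
refine (@CkS_is_diff R V _ k D _
  (fun x v => (- 'd F (x, U x) (v, 0)) *m invmx (M x)) oD _ _).
  by move=> x Dx; split; [exact: dU|apply/funext => v; exact: dUE].
have CF' w j : Ck k D (fun x => 'd F (x, U x) w 0 j : R).
  apply: (Ck_comp_graph (g := fun y => 'd F y w 0 j) oD oO DO IH).
  by apply: Ck_coordinate => //; have [_] := CF k.+1; apply.
move=> v; apply: Ck_row => // j.
rewrite (_ : (fun x => _) =
  (fun x => \sum_i (0 - 'd F (x, U x) (v, 0) 0 i) * invmx (M x) i j)); last first.
  apply/funext => x; rewrite mxE; apply: eq_bigr => i _; rewrite mxE sub0r //.
apply: Ck_sum => // i.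
apply: (@CkM R V k D (fun x => 0 - 'd F (x, U x) (v, 0) 0 i) (fun x => invmx (M x) i j) oD).
  by apply: (@CkB R V R k D (cst 0)) => //; exact: Ck_cst.
apply: Ck_invmx => // i' j'.
rewrite (_ : (fun x => _) = fun x => 'd F (x, U x) (0, delta_mx 0 i') 0 j') //.
by apply/funext => x; rewrite mxE.
Qed.

End ImplicitSmoothness.

(** * Charts and local extrema *)

Section LineDerivatives.
Context {R : realType}.
Implicit Types (V W : normedModType R).

Lemma is_diff_line V (x w : V) (t : R) :
  is_diff t (fun s : R => x + s *: w) (fun s => s *: w).
Proof.
have h := is_diffD (is_diff_cst x t) (is_diff_scalel t w).
by rewrite add0r in h; exact: h.
Qed.

Lemma is_derive_line V W (f : V -> W) (x w : V) (t : R) :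
  differentiable f (x + t *: w) ->
  is_derive t 1 (fun s : R => f (x + s *: w)) ('d f (x + t *: w) w).
Proof.
move=> df; have dfx := differentiableP df.
have [d e] := is_diff_comp (is_diff_line x w t) dfx.
split; first exact: diff_derivable.
by rewrite deriveE// e /= scale1r.
Qed.

Lemma is_derive_line0 V W (f : V -> W) (x w : V) : differentiable f x ->
  is_derive (0 : R) 1 (fun s : R => f (x + s *: w)) ('d f x w).
Proof.
move=> df; have xE : x + (0 : R) *: w = x by rewrite scale0r addr0.
have df' : differentiable f (x + (0 : R) *: w) by rewrite xE.
by have := is_derive_line df'; rewrite xE.
Qed.

Lemma line_continuous V (x w : V) : continuous (fun s : R => x + s *: w).
Proof. by move=> t; apply: differentiable_continuous; have [] := is_diff_line x w t. Qed.

Lemma derive_local_min_eq0 (f : R -> R) (df : R) : is_derive (0 : R) 1 f df ->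
  (\forall t \near (0 : R), f 0 <= f t) -> (\forall t \near (0 : R), derivable f t 1) -> df = 0.
Proof.
move=> d0 hmin hd.
have /nbhs_ballP[r /= r0 hr] : nbhs (0 : R) [set t | f 0 <= f t /\ derivable f t 1].
  by apply: filterS2 hmin hd.
have H t : t \in `]- r, r[%R -> f 0 <= f t /\ derivable f t 1.
  rewrite in_itv /= => tr; apply: hr.
  by rewrite -ball_normE /= sub0r normrN ltr_norml.
have r0' : 0 \in `]- r, r[%R by rewrite in_itv /= oppr_lt0 r0.
have rr : - r <= r by rewrite -subr_ge0 opprK addr_ge0 ?ltW.
have [_ e] := @derive1_at_min R f (- r) r 0
  rr (fun t tr => (H t tr).2) r0' (fun t tr => (H t tr).1).
by have [_ <-] := d0.
Qed.

(** The quadratic form has a positive minimum on the compact unit sphere of the sup norm, and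
    homogeneity extends the bound. The sphere is empty when [n = 0], hence the case split. *)
Lemma positive_definite_coercive n (L : {linear 'rV[R]_n -> 'rV[R]_n}) :
  (forall w : 'rV[R]_n, w != 0 -> 0 < \sum_i w 0 i * L w 0 i) ->
  exists2 m, 0 < m & forall w : 'rV[R]_n, m * `|w| ^+ 2 <= \sum_i w 0 i * L w 0 i.
Proof.
move=> posL; pose Q (w : 'rV[R]_n) : R := \sum_i w 0 i * L w 0 i.
have cQ : continuous Q.
  move=> w; have : Ck 0 setT Q; last by move=> /(_ w I).
  apply: Ck_sum; first exact: openT.
  move=> i; apply: (@CkM R 'rV[R]_n 0 setT (fun w => w 0 i) (fun w => L w 0 i)).
  - exact: openT.
  - by apply: Ck_coordinate; [exact: openT|apply: Ck_id; exact: openT].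
  - apply: Ck_coordinate; first exact: openT.
    by move=> x _; exact: (row_linear_continuous (L := L)).
pose A := [set w : 'rV[R]_n | `|w| = 1].
have cA : compact A.
  apply: bounded_closed_compact.
    by exists 1; split=> [|M M1 w /= ->]; [exact: num_real|exact: ltW].
  apply: (preimage_closed (f := fun w : 'rV[R]_n => `|w|) (D := [set 1])).
    by move=> w _; exact: norm_continuous.
  exact: (accessible_closed_set1 (hausdorff_accessible (@norm_hausdorff _ R))).
have QZ (a : R) w : Q (a *: w) = a ^+ 2 * Q w.
  rewrite /Q mulr_sumr; apply: eq_bigr => i _.
  by rewrite linearZ !mxE; ring.
have [A0|/set0P A0] := eqVneq A set0.
  exists 1 => // w; have [->|w0] := eqVneq w 0.
    by rewrite normr0 expr0n mulr0 /= sumr_ge0// => i _; rewrite mxE mul0r.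
  have : A (`|w|^-1 *: w) by rewrite /A/= normrZ normfV normr_id mulVf// normr_eq0.
  by rewrite A0.
have [w0 /set_mem Aw0 hw0] := compact_EVT_min A0 cA (continuous_subspaceT cQ).
exists (Q w0).
  by apply: posL; rewrite -normr_eq0 Aw0 oner_neq0.
move=> w; have [->|wn0] := eqVneq w 0.
  by rewrite normr0 expr0n mulr0 /= sumr_ge0// => i _; rewrite mxE mul0r.
have nw : 0 < `|w| by rewrite normr_gt0.
have Aw : A (`|w|^-1 *: w) by rewrite /A/= normrZ normfV normr_id mulVf// normr_eq0.
have := hw0 _ (mem_set Aw).
by rewrite QZ exprVn mulrC ler_pdivlMr ?exprn_gt0// mulrC.
Qed.

Lemma norm_sum_mul n (u v : 'rV[R]_n) :
  `|\sum_i u 0 i * v 0 i| <= n%:R * (`|u| * `|v|).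
Proof.
apply: le_trans (ler_norm_sum _ _ _) _.
rewrite mulr_natl -[X in _ *+ X]card_ord -sumr_const; apply: ler_sum => i _.
rewrite normrM ler_pM// /Num.Def.normr/= mx_normrE.
  exact: (le_bigmax _ (fun ij => `|u ij.1 ij.2|) (0, i)).
exact: (le_bigmax _ (fun ij => `|v ij.1 ij.2|) (0, i)).
Qed.

(* [K] is the gradient of [g]; only its differentiability at the critical point
   is used, through [g (u0 + h) - g u0 = K (u0 + s h) . h] for some [s]. *)
Lemma strict_local_min_of_gradient n (g : 'rV[R]_n -> R) (K : 'rV[R]_n -> 'rV[R]_n)
    (u0 : 'rV[R]_n) :
  (\forall u \near u0, differentiable g u /\
     forall h : 'rV[R]_n, 'd g u h = \sum_i h 0 i * K u 0 i) ->
  K u0 = 0 -> differentiable K u0 ->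
  (forall w : 'rV[R]_n, w != 0 -> 0 < \sum_i w 0 i * 'd K u0 w 0 i) ->
  \forall u \near u0, u != u0 -> g u0 < g u.
Proof.
move=> gK K0 dK posK.
have [m m0 hm] := positive_definite_coercive posK.
(* The linearization error of the product with [h] is at most [n * e] times the squared norm of [h],
   hence at most half of the coercivity bound. Using [n.+1] keeps the denominator nonzero. *)
pose e := m / (2 * n.+1%:R).
have e0 : 0 < e by rewrite divr_gt0// mulr_gt0// ltr0n.
have H := iffLR (@is_diff_epsP R _ _ K ('d K u0) u0 (diff_continuous dK))
  (differentiableP dK) e e0.
have /nbhs_ballP[r1 /= r10 hr1] := gK.
have /nbhs_ballP[r2 /= r20 hr2] := H.
pose r := Num.min r1 r2.
have r0 : 0 < r by rewrite lt_min r10.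
have pos (h : 'rV[R]_n) : `|h| < r -> h != 0 -> 0 < \sum_i h 0 i * K (u0 + h) 0 i.
  move=> hr hn0.
  have : `|K (h + u0) - K u0 - 'd K u0 h| <= e * `|h|.
    apply: hr2; rewrite -ball_normE /= sub0r normrN.
    by apply: lt_le_trans hr _; rewrite ge_min lexx orbT.
  rewrite K0 subr0 (addrC h) => hK.
  rewrite (_ : \sum_i _ = \sum_i h 0 i * 'd K u0 h 0 i +
     \sum_i h 0 i * (K (u0 + h) - 'd K u0 h) 0 i); last first.
    by rewrite -big_split; apply: eq_bigr => i _; rewrite !mxE /=; ring.
  have := norm_sum_mul h (K (u0 + h) - 'd K u0 h).
  move: (\sum_i h 0 i * (K _ - _) 0 i) => S hS.
  have nh : 0 < `|h| by rewrite normr_gt0.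
  have hS' : `|S| <= n%:R * (`|h| * (e * `|h|)).
    by apply: le_trans hS _; rewrite ler_wpM2l// ler_wpM2l.
  have en : n%:R * e <= m / 2.
    rewrite /e mulrA ler_pdivrMr ?mulr_gt0 ?ltr0n// -natr1.
    by rewrite (_ : _ * (2 * _) = n%:R * m + m) ?lerDl ?ltW//; field.
  have := hm h; have := ler_norm (- S); rewrite normrN.
  move: hS' en nh; move: `|h| `|S| => y s.
  move: (\sum_i _) => q hS' en y0 hs hq.
  have : n%:R * (y * (e * y)) <= m / 2 * y ^+ 2.
    have -> : n%:R * (y * (e * y)) = n%:R * e * y ^+ 2 by ring.
    by rewrite ler_wpM2r// sqr_ge0.
  have : 0 < m * y ^+ 2 by rewrite mulr_gt0// exprn_gt0.
  lra.
apply/nbhs_ballP; exists r => //= u ur uu0.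
pose h : 'rV[R]_n := u - u0.
have hr : `|h| < r by move: ur; rewrite -ball_normE /= distrC.
have hn0 : h != 0 by rewrite subr_eq0.
have inr (s : R) : 0 <= s <= 1 -> ball u0 r1 (u0 + s *: h).
  move=> /andP[s0 s1]; rewrite -ball_normE /= opprD addrA subrr sub0r normrN normrZ ger0_norm//.
  apply: (@le_lt_trans _ _ `|h|); first by rewrite ler_piMl.
  by apply: lt_le_trans hr _; rewrite ge_min lexx.
have dg (s : R) : 0 <= s <= 1 -> is_derive s 1 (fun s : R => g (u0 + s *: h))
    (\sum_i h 0 i * K (u0 + s *: h) 0 i).
  move=> /inr/hr1[d <-]; exact: is_derive_line.
have [| |c c01] := @MVT R (fun s : R => g (u0 + s *: h))
   (fun s => \sum_i h 0 i * K (u0 + s *: h) 0 i) 0 1 ltr01.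
- by move=> s; rewrite in_itv /= => /andP[s0 s1]; apply: dg; rewrite !ltW.
- apply: derivable_within_continuous => s; rewrite in_itv /= => s01.
  by have [] := dg s s01.
have uE : u0 + h = u by rewrite addrC subrK.
rewrite scale1r scale0r addr0 subr0 mulr1 uE => E.
rewrite -subr_gt0 E.
move: c01; rewrite in_itv /= => /andP[c0 c1].
have : 0 < \sum_i (c *: h) 0 i * K (u0 + c *: h) 0 i.
  apply: pos; last by rewrite scaler_eq0 negb_or gt_eqF.
  by rewrite normrZ gtr0_norm//; apply: le_lt_trans hr; rewrite ler_piMl// ltW.
rewrite (_ : \sum_i (c *: h) 0 i * _ = c * \sum_i h 0 i * K (u0 + c *: h) 0 i).
  by rewrite pmulr_rgt0.
by rewrite mulr_sumr; apply: eq_bigr => i _; rewrite mxE mulrA.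
Qed.

End LineDerivatives.

(** * Identities of vector algebra *)

Section VectorIdentities.
Context {R : realType}.
Implicit Types (u v w a b n : 'rV[R]_3).

Lemma crossE0 u v : cross u v 0 0 = u 0 1 * v 0 2 - u 0 2 * v 0 1.
Proof. by have [] := crossE u v. Qed.

Lemma crossE1 u v : cross u v 0 1 = u 0 2 * v 0 0 - u 0 0 * v 0 2.
Proof. by have [] := crossE u v. Qed.

Lemma crossE2 u v : cross u v 0 2 = u 0 0 * v 0 1 - u 0 1 * v 0 0.
Proof. by have [] := crossE u v. Qed.

End VectorIdentities.

Ltac vec3 := rewrite /trip ?(dotE, crossE0, crossE1, crossE2, mxE); ring.

Section VectorIdentities2.
Context {R : realType}.
Implicit Types (u v w a b n : 'rV[R]_3).

Lemma dotDr u v w : dot u (v + w) = dot u v + dot u w. Proof. by vec3. Qed.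
Lemma dotZr (r : R) u v : dot u (r *: v) = r * dot u v. Proof. by vec3. Qed.
Lemma dotBr u v w : dot u (v - w) = dot u v - dot u w. Proof. by vec3. Qed.
Lemma dotNl u v : dot (- u) v = - dot u v. Proof. by vec3. Qed.
Lemma dotNr u v : dot u (- v) = - dot u v. Proof. by vec3. Qed.
Lemma dot0l v : dot 0 v = 0. Proof. by vec3. Qed.
Lemma dot0r v : dot v 0 = 0. Proof. by vec3. Qed.
Lemma dot_crossl u v : dot (cross u v) u = 0. Proof. by vec3. Qed.
Lemma dot_crossr u v : dot (cross u v) v = 0. Proof. by vec3. Qed.

Lemma cross0r u : cross u 0 = 0. Proof. by apply: eqrV3; vec3. Qed.

Lemma cross_cross_perp u v : cross u (cross u v) = dot u v *: u - dot u u *: v.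
Proof. by apply: eqrV3; vec3. Qed.

Lemma perp_cross_parallel n a b : dot n a = 0 -> dot n b = 0 ->
  dot (cross a b) (cross a b) *: n = dot n (cross a b) *: cross a b.
Proof.
move=> na nb; apply/subr0_eq.
transitivity (dot n b *: cross (cross a b) a - dot n a *: cross (cross a b) b).
  by apply: eqrV3; vec3.
by rewrite na nb !scale0r subr0.
Qed.

End VectorIdentities2.

Lemma diff_coordinate (R : realType) (V : normedModType R) n (f : V -> 'rV[R]_n) x (i : 'I_n) :
  differentiable f x ->
  is_diff x (fun y => f y 0 i : R) (fun v => 'd f x v 0 i).
Proof.
move=> df; have dfx := differentiableP df.
have cc : continuous (coordinate (R := R) i) := @coord_continuous R 1 n 0 i.
have dc : is_diff (f x) (coordinate (R := R) i) (coordinate i).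
  by split; [exact: linear_differentiable | exact: diff_lin].
exact: (is_diff_comp dfx dc).
Qed.

(** * Height functions in a chart and the second fundamental form *)

Section Charts.
Context {R : realType}.
Variables (S : set 'rV[R]_3) (D : set 'rV[R]_2) (phi : 'rV[R]_2 -> 'rV[R]_3).
Hypothesis chart : local_param S D phi.
Implicit Types (u w : 'rV[R]_2) (n p : 'rV[R]_3).

Let oD : open D. Proof. by case: chart. Qed.
Let Cphi k : Ck k D phi. Proof. by case: chart => _ /(_ k). Qed.

(** Of the height [dot n (phi u)] in chart coordinates. The vector [n] is a parameter because it
    later depends on the line and on the point of tangency. *)
Definition gradient n u : 'rV[R]_2 := \row_i dot n ('d phi u (delta_mx 0 i)).

Definition hessian_form n u w : R := \sum_i w 0 i * 'd (gradient n) u w 0 i.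

Lemma chart_diff u : D u -> differentiable phi u.
Proof. by have [+ _] := Cphi 1%N; apply. Qed.

Lemma chart_image u : D u -> S (phi u).
Proof.
move=> Du; have [_ _ _ [Om _ SO] _] := chart.
by have [] : (S `&` Om) (phi u) by rewrite -SO; exists u.
Qed.

(** Continuity of the inverse of the chart: all points of [S] near [phi u] come from parameters near
    [u], so local properties on [S] can be checked in the chart. *)
Lemma chart_nbhs u (B : set 'rV[R]_2) : D u -> nbhs u B ->
  exists2 N, open_nbhs (phi u) N & forall z, S z -> N z -> exists u', [/\ D u', B u' & phi u' = z].
Proof.
move=> Du nB; have [_ _ _ [Om oO SO] [psi cpsi phiK]] := chart.
have Ou : (S `&` Om) (phi u) by rewrite -SO; exists u.
have nB' : nbhs (psi (phi u)) B by rewrite phiK ?inE.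
have nN : nbhs (phi u) [set z | (phi @` D) z -> B (psi z)].
  exact: (iffLR (subspace_continuousP _ _) cpsi (phi u) (ex_intro2 _ _ u Du erefl) _ nB').
have nO : nbhs (phi u) Om by apply: open_nbhs_nbhs; split=> //; have [] := Ou.
exists (interior ([set z | (phi @` D) z -> B (psi z)] `&` Om)).
  by split; [exact: open_interior|exact: filterI].
move=> z Sz /interior_subset[Bz Oz].
have [u' Du' zE] : (phi @` D) z by rewrite SO.
exists u'; split=> //; have := Bz (ex_intro2 _ _ u' Du' zE).
by rewrite -zE phiK ?inE.
Qed.

Lemma chart_partials u w : 'd phi u w = \sum_i w 0 i *: 'd phi u (delta_mx 0 i).
Proof.
rewrite {1}(row_sum_delta w) linear_sum; apply: eq_bigr => i _.
by rewrite linearZ.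
Qed.

Lemma chart_partials2 u w : 'd phi u w =
  w 0 0 *: 'd phi u (delta_mx 0 0) + w 0 1 *: 'd phi u (delta_mx 0 1).
Proof.
rewrite chart_partials !big_ord_recl big_ord0 addr0.
by congr (_ + w 0 _ *: 'd phi u (delta_mx 0 _)); apply: val_inj.
Qed.

Lemma dot_chart n u w : dot n ('d phi u w) = \sum_i w 0 i * gradient n u 0 i.
Proof.
rewrite chart_partials !big_ord_recl !big_ord0 !addr0 dotDr !dotZr.
by rewrite !mxE.
Qed.

(** If the cross product vanished, the double cross product formula would be a linear relation
    between the partial derivatives, excluded by injectivity of ['d phi u]. *)
Lemma chart_normal_neq0 u : D u ->
  cross ('d phi u (delta_mx 0 0)) ('d phi u (delta_mx 0 1)) != 0.
Proof.
move=> Du; have [_ _ inj _ _] := chart.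
set a := 'd phi u _; set b := 'd phi u _; apply/negP => /eqP ab0.
have := cross_cross_perp a b; rewrite ab0 => E.
have E' : dot a b *: a - dot a a *: b = 0.
  by rewrite -E cross0r.
have /(inj u Du)/rowP/(_ 1) :
    'd phi u (dot a b *: delta_mx 0 0 - dot a a *: delta_mx 0 1) = 'd phi u 0.
  rewrite linear0 linearB linearZ linearZ; exact: E'.
rewrite !mxE /= mulr0 sub0r mulr1 => /eqP.
rewrite oppr_eq0 dot_eq0 => /eqP a0.
have /(inj u Du)/rowP/(_ 0) : 'd phi u (delta_mx 0 0) = 'd phi u 0 by rewrite linear0 -/a a0.
by rewrite !mxE /= => /eqP; rewrite oner_eq0.
Qed.

Lemma Ck_partial k w : Ck k D (fun u => 'd phi u w).
Proof. by have [_] := Cphi k.+1; apply. Qed.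

Lemma Ck_gradient n k : Ck k D (gradient n).
Proof.
apply: Ck_row => // i; rewrite (_ : (fun x => _) = fun u => dot n ('d phi u (delta_mx 0 i))).
  by apply: Ck_dot => //; [exact: Ck_cst|exact: Ck_partial].
by apply/funext => u; rewrite mxE.
Qed.

Lemma gradient_diff n u : D u -> differentiable (gradient n) u.
Proof. by have [+ _] := Ck_gradient n 1%N; apply. Qed.

Lemma Ck_unit_normal k : Ck k D (unit_normal phi).
Proof.
apply: Ck_normalize => //; first exact: chart_normal_neq0.
by apply: Ck_cross => //; exact: Ck_partial.
Qed.

Lemma unit_normal_perp u w : dot (unit_normal phi u) ('d phi u w) = 0.
Proof.
rewrite /unit_normal /normalize dotZl (chart_partials2 u w) dotDr !dotZr.
by rewrite dot_crossl dot_crossr !mulr0 addr0 mulr0.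
Qed.

Lemma partial_diff u w : D u -> differentiable (fun u' => 'd phi u' w) u.
Proof. by have [+ _] := Ck_partial 1 w; apply. Qed.

Lemma gradient_derivative n u w (i : 'I_2) : D u ->
  'd (gradient n) u w 0 i = dot n ('d (fun u' => 'd phi u' (delta_mx 0 i)) u w).
Proof.
move=> Du; have dP := partial_diff (delta_mx 0 i) Du.
have [_ e1] := is_derive_dot (is_derive_cst n (0 : R) 1) (is_derive_line0 w dP).
have [dc /(congr1 (@^~ w)) ec] := diff_coordinate i (gradient_diff n Du).
have [_ e2] := is_derive_line0 w dc.
move: e1 e2; rewrite ec dot0l add0r => <- <-.
by apply: (congr1 (fun f : R -> R => derive f 0 1)); apply/funext => s; rewrite mxE.
Qed.

Lemma dot_second_derivative n u w : D u ->
  dot n ('d (fun u' => 'd phi u' w) u w) = hessian_form n u w.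
Proof.
move=> Du; have d1 := is_derive_line0 w (partial_diff w Du).
have d2 (i : 'I_2) : is_derive (0 : R) 1 (fun s : R => gradient n (u + s *: w) 0 i : R)
    ('d (gradient n) u w 0 i).
  have [dc /(congr1 (@^~ w)) <-] := diff_coordinate i (gradient_diff n Du).
  exact: (is_derive_line0 w dc).
have [_ e2] := @is_derive_sum R R R 2
  (fun (i : 'I_2) (s : R) => w 0 i * gradient n (u + s *: w) 0 i) (0 : R) (1 : R)
  (fun i => w 0 i * 'd (gradient n) u w 0 i) (fun i => is_deriveZ (w 0 i) (d2 i)).
have [_ e1] := is_derive_dot (is_derive_cst n (0 : R) 1) d1.
rewrite /hessian_form; move: e1 e2; rewrite dot0l add0r => <- <-.
apply: (congr1 (fun f : R -> R => derive f 0 1)); apply/funext => s.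
by rewrite fct_sumE dot_chart.
Qed.

(** A normal vector [n] is a multiple of the unit normal. Differentiating the orthogonality of the
    unit normal and ['d phi u w] along [w] moves the second derivative of [phi] onto the normal,
    with a minus sign. *)
Lemma second_fundamental_form n u : D u -> n != 0 ->
  (forall w, dot n ('d phi u w) = 0) ->
  exists2 c, c != 0 & forall w, hessian_form n u w =
    c * dot (shape_operator phi u w) ('d phi u w).
Proof.
move=> Du n0 nperp; set m := cross ('d phi u (delta_mx 0 0)) ('d phi u (delta_mx 0 1)).
have m0 : 0 < dot m m by rewrite dot_gt0 chart_normal_neq0.
have nE : n = ((dot m m)^-1 * dot n m * enorm m) *: unit_normal phi u.
  rewrite /unit_normal -/m /normalize scalerA mulfK ?gt_eqF ?sqrtr_gt0//.
  by rewrite -scalerA -perp_cross_parallel// scalerA mulVf ?scale1r// gt_eqF.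
move: nE; move: (_ * enorm m) => c nE; exists c.
  by apply: contraNneq n0 => c0; rewrite nE c0 scale0r.
move=> w; rewrite -(dot_second_derivative n w Du).
rewrite [in LHS]nE dotZl; apply: (congr1 ( *%R c)).
have dN : differentiable (unit_normal phi) u by have [+ _] := Ck_unit_normal 1; apply.
have [_] := is_derive_dot (is_derive_line0 w dN) (is_derive_line0 w (partial_diff w Du)).
rewrite (_ : (fun s => _) = cst 0); last first.
  by apply/funext => s; exact: unit_normal_perp.
rewrite derive_cst scale0r addr0 /shape_operator dotNl => /esym/eqP.
by rewrite addrC addr_eq0 => /eqP.
Qed.

Definition definite_hessian n u := forall w, w != 0 ->
  0 < hessian_form n u w.

Lemma hessian_formN n u w : D u -> hessian_form (- n) u w = - hessian_form n u w.
Proof.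
move=> Du; apply/esym; rewrite /hessian_form -sumrN; apply: eq_bigr => i _.
rewrite -mulrN; apply: (congr1 ( *%R (w 0 i))).
apply: (etrans (congr1 -%R (gradient_derivative n w i Du))).
by rewrite -dotNl; apply/esym; exact: gradient_derivative.
Qed.

Lemma hessian_definite n u : D u -> n != 0 -> definite_shape_operator phi u ->
  (forall w, dot n ('d phi u w) = 0) -> definite_hessian n u \/ definite_hessian (- n) u.
Proof.
move=> Du n0 def nperp; have [c c0 hc] := second_fundamental_form Du n0 nperp.
have hN w : hessian_form (- n) u w = - (c * dot (shape_operator phi u w) ('d phi u w)).
  by rewrite hessian_formN// hc.
rewrite /definite_hessian.
have [cneg|cpos] := ltrP c 0; last have {}cpos : 0 < c by rewrite lt_neqAle eq_sym c0.
  by case: def => def; [right|left] => w /def; rewrite ?hN ?hc; nra.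
by case: def => def; [left|right] => w /def; rewrite ?hN ?hc; nra.
Qed.

Lemma definite_hessian_strict_min n u : D u -> definite_hessian n u ->
  (forall w, dot n ('d phi u w) = 0) ->
  \forall u' \near u, u' != u -> dot n (phi u) < dot n (phi u').
Proof.
move=> Du def nperp.
apply: (@strict_local_min_of_gradient R 2 (fun u => dot n (phi u)) (gradient n)) => //.
- apply: filterS (open_nbhs_nbhs (conj oD Du)) => u' Du'.
  have Cd : Ck 1 D (fun u => dot n (phi u)) by apply: Ck_dot => //; exact: Ck_cst.
  have [dd _] := Cd; split; first exact: dd.
  move=> h; rewrite -dot_chart.
  have [_ e1] := is_derive_line0 h (dd u' Du').
  have [_ e2] := is_derive_dot (is_derive_cst n (0 : R) 1) (is_derive_line0 h (chart_diff Du')).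
  rewrite dot0l add0r in e2.
  exact: etrans (esym e1) e2.
- by apply/rowP => i; rewrite !mxE nperp.
- exact: gradient_diff.
Qed.

End Charts.

Lemma ball_segment (R : realType) (V : normedModType R) (u a b : V) (r t : R) :
  ball u r a -> ball u r b -> 0 <= t <= 1 -> ball u r (a + t *: (b - a)).
Proof.
rewrite -!ball_normE /= => ha hb /andP[t0 t1].
have -> : u - (a + t *: (b - a)) = (1 - t) *: (u - a) + t *: (u - b).
  rewrite opprD addrA; have -> : b - a = (u - a) - (u - b).
    by rewrite opprB [RHS]addrC addrA subrK.
  rewrite scalerBr opprB scalerBl scale1r -[RHS]addrA.
  by apply: (congr1 (+%R (u - a))); rewrite addrC.
have nt : `|1 - t| = 1 - t by rewrite ger0_norm// subr_ge0.
apply: le_lt_trans (ler_normD _ _) _; rewrite !normrZ nt (ger0_norm t0).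
have := normr_ge0 (u - a); have := normr_ge0 (u - b).
move: `|u - a| `|u - b| ha hb => x y hx hy x0 y0.
have [->|tn0] := eqVneq t 0; first by rewrite subr0 mul1r mul0r addr0.
have {}t0 : 0 < t by rewrite lt_neqAle eq_sym tn0.
have : t * y < t * r by rewrite ltr_pM2l.
have : (1 - t) * x <= (1 - t) * r by rewrite ler_wpM2l// ?subr_ge0// ltW.
by rewrite mulrBl mul1r; lra.
Qed.

(** * Joining points below a level in a chart; regular points *)

Section ChartPaths.
Context {R : realType}.
Variables (S : set 'rV[R]_3) (D : set 'rV[R]_2) (phi : 'rV[R]_2 -> 'rV[R]_3).
Hypothesis chart : local_param S D phi.
Implicit Types (u w a b : 'rV[R]_2) (n p : 'rV[R]_3).

Let oD : open D. Proof. by case: chart. Qed.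

Lemma dot_continuous n : continuous (fun p : 'rV[R]_3 => dot n p : R).
Proof.
move=> p; have : Ck 0 setT (fun p : 'rV[R]_3 => dot n p : R); last by move=> /(_ p I).
by apply: Ck_dot; [exact: openT|exact: Ck_cst|exact/Ck_id/openT].
Qed.

Lemma height_continuous n u : D u -> {for u, continuous (fun u => dot n (phi u) : R)}.
Proof.
move=> Du; apply: (continuous_comp (f := phi)); last exact: dot_continuous.
exact: differentiable_continuous (chart_diff chart Du).
Qed.

(** The maximum of the height over the compact segment is the uniform level below [c] that
    [joined_below] asks for. *)
Lemma chart_segment n (c : R) a b :
  (forall t : R, 0 <= t <= 1 -> D (a + t *: (b - a)) /\ dot n (phi (a + t *: (b - a))) < c) ->
  joined_below S (fun p => dot n p) c (phi a) (phi b).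
Proof.
move=> H; pose l (t : R) := a + t *: (b - a); pose I := `[0 : R, 1]%classic.
have HI t : I t -> D (l t) /\ dot n (phi (l t)) < c by rewrite /I /= in_itv /=; exact: H.
have cl : {in I, continuous (fun t => phi (l t))}.
  move=> t /set_mem/HI[Dt _]; apply: (continuous_comp (f := l) (g := phi)).
    exact: line_continuous.
  exact: differentiable_continuous (chart_diff chart Dt).
have I0 : I 0 by rewrite /I /= in_itv /= lexx ler01.
have I1 : I 1 by rewrite /I /= in_itv /= lexx ler01.
exists ((fun t => phi (l t)) @` I); split.
- apply: connected_continuous_connected; first exact: segment_connected.
  exact: continuous_in_subspaceT.
- by move=> _ [t /HI[Dt _] <-]; exact: (chart_image chart).
- by exists 0 => //; rewrite /l scale0r addr0.
- by exists 1 => //; rewrite /l scale1r addrC subrK.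
have [|m /set_mem Im hm] := compact_EVT_max (f := fun t => dot n (phi (l t)))
  (ex_intro _ 0 I0) (@segment_compact R 0 1).
  apply: continuous_in_subspaceT => t It.
  by apply: (continuous_comp (f := fun t => phi (l t))); [exact: cl|exact: dot_continuous].
exists (dot n (phi (l m))); first by have [] := HI m Im.
by move=> _ [t It <-]; apply: hm; exact: mem_set.
Qed.

Lemma chart_locally_joined n u (e : R) : D u -> dot n (phi u) < e ->
  exists2 N, nbhs (phi u) N & forall z, S z -> N z ->
    joined_below S (fun p => dot n p) e (phi u) z.
Proof.
move=> Du hu.
have nB : nbhs u [set u' | D u' /\ dot n (phi u') < e].
  apply: filterI; first by apply: open_nbhs_nbhs.
  have hc : (fun u => dot n (phi u)) @ u --> (dot n (phi u) : R) := @height_continuous n u Du.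
  exact: (cvgr_lt _ hc).
have /nbhs_ballP[r /= r0 hr] := nB.
have [N [oN Np] hN] := chart_nbhs chart Du (nbhsx_ballx u r r0).
exists N; first exact: open_nbhs_nbhs.
move=> z Sz /(hN z Sz)[u' [Du' Bu' <-]]; apply: chart_segment => t t01.
by apply: hr; apply: ball_segment => //; exact: ballxx.
Qed.

Lemma chart_decrease n a w (s q : R) : 0 < s ->
  (forall t, 0 <= t <= s -> D (a + t *: w) /\ dot n ('d phi (a + t *: w) w) < q) ->
  dot n (phi (a + s *: w)) < dot n (phi a) + s * q.
Proof.
move=> s0 H.
have dg t : 0 <= t <= s -> is_derive t 1 (fun t : R => dot n (phi (a + t *: w)))
    (dot n ('d phi (a + t *: w) w)).
  move=> /H[Dt _]; have d1 := is_derive_line (chart_diff chart Dt).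
  by have := is_derive_dot (is_derive_cst n (t : R) 1) d1; rewrite dot0l add0r.
have [| |c c01] := @MVT R (fun t : R => dot n (phi (a + t *: w)))
   (fun t => dot n ('d phi (a + t *: w) w)) 0 s s0.
- by move=> t; rewrite in_itv /= => /andP[t0 t1]; apply: dg; rewrite !ltW.
- apply: derivable_within_continuous => t; rewrite in_itv /= => t01.
  by have [] := dg t t01.
rewrite scale0r addr0 subr0 => E.
have [_ hc] : D (a + c *: w) /\ dot n ('d phi (a + c *: w) w) < q.
  by apply: H; move: c01; rewrite in_itv /= => /andP[c0 c1]; rewrite !ltW.
rewrite -ltrBlDl E mulrC ltr_pM2l//.
Qed.

(** Translating by [t *: w] in the chart lowers heights near [u] by at least [- t * (q / 2)]. Two
    points below the level are moved down, and the translated segment between them stays below the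
    level. *)
Lemma passable_regular n u w : D u -> dot n ('d phi u w) < 0 ->
  passable S (fun p => dot n p) (phi u).
Proof.
move=> Du; set q := dot n _ => q0.
have ck : {for u, continuous (fun u => dot n ('d phi u w) : R)}.
  have : Ck 0 D (fun u => dot n ('d phi u w) : R); last by move=> /(_ u Du).
  by apply: Ck_dot => //; [exact: Ck_cst|exact: (Ck_partial chart)].
have nB : nbhs u [set u' | D u' /\ dot n ('d phi u' w) < q / 2].
  apply: filterI; first by apply: open_nbhs_nbhs.
  have ck' : (fun u => dot n ('d phi u w)) @ u --> (dot n ('d phi u w) : R) := ck.
  by apply: (cvgr_lt _ ck'); rewrite -/q; lra.
have /nbhs_ballP[r /= r0 hr] := nB.
(* Up to time [t], points of the ball of radius [r / 2] stay in the ball of radius [r]. *)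
pose t := r / (2 * (`|w| + 1)).
have w1 : 0 < `|w| + 1 by rewrite ltr_wpDl.
have t0 : 0 < t by rewrite divr_gt0// mulr_gt0.
have tw : t * `|w| < r / 2.
  rewrite /t mulrAC ltr_pdivrMr ?mulr_gt0//.
  have -> : r / 2 * (2 * (`|w| + 1)) = r * `|w| + r by field.
  by rewrite ltrDl.
(* Points of this neighborhood exceed the level of [u] by less than the drop at time [t]. *)
have nB' : nbhs u [set u' | dot n (phi u') < dot n (phi u) - t * (q / 2)].
  have hc : (fun u => dot n (phi u)) @ u --> (dot n (phi u) : R) := @height_continuous n u Du.
  by apply: (cvgr_lt _ hc); rewrite ltrBrDr gtrDl; nra.
have /nbhs_ballP[r' /= r'0 hr'] := nB'.
pose r2 := Num.min r' (r / 2).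
have r20 : 0 < r2 by rewrite lt_min r'0 divr_gt0.
have inB a s : ball u r2 a -> 0 <= s <= t ->
    D (a + s *: w) /\ dot n ('d phi (a + s *: w) w) < q / 2.
  rewrite -ball_normE /= => ha /andP[s0 st]; apply: hr; rewrite -ball_normE /=.
  rewrite opprD addrA; apply: le_lt_trans (ler_normB _ _) _.
  have ha2 : `|u - a| < r / 2 by apply: lt_le_trans ha _; rewrite ge_min lexx orbT.
  rewrite normrZ (ger0_norm s0).
  have : s * `|w| <= t * `|w| by rewrite ler_wpM2r.
  by move: ha2 tw; lra.
have dec a s : ball u r2 a -> 0 < s <= t ->
    dot n (phi (a + s *: w)) < dot n (phi a) + s * (q / 2).
  move=> ha /andP[s0 st]; apply: chart_decrease => // s' /andP[s'0 s's].
  by apply: inB => //; rewrite s'0 (le_trans s's).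
have [N [oN Np] hN] := chart_nbhs chart Du (nbhsx_ballx u r2 r20).
exists N; split => //.
  move=> z Sz /(hN z Sz)[a [Da Ba <-]] ha B nB2.
  have c4 : {for (0 : R), continuous (fun s : R => phi (a + s *: w))}.
    apply: (continuous_comp (f := fun s : R => a + s *: w)); first exact: line_continuous.
    by rewrite scale0r addr0; exact: differentiable_continuous (chart_diff chart Da).
  have nB4 : nbhs (0 : R) [set s | B (phi (a + s *: w))].
    by apply: c4; rewrite scale0r addr0.
  have /nbhs_ballP[rho /= rho0 hrho] := nB4.
  pose s := Num.min t (rho / 2).
  have s0 : 0 < s by rewrite lt_min t0 divr_gt0.
  have st : s <= t by rewrite ge_min lexx.
  exists (phi (a + s *: w)); split; last first.
    apply: hrho; rewrite -ball_normE /= sub0r normrN gtr0_norm//.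
    by rewrite gt_min (ltr_pdivrMr _ _ (ltr0n _ 2)) ltr_pMr// ltr1n orbT.
  have st' : 0 <= s <= t by rewrite ltW.
  split; first by apply: (chart_image chart); have [] := inB a s Ba st'.
  apply: lt_le_trans (dec a s Ba _) _; first by rewrite s0.
  apply: le_trans ha; rewrite gerDl; nra.
move=> z z' Sz Sz' /(hN z Sz)[a [Da Ba <-]] /(hN z' Sz')[b [Db Bb <-]] ha hb.
have vert c : ball u r2 c -> dot n (phi c) < dot n (phi u) ->
    joined_below S (fun p => dot n p) (dot n (phi u)) (phi c) (phi (c + t *: w)).
  move=> Bc hc; apply: chart_segment => s /andP[s0 s1].
  rewrite [c + _ - c]addrC addKr scalerA.
  have st : 0 <= s * t <= t by rewrite mulr_ge0 ?(ltW t0)//= ler_piMl// ltW.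
  split; first by have [] := inB c (s * t) Bc st.
  have [->|sn0] := eqVneq s 0; first by rewrite mul0r scale0r addr0.
  have s0' : 0 < s by rewrite lt_neqAle eq_sym sn0.
  have st0 : 0 < s * t by rewrite mulr_gt0.
  apply: lt_trans (dec c (s * t) Bc _) _; first by rewrite st0; case/andP: st.
  by apply: le_lt_trans hc; rewrite gerDl; nra.
apply: joined_below_trans (vert a Ba ha) _.
apply: joined_below_trans (joined_below_sym (vert b Bb hb)).
apply: chart_segment => s s01.
have -> : a + t *: w + s *: (b + t *: w - (a + t *: w)) = a + s *: (b - a) + t *: w.
  by rewrite opprD addrACA subrr addr0 addrAC.
have Bc := ball_segment Ba Bb s01.
have tt : 0 <= t <= t by rewrite ltW/=.
split; first by have [] := inB _ t Bc tt.
apply: lt_trans (dec _ t Bc _) _; first by rewrite t0 lexx.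
rewrite -ltrBrDr; apply: hr'; move: Bc; rewrite -!ball_normE /= => /lt_le_trans; apply.
by rewrite ge_min lexx.
Qed.

End ChartPaths.

(** * Global convexity *)

Section StrictMax.
Context {R : realType}.
Variables (S : set 'rV[R]_3) (D : set 'rV[R]_2) (phi : 'rV[R]_2 -> 'rV[R]_3).
Hypothesis chart : local_param S D phi.
Implicit Types (u w a b : 'rV[R]_2) (n p : 'rV[R]_3).

Let oD : open D. Proof. by case: chart. Qed.

Lemma near_line (V : normedModType R) (u w : V) (P : set V) : nbhs u P ->
  exists2 e : R, 0 < e & P (u + e *: w).
Proof.
move=> nP.
have nB4 : nbhs (0 : R) [set s | P (u + s *: w)].
  by apply: (@line_continuous R _ u w 0); rewrite scale0r addr0.
have /nbhs_ballP[rho /= rho0 hrho] := nB4.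
exists (rho / 2); first by rewrite divr_gt0.
apply: hrho; rewrite -ball_normE /= sub0r normrN gtr0_norm ?divr_gt0//.
by rewrite ltr_pdivrMr// ltr_pMr// ltr1n.
Qed.

Lemma near_other_point u (P : set 'rV[R]_2) : nbhs u P -> exists2 u', u' != u & P u'.
Proof.
move=> /(near_line (delta_mx 0 0))[e e0 Pe]; exists (u + e *: delta_mx 0 0) => //.
rewrite addrC -subr_eq0 addrK scaler_eq0 gt_eqF//=.
by apply/negP => /eqP/rowP/(_ 0); rewrite !mxE /= => /eqP; rewrite oner_eq0.
Qed.

Lemma row2_eq0 u : u 0 0 = 0 -> u 0 1 = 0 -> u = 0.
Proof.
move=> u0 u1; apply/rowP => -[[|[|//]] hi]; rewrite mxE.
  by rewrite (_ : Ordinal hi = 0) //; apply: val_inj.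
by rewrite (_ : Ordinal hi = 1) //; apply: val_inj.
Qed.

(** Everything near [u] except [u] is below the level, and a punctured disc is connected: two points
    are joined by their segment or, if it contains [u], by a detour. *)
Lemma passable_strict_max n u : D u ->
  (\forall u' \near u, u' != u -> dot n (phi u') < dot n (phi u)) ->
  passable S (fun p => dot n p) (phi u).
Proof.
move=> Du hmax.
have nB : nbhs u [set u' | D u' /\ (u' != u -> dot n (phi u') < dot n (phi u))].
  by apply: filterI => //; exact: open_nbhs_nbhs.
have /nbhs_ballP[r /= r0 hr] := nB.
have [N [oN Np] hN] := chart_nbhs chart Du (nbhsx_ballx u r r0).
exists N; split => //.
  move=> z Sz /(hN z Sz)[a [Da Ba <-]] _.
  have [->|au] := eqVneq a u; last first.
    apply: subset_closure; split; first exact: (chart_image chart).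
    by have [_] := hr a Ba; apply.
  move=> B nB2.
  have nB3 : nbhs u (phi @^-1` B) := differentiable_continuous (chart_diff chart Du) nB2.
  have [u' u'u [Bu' Pu']] := near_other_point (filterI nB3 (nbhsx_ballx u r r0)).
  have [Du' hu'] := hr u' Pu'.
  exists (phi u'); split=> //; split; last exact: hu'.
  exact: (chart_image chart).
move=> z z' Sz Sz' /(hN z Sz)[a [Da Ba <-]] /(hN z' Sz')[b [Db Bb <-]] ha hb.
have au : a != u by apply: contraTneq ha => ->; rewrite ltxx.
have bu : b != u by apply: contraTneq hb => ->; rewrite ltxx.
have seg c d : ball u r c -> ball u r d ->
    (forall t : R, 0 <= t <= 1 -> c + t *: (d - c) <> u) ->
    joined_below S (fun p => dot n p) (dot n (phi u)) (phi c) (phi d).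
  move=> Bc Bd cd; apply: (chart_segment chart) => t t01.
  have [Dt ht] := hr _ (ball_segment Bc Bd t01).
  by split=> //; apply: ht; apply/eqP; exact: cd.
have [[t [t01 tu]]|noseg] :=
    pselect (exists t : R, 0 <= t <= 1 /\ a + t *: (b - a) = u); last first.
  by apply: seg => // t t01 tu; apply: noseg; exists t.
(* The vector [a - u] turned by a right angle; the detour goes through [u + e *: w]. *)
pose w : 'rV[R]_2 := \row_i (if i == 0 then u 0 1 - a 0 1 else a 0 0 - u 0 0).
have [e e0 Be] := near_line w (nbhsx_ballx u r r0).
have ct (c : 'rV[R]_2) : c != u -> 0 < (c 0 0 - u 0 0) ^+ 2 + (c 0 1 - u 0 1) ^+ 2.
  move=> cu; rewrite lt_neqAle addr_ge0 ?sqr_ge0// andbT eq_sym paddr_eq0 ?sqr_ge0//.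
  rewrite !sqrf_eq0 !subr_eq0; apply: contra cu => /andP[/eqP c0 /eqP c1].
  by rewrite -subr_eq0; apply/eqP/row2_eq0; rewrite !mxE ?c0 ?c1 subrr.
have qa := ct a au; have qb := ct b bu.
have /rowP tu0 := tu; have := tu0 0; have := tu0 1; rewrite !mxE => t1 t0.
apply: (@joined_below_trans _ _ _ _ _ _ (phi (u + e *: w))).
  apply: seg => // s s01 /rowP su; have := su 0; have := su 1; rewrite !mxE /= => s1 s0.
  move: qa t0 t1 s0 s1 s01 t01 e0.
  move: (a 0 0) (a 0 1) (u 0 0) (u 0 1) (b 0 0) (b 0 1) => a0 a1 u0 u1 b0 b1.
  move=> qa _ _ s0 s1 _ _ e0.
  (* If a point of the first segment were [u], its scalar product and determinant with [a - u] would
     give [1 - s = 0] and [s * e = 0]. *)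
  have E1 : (1 - s) * ((a0 - u0) ^+ 2 + (a1 - u1) ^+ 2) = 0.
    transitivity ((a0 - u0) * (a0 + s * (u0 + e * (u1 - a1) - a0) - u0) +
      (a1 - u1) * (a1 + s * (u1 + e * (a0 - u0) - a1) - u1)); first by ring.
    by rewrite s0 s1 !subrr !mulr0 addr0.
  have E2 : s * e * ((a0 - u0) ^+ 2 + (a1 - u1) ^+ 2) = 0.
    transitivity ((a0 - u0) * (a1 + s * (u1 + e * (a0 - u0) - a1) - u1) -
      (a1 - u1) * (a0 + s * (u0 + e * (u1 - a1) - a0) - u0)); first by ring.
    by rewrite s0 s1 !subrr !mulr0 subr0.
  move/eqP: E1; rewrite mulf_eq0 (gt_eqF qa) orbF subr_eq0 => /eqP s1'.
  by move/eqP: E2; rewrite -s1' mul1r mulf_eq0 (gt_eqF qa) (gt_eqF e0).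
apply: seg => // s s01 /rowP su; have := su 0; have := su 1; rewrite !mxE /= => s1 s0.
move: qa qb t0 t1 s0 s1 s01 t01 e0.
move: (a 0 0) (a 0 1) (u 0 0) (u 0 1) (b 0 0) (b 0 1) => a0 a1 u0 u1 b0 b1.
move=> qa qb t0 t1 s0 s1 _ _ e0.
have t_neq0 : t != 0.
  apply: contraTneq qa => tz; move: t0 t1; rewrite tz !mul0r !addr0 => -> ->.
  by rewrite !subrr expr0n addr0 ltxx.
(* Since [u] is on the segment from [a] to [b] and differs from [a], the vectors [a - u] and [b - u]
   are collinear; the second segment could then meet [u] only at its end [b]. *)
have E1 : t * ((a0 - u0) * (b1 - u1) - (a1 - u1) * (b0 - u0)) = 0.
  transitivity ((a0 - u0) * (a1 + t * (b1 - a1) - u1) -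
    (a1 - u1) * (a0 + t * (b0 - a0) - u0)); first by ring.
  by rewrite t0 t1 !subrr !mulr0 subr0.
move/eqP: E1; rewrite mulf_eq0 (negPf t_neq0) /= => /eqP E1.
have E2 : e * (1 - s) * ((a0 - u0) ^+ 2 + (a1 - u1) ^+ 2) = 0.
  transitivity ((a0 - u0) * (u1 + e * (a0 - u0) + s * (b1 - (u1 + e * (a0 - u0))) - u1) -
    (a1 - u1) * (u0 + e * (u1 - a1) + s * (b0 - (u0 + e * (u1 - a1))) - u0) -
    s * ((a0 - u0) * (b1 - u1) - (a1 - u1) * (b0 - u0))); first by ring.
  by rewrite s0 s1 E1 !subrr !mulr0 !subr0.
move/eqP: E2; rewrite !mulf_eq0 (gt_eqF qa) (gt_eqF e0) orbF /= subr_eq0 => /eqP s1'.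
move: s0 s1; rewrite -s1' !mul1r ![_ + (_ - _)]addrC !subrK => b0E b1E.
by move: qb; rewrite b0E b1E !subrr expr0n addr0 ltxx.
Qed.

End StrictMax.

(** * Supporting planes at every point of the surface *)

Section GlobalConvexity.
Context {R : realType}.
Variables (S : set 'rV[R]_3).
Hypotheses (hS : closed_surface S) (hconv : quadratically_convex S).
Implicit Types (n p y X : 'rV[R]_3).

Lemma strict_local_min_chart D phi u n : local_param S D phi -> D u ->
  (\forall u' \near u, u' != u -> dot n (phi u) < dot n (phi u')) ->
  strict_local_min S (fun p => dot n p) (phi u).
Proof.
move=> chart Du hmin; have [N oN hN] := chart_nbhs chart Du hmin.
exists N; split=> // z Sz /(hN z Sz)[u' [Du' hu' <-]] uu'.
by apply: hu'; apply: contra_notN uu' => /eqP ->.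
Qed.

Lemma critical_alternative D phi u n : local_param S D phi -> D u -> n != 0 ->
  (forall w, dot n ('d phi u w) = 0) ->
  (\forall u' \near u, u' != u -> dot n (phi u) < dot n (phi u')) \/
  (\forall u' \near u, u' != u -> dot n (phi u') < dot n (phi u)).
Proof.
move=> chart Du n0 nperp.
have [hn|hn] := hessian_definite chart Du n0 (hconv chart Du) nperp.
  by left; exact: (definite_hessian_strict_min chart Du hn nperp).
right; have nperp' w : dot (- n) ('d phi u w) = 0 by rewrite dotNl nperp oppr0.
apply: filterS (definite_hessian_strict_min chart Du hn nperp') => u' hu' /hu'.
by rewrite !dotNl ltrN2.
Qed.

(** Quadratic convexity excludes saddles: at a critical point the Hessian is definite, and both
    regular points and strict maxima are passable. *)
Lemma min_or_passable n y : n != 0 -> S y ->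
  strict_local_min S (fun p => dot n p) y \/ passable S (fun p => dot n p) y.
Proof.
move=> n0 Sy; have [_ _ _ /(_ y Sy)[D [phi [chart [u Du <-]]]]] := hS.
have [nperp|] := pselect (forall w, dot n ('d phi u w) = 0); last first.
  move=> /existsNP[w /eqP nw]; right.
  have [dneg|dpos] := ltrP (dot n ('d phi u w)) 0.
    exact: (passable_regular chart Du dneg).
  apply: (passable_regular chart (w := - w) Du).
  by rewrite linearN dotNr oppr_lt0 lt_neqAle eq_sym nw.
have [hmin|hmax] := critical_alternative chart Du n0 nperp.
  by left; exact: (strict_local_min_chart chart Du hmin).
by right; exact: (passable_strict_max chart Du hmax).
Qed.

Lemma height_min_unique n p y : n != 0 -> S p -> S y ->
  strict_local_min S (fun p => dot n p) p -> strict_local_min S (fun p => dot n p) y ->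
  p = y.
Proof.
move=> n0 Sp Sy; have [_ cS conS charts] := hS.
apply: strict_local_min_unique => //.
- exact: dot_continuous.
- move=> z Sz e; have [D [phi [chart [u Du <-]]]] := charts z Sz.
  move=> /(chart_locally_joined chart Du)[N nN hN]; exists N => // x Sx /(hN x Sx).
  move=> [C [cC CS Cu Cx [e' e'e he']]]; exists C; split=> // z' /he'/le_trans; apply.
  exact: ltW.
- by move=> z; exact: min_or_passable.
Qed.

Lemma min_critical n D phi u : local_param S D phi -> D u ->
  (forall y, S y -> dot n (phi u) <= dot n y) -> forall w, dot n ('d phi u w) = 0.
Proof.
move=> chart Du hmin w.
have nD : \forall t \near (0 : R), D (u + t *: w).
  apply: (@line_continuous R _ u w 0); rewrite scale0r addr0.
  by apply: open_nbhs_nbhs; split=> //; case: chart.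
have d t : D (u + t *: w) -> is_derive t 1 (fun t : R => dot n (phi (u + t *: w)) : R)
    (dot n ('d phi (u + t *: w) w)).
  move=> Dt; have d1 := is_derive_line (chart_diff chart Dt).
  by have := is_derive_dot (is_derive_cst n (t : R) 1) d1; rewrite dot0l add0r.
have := d 0; rewrite scale0r addr0 => /(_ Du)/derive_local_min_eq0; apply.
  apply: filterS nD => t Dt; rewrite scale0r addr0; apply: hmin.
  exact: (chart_image chart).
by apply: filterS nD => t /d[].
Qed.

(** The alternative, a strict local maximum, is impossible at a minimizer since [S] has other points
    nearby. *)
Lemma min_strict_local_min n p : n != 0 -> S p ->
  (forall y, S y -> dot n p <= dot n y) -> strict_local_min S (fun p => dot n p) p.
Proof.
move=> n0 Sp; have [_ _ _ /(_ p Sp)[D [phi [chart [u Du <-]]]]] := hS.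
move=> hmin; have nperp := min_critical chart Du hmin.
have [h|hmax] := critical_alternative chart Du n0 nperp.
  exact: (strict_local_min_chart chart Du h).
have nD : nbhs u D by apply: open_nbhs_nbhs; split=> //; case: chart.
have [u' uu' [hu' Du']] := near_other_point (filterI hmax nD).
by have := hmin _ (chart_image chart Du'); rewrite leNgt hu'.
Qed.

(** A second minimizer would be a second strict local minimum, against the mountain pass lemma. *)
Lemma minimizer_strict n p : n != 0 -> S p ->
  (forall y, S y -> dot n p <= dot n y) -> forall y, S y -> y <> p -> dot n p < dot n y.
Proof.
move=> n0 Sp hmin y Sy yp; rewrite ltNge; apply/negP => hy; apply: yp.
apply: (height_min_unique n0) => //; apply: min_strict_local_min => // z /hmin.
exact: le_trans.
Qed.

Lemma height_minimizer n : exists2 p, S p & forall y, S y -> dot n p <= dot n y.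
Proof.
have [S0 cS _ _] := hS.
have [p /set_mem Sp hp] := compact_EVT_min S0 cS (continuous_subspaceT (@dot_continuous R n)).
by exists p => // y Sy; apply: hp; exact: mem_set.
Qed.

Definition inner_normal p n : Prop :=
  n != 0 /\ forall y, S y -> y <> p -> dot n p < dot n y.

Lemma inner_normal_le p n y : inner_normal p n -> S y -> dot n p <= dot n y.
Proof.
by move=> [_ h] Sy; have [->//|/eqP yp] := eqVneq y p; rewrite ltW// h.
Qed.

(** For one of the two chart normals [p] is a strict local minimum of the height; as there is only
    one such minimum, it coincides with a global minimizer. *)
Lemma exists_inner_normal p : S p -> exists n, inner_normal p n.
Proof.
move=> Sp; have [_ _ _ /(_ p Sp)[D [phi [chart [u Du pE]]]]] := hS.
pose m := cross ('d phi u (delta_mx 0 0)) ('d phi u (delta_mx 0 1)).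
have m0 : m != 0 := chart_normal_neq0 chart Du.
have mperp w : dot m ('d phi u w) = 0.
  by rewrite (chart_partials2 phi u w) dotDr !dotZr dot_crossl dot_crossr !mulr0 addr0.
have key n : n != 0 -> strict_local_min S (fun p => dot n p) p -> inner_normal p n.
  move=> n0 hn; split=> // y Sy yp.
  have [q Sq hq] := height_minimizer n.
  have qp : p = q := height_min_unique n0 Sp Sq hn (min_strict_local_min n0 Sq hq).
  by rewrite -qp in hq; exact: minimizer_strict.
have [h|h] := critical_alternative chart Du m0 mperp.
  by exists m; apply: key => //; rewrite -pE; exact: (strict_local_min_chart chart Du h).
exists (- m); apply: key; first by rewrite oppr_eq0.
rewrite -pE; apply: (strict_local_min_chart chart) => //.
by apply: filterS h => u' hu' /hu'; rewrite !dotNl ltrN2.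
Qed.

(** The coefficients are the pairings with the dual basis of [a], [b], [m], multiplied by the
    determinant [dot m m] of that basis. *)
Lemma cross_frame a b X : let m := cross a b in dot m m *: X =
  dot X (cross b m) *: a + dot X (cross m a) *: b + dot X m *: m.
Proof. by rewrite /=; apply: eqrV3; vec3. Qed.

(** Velocities from any chart are orthogonal to [n] because [p] minimizes the height; conversely the
    partial derivatives of one chart span the orthogonal plane. *)
Lemma tangent_spaceE p n X : S p -> inner_normal p n ->
  tangent_space S p X <-> dot n X = 0.
Proof.
move=> Sp hn; split.
  move=> [D [phi [u [w [chart Du uE ->]]]]].
  apply: (min_critical chart Du) => y Sy; rewrite uE; exact: inner_normal_le.
have [_ _ _ /(_ p Sp)[D [phi [chart [u Du pE]]]]] := hS.
have hmin y : S y -> dot n (phi u) <= dot n y.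
  by rewrite pE; exact: inner_normal_le.
have nperp := min_critical chart Du hmin.
move=> nX; pose a := 'd phi u (delta_mx 0 0); pose b := 'd phi u (delta_mx 0 1).
pose m := cross a b.
have m0 : dot m m != 0 by rewrite dot_eq0; exact: (chart_normal_neq0 chart Du).
have n0 : n != 0 by have [] := hn.
have := perp_cross_parallel (nperp (delta_mx 0 0)) (nperp (delta_mx 0 1)).
rewrite -/a -/b -/m => nE.
have nm : dot n m != 0.
  apply: contra_neq n0 => nm0; move/eqP: nE; rewrite nm0 scale0r scaler_eq0 (negPf m0).
  by move/eqP.
have Xm : dot X m = 0.
  have : dot (dot m m *: n) X = 0 by rewrite dotZl nX mulr0.
  rewrite nE dotZl => /eqP; rewrite mulf_eq0 (negPf nm) /= dotC => /eqP //.
exists D, phi, u, ((dot m m)^-1 *: (dot X (cross b m) *: delta_mx 0 0 +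
   dot X (cross m a) *: delta_mx 0 1)); split=> //.
rewrite linearZ linearD !linearZ -/a -/b.
have := cross_frame a b X; rewrite /= -/m Xm scale0r addr0 => <-.
by rewrite scalerA mulVf// scale1r.
Qed.

End GlobalConvexity.

(** * Points of tangency *)

(** The tube lemma: the parameters for which no point of [K] qualifies form an open set. *)
Lemma compact_projection_closed (T Y : topologicalType) (K : set Y) (Q : T -> Y -> Prop) :
  compact K ->
  (forall t p, K p -> ~ Q t p -> \forall p' \near p & t' \near t, ~ Q t' p') ->
  closed [set t | exists2 p, K p & Q t p].
Proof.
move=> cK openQ; rewrite -openC; rewrite openE => t nt.
have := (compact_near_coveringP K).1 cK T (nbhs t) (fun t p => ~ Q t p).
move=> /(_ _) H; apply: filterS (H _) => [t' nQ [p Kp Qp]|p Kp].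
  exact: nQ Qp.
by apply: openQ => // Qp; apply: nt; exists p.
Qed.

Lemma near_pair_neg (R : realType) (T Y : topologicalType) (f : T * Y -> R) t p :
  {for (t, p), continuous f} -> f (t, p) < 0 -> \forall p' \near p & t' \near t, f (t', p') < 0.
Proof.
move=> cf f0.
have cf' : f @ (t, p) --> f (t, p) := cf.
have [[A B] /= [nA nB] AB] := cvgr_lt _ cf' _ f0.
by exists (B, A) => //= -[p' t'] /= [Bp' At']; exact: (AB (t', p')).
Qed.

(** * Separation of a line from the surface *)

Section LineSeparation.
Context {R : realType}.
Variables (S : set 'rV[R]_3).
Hypotheses (hS : closed_surface S) (hconv : quadratically_convex S).
Implicit Types (n p y q x v w z X : 'rV[R]_3).

Lemma other_point p : S p -> exists2 y, S y & y <> p.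
Proof.
move=> Sp; have [_ _ _ /(_ p Sp)[D [phi [chart [u Du <-]]]]] := hS.
have [oD _ _ _ [psi _ phiK]] := chart.
have [u' uu' Du'] := near_other_point (open_nbhs_nbhs (conj oD Du)).
exists (phi u'); first exact: (chart_image chart).
move=> E; move/eqP: uu'; apply; rewrite -(phiK u') ?inE// E phiK ?inE//.
Qed.

Lemma height_not_constant n p : n != 0 -> S p -> ~ (forall y, S y -> dot n y = dot n p).
Proof.
move=> n0 Sp hn; have [y Sy yp] := other_point Sp.
have hmin z : S z -> dot n p <= dot n z by move=> Sz; rewrite (hn z Sz).
by have := minimizer_strict hS hconv n0 Sp hmin Sy yp; rewrite (hn y Sy) ltxx.
Qed.

(** The squared distance to [z] is critical at [p], so [p - z] is orthogonal to the tangent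
    plane. *)
Lemma nearest_point_normal z p n : S p -> inner_normal S p n ->
  (forall y, S y -> dot (p - z) (p - z) <= dot (y - z) (y - z)) ->
  dot n n *: (p - z) = dot n (p - z) *: n.
Proof.
move=> Sp hn hmin.
have perp X : dot n X = 0 -> dot (p - z) X = 0.
  move=> /(tangent_spaceE hS _ Sp hn)[D [phi [u [w [chart Du uE ->]]]]].
  have nD : \forall t \near (0 : R), D (u + t *: w).
    apply: (@line_continuous R _ u w 0); rewrite scale0r addr0.
    by apply: open_nbhs_nbhs; split=> //; case: chart.
  have d t : D (u + t *: w) -> is_derive t 1
      (fun t : R => dot (phi (u + t *: w) - z) (phi (u + t *: w) - z) : R)
      (2 * dot (phi (u + t *: w) - z) ('d phi (u + t *: w) w)).
    move=> Dt; have d1 := is_derive_line (chart_diff chart Dt).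
    have d2 := is_deriveB d1 (is_derive_cst z (t : R) 1); rewrite subr0 in d2.
    have := is_derive_dot d2 d2; rewrite fctE /= => /is_derive_eq; apply.
    by rewrite dotC; ring.
  have := d 0; rewrite scale0r addr0 => /(_ Du)/derive_local_min_eq0 h.
  have /eqP : 2 * dot (phi u - z) ('d phi u w) = 0.
    apply: h; last by apply: filterS nD => t /d[].
    apply: filterS nD => t Dt; rewrite scale0r addr0 uE; apply: hmin.
    exact: (chart_image chart).
  by rewrite mulf_eq0 pnatr_eq0 /= uE => /eqP.
(* Up to a factor, [X] is the tangential part of [p - z]: it is orthogonal to [n] and to [p - z],
   hence to itself. *)
apply/subr0_eq; set X := dot n n *: (p - z) - _.
have nX : dot n X = 0 by rewrite /X; vec3.
have zX := perp X nX.
have XX : dot X X = dot n n * dot (p - z) X - dot n (p - z) * dot n X.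
  by rewrite {1}/X; move: X {nX zX} => Y; vec3.
by apply/eqP; rewrite -dot_eq0 XX zX nX !mulr0 subrr.
Qed.


(** For [v <> 0] the cross product vanishes exactly when [y] is on the line through [x] with
    direction [v]; no unit length is imposed on [v]. *)
Definition avoids x v := forall y, S y -> cross v (y - x) != 0.

Lemma dot_cross_unit v a : dot v v = 1 ->
  dot (cross v a) (cross v a) = dot a a - dot a v ^+ 2.
Proof.
move=> v1; transitivity (dot v v * dot a a - dot a v ^+ 2); last by rewrite v1 mul1r.
by vec3.
Qed.

Lemma dist_sqr_expand z p y : dot (y - z) (y - z) =
  dot (y - p) (y - p) + 2 * dot (p - z) (y - p) + dot (p - z) (p - z).
Proof. by vec3. Qed.

Lemma dot_quadratic_continuous (T : topologicalType) (f g : T -> 'rV[R]_3) t :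
  {for t, continuous f} -> {for t, continuous g} ->
  {for t, continuous (fun t => dot (f t) (g t) : R)}.
Proof.
move=> cf cg.
have c (h : T -> 'rV[R]_3) i : {for t, continuous h} -> {for t, continuous (fun t => h t 0 i : R)}.
  by move=> ch; apply: (continuous_comp (f := h) (g := fun M : 'rV[R]_3 => M 0 i : R));
    [exact: ch|exact: coord_continuous].
rewrite (_ : (fun t => _) = fun t => f t 0 0 * g t 0 0 + f t 0 1 * g t 0 1 + f t 0 2 * g t 0 2).
  have m i := continuousM (c f i cf) (c g i cg).
  exact: (continuousD (continuousD (m 0) (m 1)) (m 2)).
by apply/funext => s; rewrite dotE.
Qed.

Lemma sub_cst_continuous z : continuous (fun p : 'rV[R]_3 => p - z).
Proof.
move=> p; apply: differentiable_continuous.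
by have [] := is_diffB (is_diff_id p) (is_diff_cst z p).
Qed.

Lemma dist_sqr_continuous z : continuous (fun p => dot (p - z) (p - z) : R).
Proof.
by move=> p; exact: (dot_quadratic_continuous (@sub_cst_continuous z p) (@sub_cst_continuous z p)).
Qed.

(* The sign of [dot (p - z) (y - p)], with [p] the point of [S] nearest to [z],
   tells whether [z] is outside or inside; neither can change along a line that
   avoids [S], and far away points are outside. *)
Lemma outside_along_line x v : dot v v = 1 -> avoids x v -> forall t : R,
  exists2 p, S p & forall y, S y -> 0 <= dot (p - (x + t *: v)) (y - p).
Proof.
move=> v1 av; have [S0 cS _ _] := hS.
pose z (t : R) := x + t *: v.
pose Qo (t : R) p := forall y, S y -> 0 <= dot (p - z t) (y - p).
(* A point as in [Qo] is automatically nearest to [z t], while here this must be required: [disj]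
   uses it to identify the two points, after which [S] would lie in a plane. *)
pose Qi (t : R) p := forall y, S y -> dot (p - z t) (y - p) <= 0 /\
  dot (p - z t) (p - z t) <= dot (y - z t) (y - z t).
have zS t p : S p -> p - z t != 0.
  move=> Sp; apply: contra_neq (av p Sp) => /subr0_eq ->.
  by rewrite /z addrC addKr; apply: eqrV3; vec3.
have cz : continuous z := @line_continuous R _ x v.
have cpz (p : 'rV[R]_3) (t : R) : {for (t, p), continuous (fun q : R * 'rV[R]_3 => q.2 - z q.1)}.
  apply: cvgB; first exact: cvg_snd.
  by apply: (continuous_comp (f := fst)); [exact: cvg_fst|exact: cz].
have cyp (y p : 'rV[R]_3) (t : R) : {for (t, p), continuous (fun q : R * 'rV[R]_3 => y - q.2)}.
  by apply: cvgB; [exact: cvg_cst|exact: cvg_snd].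
have cyz (y p : 'rV[R]_3) (t : R) : {for (t, p), continuous (fun q : R * 'rV[R]_3 => y - z q.1)}.
  apply: cvgB; first exact: cvg_cst.
  by apply: (continuous_comp (f := fst)); [exact: cvg_fst|exact: cz].
have clO : closed [set t | exists2 p, S p & Qo t p].
  apply: compact_projection_closed => // t p Sp /existsNP[y /not_implyP[Sy /negP]].
  rewrite -ltNge => h.
  have := @near_pair_neg R _ _ (fun q : R * 'rV[R]_3 => dot (q.2 - z q.1) (y - q.2)) t p
    (dot_quadratic_continuous (cpz p t) (cyp y p t)) h.
  by apply: filterS => -[p' t'] /= h' /(_ y Sy); rewrite leNgt h'.
have clI : closed [set t | exists2 p, S p & Qi t p].
  apply: compact_projection_closed => // t p Sp /existsNP[y /not_implyP[Sy /not_andP[]]].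
    move=> /negP; rewrite -ltNge -oppr_lt0 => h.
    have := @near_pair_neg R _ _ (fun q : R * 'rV[R]_3 => - dot (q.2 - z q.1) (y - q.2)) t p
      (continuousN (dot_quadratic_continuous (cpz p t) (cyp y p t))) h.
    by apply: filterS => -[p' t'] /=; rewrite oppr_lt0 => h' /(_ y Sy)[]; rewrite leNgt h'.
  move=> /negP; rewrite -ltNge -subr_lt0 => h.
  have := @near_pair_neg R _ _ (fun q : R * 'rV[R]_3 => dot (y - z q.1) (y - z q.1) -
      dot (q.2 - z q.1) (q.2 - z q.1)) t p
    (continuousB (dot_quadratic_continuous (cyz y p t) (cyz y p t))
      (dot_quadratic_continuous (cpz p t) (cpz p t))) h.
  by apply: filterS => -[p' t'] /=; rewrite subr_lt0 => h' /(_ y Sy)[_]; rewrite leNgt h'.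
have cover t : (exists2 p, S p & Qo t p) \/ (exists2 p, S p & Qi t p).
  have cd : continuous (fun p => dot (p - z t) (p - z t) : R).
    exact: dist_sqr_continuous.
  have [p /set_mem Sp hp] := compact_EVT_min S0 cS (continuous_subspaceT cd).
  have {}hp y : S y -> dot (p - z t) (p - z t) <= dot (y - z t) (y - z t).
    by move=> Sy; apply: hp; exact: mem_set.
  have [n hn] := exists_inner_normal hS hconv Sp.
  have nE := nearest_point_normal Sp hn hp.
  have nn : 0 < dot n n by rewrite dot_gt0; case: hn.
  have hE y : dot n n * dot (p - z t) (y - p) = dot n (p - z t) * (dot n y - dot n p).
    by rewrite -dotZl nE dotZl (dotBr n y p).
  have [c0|c0] := lerP 0 (dot n (p - z t)).
    left; exists p => // y Sy; rewrite -(pmulr_rge0 _ nn) hE mulr_ge0// subr_ge0.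
    exact: (inner_normal_le hn).
  right; exists p => // y Sy; split; last exact: hp.
  rewrite -(pmulr_rle0 _ nn) hE nmulr_rle0// subr_ge0; exact: (inner_normal_le hn).
have disj t p q : S p -> S q -> Qo t p -> Qi t q -> False.
  move=> Sp Sq ho hi.
  have pq : q - p = 0.
    apply/eqP; rewrite -dot_eq0 eq_le dot_ge0 andbT.
    have := (hi p Sp).2; rewrite (dist_sqr_expand (z t) p q) -[leRHS]add0r lerD2r => h.
    apply: le_trans h; rewrite lerDl mulr_ge0//; exact: ho.
  move/subr0_eq in pq; subst q.
  apply: (height_not_constant (zS t p Sp) Sp) => y Sy.
  by apply/eqP; rewrite -subr_eq0 -dotBr eq_le ho// andbT; have [] := hi y Sy.
have someO : exists t, exists2 p, S p & Qo t p.
  apply: contrapT => noO.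
  have allI t : exists2 p, S p & Qi t p.
    by have [h|//] := cover t; exfalso; apply: noO; exists t.
  have cd : continuous (fun p => dot (p - x) (p - x) : R).
    exact: dist_sqr_continuous.
  have [m /set_mem Sm hm] := compact_EVT_max S0 cS (continuous_subspaceT cd).
  pose M := dot (m - x) (m - x).
  have {}hm y : S y -> dot (y - x) (y - x) <= M by move=> Sy; apply: hm; exact: mem_set.
  have [q Sq hq] := height_minimizer hS v.
  have v0 : v != 0 by rewrite -dot_eq0 v1 oner_neq0.
  have /existsNP[q' /not_implyP[Sq' /eqP qq']] := height_not_constant v0 Sq.
  have {}qq' : 0 < dot v q' - dot v q by rewrite subr_gt0 lt_neqAle eq_sym qq' hq.
  (* If [z t] is inside, with nearest point [p], then [t * (dot v y - dot v p)] lies between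
     [- 5 * M / 2] and [M / 2] for all [y] in [S]. Its values at [q'] and [q] would then differ by
     at most [3 * M]. *)
  pose t := (3 * M + 1) / (dot v q' - dot v q).
  have [p Sp hp] := allI t.
  have key y : S y -> 2 * (t * (dot v y - dot v p)) <= M /\
      - (5 * M) <= 2 * (t * (dot v y - dot v p)).
    move=> Sy; have [h1 h2] := hp y Sy.
    have hA := hm p Sp; have hC := hm y Sy.
    have A0 := dot_ge0 (p - x); have C0 := dot_ge0 (y - x).
    have hB : dot (y - p) (y - p) <= 2 * dot (y - x) (y - x) + 2 * dot (p - x) (p - x).
      rewrite -subr_ge0 (_ : _ - _ = dot (y - x + (p - x)) (y - x + (p - x))) ?dot_ge0//.
      by vec3.
    have E1 := dist_sqr_expand x p y.
    have E2 := dist_sqr_expand (z t) p y.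
    have E3 : dot (p - z t) (y - p) = dot (p - x) (y - p) - t * (dot v y - dot v p).
      by rewrite /z; vec3.
    move: h1 h2 hA hC A0 C0 hB E1 E2 E3.
    move: (dot (p - z t) (y - p)) (dot (p - x) (y - p)) (t * _) (dot (p - x) (p - x))
      (dot (y - x) (y - x)) (dot (y - p) (y - p)) (dot (y - z t) _) (dot (p - z t) _).
    by move=> *; split; lra.
  have [h1 _] := key q' Sq'; have [_ h2] := key q Sq.
  have tE : t * (dot v q' - dot v q) = 3 * M + 1 by rewrite /t divfK// gt_eqF.
  have : t * (dot v q' - dot v p) - t * (dot v q - dot v p) = 3 * M + 1 by rewrite -tE; ring.
  have M0 : 0 <= M := dot_ge0 _.
  by move: h1 h2 M0; move: (t * _) (t * _) => a b; lra.
have OT : [set t | exists2 p, S p & Qo t p] = setT.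
  have conT : connected [set: R] by apply/connected_intervalP.
  apply: conT => //.
    exists (~` [set t | exists2 p, S p & Qi t p]); first exact: closed_openC.
    rewrite setTI; apply/seteqP; split=> t /=.
      by move=> [p Sp ho] [q Sq hi]; exact: (disj t p q).
    by move=> ni; have [|] := cover t.
  by exists [set t | exists2 p, S p & Qo t p]; rewrite ?setTI.
move=> t; have : [set t | exists2 p, S p & Qo t p] t by rewrite OT.
by [].
Qed.

(** Let [p] be a point of [S] nearest to the line and [z] its foot. As [p] is also nearest to [z],
    it is the witness that [z] is outside, so [u = p - z] is the normal sought; avoidance makes it
    nonzero and the inequality strict. *)
Lemma line_half_space x v : dot v v = 1 -> avoids x v ->
  exists2 u, dot u v = 0 & forall y, S y -> 0 < dot u (y - x).
Proof.
move=> v1 av; have [S0 cS _ _] := hS.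
have cd : continuous (fun p => dot (p - x) (p - x) - dot (p - x) v ^+ 2 : R).
  move=> p; have cpx := @sub_cst_continuous x p.
  have cv : {for p, continuous (fun _ : 'rV[R]_3 => v)} by exact: cst_continuous.
  have cpv := dot_quadratic_continuous cpx cv.
  exact: (continuousB (dot_quadratic_continuous cpx cpx) (continuousM cpv cpv)).
have [p /set_mem Sp hp] := compact_EVT_min S0 cS (continuous_subspaceT cd).
have {}hp y : S y -> dot (p - x) (p - x) - dot (p - x) v ^+ 2 <=
   dot (y - x) (y - x) - dot (y - x) v ^+ 2 by move=> Sy; apply: hp; exact: mem_set.
pose t := dot (p - x) v; pose u := p - (x + t *: v).
have uv : dot u v = 0.
  transitivity (dot (p - x) v - t * dot v v); first by rewrite /u; vec3.
  by rewrite v1 mulr1 subrr.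
have [q Sq hq] := outside_along_line v1 av t.
have expand y : dot (y - (x + t *: v)) (y - (x + t *: v)) =
    dot (y - x) (y - x) - dot (y - x) v ^+ 2 + (dot (y - x) v - t) ^+ 2.
  transitivity (dot (y - x) (y - x) - 2 * t * dot (y - x) v + t ^+ 2 * dot v v).
    by vec3.
  by rewrite v1; ring.
have qp : q = p.
  apply/esym/subr0_eq/eqP; rewrite -dot_eq0 eq_le dot_ge0 andbT.
  have := expand p; rewrite -/t subrr expr0n addr0 => Ep.
  have := hp q Sq; rewrite -Ep => h.
  have := expand q => Eq.
  have h2 : dot (p - (x + t *: v)) (p - (x + t *: v)) <=
     dot (q - (x + t *: v)) (q - (x + t *: v)).
    by rewrite Eq; apply: le_trans h _; rewrite lerDl sqr_ge0.
  have := dist_sqr_expand (x + t *: v) q p => E.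
  have h3 := hq p Sp; move: h2; rewrite E; lra.
subst q; exists u => // y Sy.
have -> : dot u (y - x) = dot u (y - p) + dot u u.
  transitivity (dot u (y - p) + dot u u + t * dot u v); first by rewrite /u; vec3.
  by rewrite uv mulr0 addr0.
apply: ltr_wpDl; first exact: hq.
rewrite dot_gt0; apply: contra_neq (av p Sp) => /subr0_eq ->.
by rewrite addrC addKr; apply: eqrV3; vec3.
Qed.

End LineSeparation.

(** * Triple products as planar determinants *)

Section TripleProduct.
Context {R : realType}.
Implicit Types (u v w a b x : 'rV[R]_3).

Lemma tripC w a b : trip w b a = - trip w a b. Proof. by vec3. Qed.
Lemma trip_aa w a : trip w a a = 0. Proof. by vec3. Qed.
Lemma tripNl w a b : trip (- w) a b = - trip w a b. Proof. by vec3. Qed.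

(** Up to the factor, [trip v] is the planar determinant in the coordinates along [u] and
    [cross v u]. On the side where [dot u] is positive, its sign compares slopes. *)
Lemma trip_half_space v u a b : dot v v = 1 -> dot u v = 0 ->
  dot u u * trip v a b = dot u a * dot (cross v u) b - dot (cross v u) a * dot u b.
Proof.
move=> v1 uv; apply/esym.
transitivity (dot u u * trip v a b - dot u v * trip u a b); last by rewrite uv mul0r subr0.
by vec3.
Qed.

Lemma det_rows3 u v w : \det (\matrix_(i < 3) [tuple u; v; w]`_i) = trip w u v.
Proof.
rewrite (expand_det_row _ 0) !big_ord_recl big_ord0 /cofactor.
rewrite !(expand_det_row _ 0) !big_ord_recl !big_ord0 /cofactor !det_mx11 !mxE /=.
rewrite /trip dotE crossE0 crossE1 crossE2.
(* Indexing by natural numbers identifies ordinals that are built in different ways. *)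
have coords x : exists c : nat -> R, forall i : 'I_3, x 0 i = c i.
  by exists (fun k => x 0 (inord k)) => i; rewrite inord_val.
have [cu Eu] := coords u; have [cv Ev] := coords v; have [cw Ew] := coords w.
by rewrite !Eu !Ev !Ew /= /bump /=; ring.
Qed.

End TripleProduct.

(** * Existence and uniqueness of the supporting point of a line *)

Section Supports.
Context {R : realType}.
Variables (S : set 'rV[R]_3).
Hypotheses (hS : closed_surface S) (hconv : quadratically_convex S).
Implicit Types (n p y q x v w z X : 'rV[R]_3) (l : 'rV[R]_3 * 'rV[R]_3).

(* [p] is the point of tangency [p_+] of the line through [x] with direction
   [w]; the point [p_-] is obtained by reversing [w]. *)
Definition supports x w p := S p /\ forall y, S y -> 0 <= trip w (p - x) (y - x).

Lemma avoidsN x w : avoids S x w -> avoids S x (- w).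
Proof.
move=> av y Sy; have -> : cross (- w) (y - x) = - cross w (y - x) by apply: eqrV3; vec3.
by rewrite oppr_eq0 av.
Qed.

Lemma trip_dotB w x p y : trip w (p - x) (y - x) =
  dot (cross w (p - x)) y - dot (cross w (p - x)) p.
Proof. by vec3. Qed.

(** The support inequality says that [p] minimizes the height along [cross w (p - x)], and
    minimizers are strict. *)
Lemma supports_inner_normal x w p : avoids S x w -> supports x w p ->
  inner_normal S p (cross w (p - x)).
Proof.
move=> av [Sp hp]; split; first exact: av.
apply: (minimizer_strict hS hconv); [exact: av|by []|move=> y Sy].
by rewrite -subr_ge0 -trip_dotB hp.
Qed.

Lemma supports_strict x w p y : avoids S x w -> supports x w p ->
  S y -> y <> p -> 0 < trip w (p - x) (y - x).
Proof.
by move=> av hp Sy yp; rewrite trip_dotB subr_gt0; have [_] := supports_inner_normal av hp; apply.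
Qed.

(** For distinct [p] and [q] both strict inequalities would hold, while [trip w] is
    antisymmetric. *)
Lemma supports_unique x w p q : avoids S x w -> supports x w p -> supports x w q -> p = q.
Proof.
move=> av hp hq; apply: contrapT => pq.
have := supports_strict av hp hq.1 (fun e => pq (esym e)).
by have := supports_strict av hq hp.1 pq; rewrite tripC oppr_gt0 ltNge => /negP h /ltW.
Qed.

(** The slope [r] is defined because [S] is in the open half space [dot u (y - x) > 0]; by
    [trip_half_space], [r p <= r y] is the support inequality with its positive denominators
    cleared. *)
Lemma supports_exists x v : dot v v = 1 -> avoids S x v -> exists p, supports x v p.
Proof.
move=> v1 av; have [u uv hu] := line_half_space hS hconv v1 av.
have [S0 cS _ _] := hS.
pose r y : R := dot (cross v u) (y - x) / dot u (y - x).
have cr : {in S, continuous r}.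
  move=> y /set_mem Sy; have cyx := @sub_cst_continuous R x y.
  have c a : {for y, continuous (fun y => dot a (y - x) : R)}.
    have ca : {for y, continuous (fun _ : 'rV[R]_3 => a)} by exact: cst_continuous.
    exact: dot_quadratic_continuous ca cyx.
  apply: (continuousM (c _)); apply: continuousV; last exact: c.
  by rewrite gt_eqF// hu.
have [p /set_mem Sp hp] := compact_EVT_min S0 cS (continuous_in_subspaceT cr).
exists p; split=> // y Sy.
have [s0 Ss0] := S0; have u0 : 0 < dot u u.
  rewrite dot_gt0; apply: contraTneq (hu s0 Ss0) => ->.
  by rewrite dot0l ltxx.
rewrite -(pmulr_rge0 _ u0) (trip_half_space _ _ v1 uv) subr_ge0.
have := hp y (mem_set Sy); rewrite /r.
rewrite ler_pdivrMr ?hu// mulrAC ler_pdivlMr ?hu// => h.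
by rewrite [leRHS]mulrC.
Qed.

Lemma supports_scale x w p (c : R) : 0 < c -> supports x (c *: w) p <-> supports x w p.
Proof.
move=> c0; have E a b : trip (c *: w) a b = c * trip w a b by vec3.
split=> [] [Sp hp]; split=> // y /hp; rewrite E; first by rewrite pmulr_rge0.
by move=> h; rewrite pmulr_rge0.
Qed.

Lemma supports_shift x w p (t : R) : supports (x + t *: w) w p <-> supports x w p.
Proof.
have E y : trip w (p - (x + t *: w)) (y - (x + t *: w)) = trip w (p - x) (y - x) by vec3.
by split=> [] [Sp hp]; split=> // y /hp; rewrite E.
Qed.

Lemma avoids_scale x w (c : R) : c != 0 -> avoids S x (c *: w) <-> avoids S x w.
Proof.
move=> c0; have E a : cross (c *: w) a = c *: cross w a by apply: eqrV3; vec3.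
split=> av y Sy; have := av y Sy; rewrite E scaler_eq0 negb_or; first by case/andP.
by rewrite c0.
Qed.

Lemma avoids_shift x w (t : R) : avoids S (x + t *: w) w <-> avoids S x w.
Proof.
have E y : cross w (y - (x + t *: w)) = cross w (y - x) by apply: eqrV3; vec3.
by split=> av y Sy; have := av y Sy; rewrite E.
Qed.

Lemma normalize_scale w : w != 0 -> exists2 c : R, 0 < c & normalize w = c *: w.
Proof.
by move=> w0; exists (enorm w)^-1 => //; rewrite invr_gt0 sqrtr_gt0 dot_gt0.
Qed.

Lemma avoids_line_of x w : w != 0 ->
  avoids S (line_of (x, w)).1 (line_of (x, w)).2 <-> avoids S x w.
Proof.
move=> w0; rewrite /line_of /=; have [c c0 ->] := normalize_scale w0.
rewrite -scaleNr; split.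
  by move/avoids_shift/avoids_scale; apply; rewrite gt_eqF.
by move=> av; apply/avoids_shift/avoids_scale => //; rewrite gt_eqF.
Qed.

Lemma supports_line_of x w p : w != 0 ->
  supports (line_of (x, w)).1 (line_of (x, w)).2 p <-> supports x w p.
Proof.
move=> w0; rewrite /line_of /=; have [c c0 ->] := normalize_scale w0.
rewrite -scaleNr; split.
  by move/supports_shift/(supports_scale _ _ _ c0).
by move=> h; apply/supports_shift/(supports_scale _ _ _ c0).
Qed.

Lemma supports_exists_direction x w : w != 0 -> avoids S x w -> exists p, supports x w p.
Proof.
move=> w0 av; have /enormK n1 := (olines_line_of (x := (x, w)) w0).1.
have [p /supports_line_of hp] := supports_exists n1 ((avoids_line_of x w0).2 av).
by exists p; exact: hp.
Qed.

Lemma avoidingP l : olines l -> avoiding S l <-> avoids S l.1 l.2.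
Proof.
move=> ol; have /enormK v1 := ol.1; split=> [[_ l0] y Sy|av].
  apply/negP => /eqP c0.
  have : (points l `&` S) y; last by rewrite l0.
  split=> //; exists (dot (y - l.1) l.2) => //.
  have := cross_cross_perp l.2 (y - l.1).
  rewrite c0 cross0r v1 scale1r (dotC l.2) => /esym/subr0_eq ->.
  by rewrite addrC subrK.
split=> //; apply/seteqP; split=> // y [[t _ <-] Sy].
have := av _ Sy; rewrite addrC addKr => /negP[]; apply/eqP.
by apply: eqrV3; vec3.
Qed.

End Supports.

(** * The billiard map as a reflection in the supporting point *)

Section BilliardMap.
Context {R : realType}.
Variables (S : set 'rV[R]_3).
Hypotheses (hS : closed_surface S) (hconv : quadratically_convex S).
Implicit Types (n p y q x v w z X : 'rV[R]_3) (l : 'rV[R]_3 * 'rV[R]_3).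

(** For a unit direction, the vector from the foot of [p] on [l] to [p], that is [d *: W] in
    [tangency]. *)
Definition offset l p := (p - l.1) - dot (p - l.1) l.2 *: l.2.

Lemma offset_perp l p : dot l.2 l.2 = 1 -> dot (offset l p) l.2 = 0.
Proof.
move=> v1; transitivity (dot (p - l.1) l.2 - dot (p - l.1) l.2 * dot l.2 l.2).
  by rewrite /offset; vec3.
by rewrite v1 mulr1 subrr.
Qed.

Lemma cross_offset l p : cross l.2 (offset l p) = cross l.2 (p - l.1).
Proof. by rewrite /offset; apply: eqrV3; vec3. Qed.

Lemma offset_neq0 l p : avoids S l.1 l.2 -> S p -> offset l p != 0.
Proof.
move=> av Sp; apply: contra_neq (av p Sp) => o0.
by rewrite -cross_offset o0 cross0r.
Qed.

Lemma closest_pointP l p q : dot l.2 l.2 = 1 ->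
  closest_point l p q <-> p - q = offset l p.
Proof.
move=> v1; have ov := offset_perp p v1.
have E t : dot (p - (l.1 + t *: l.2)) (p - (l.1 + t *: l.2)) =
    dot (offset l p) (offset l p) + (dot (p - l.1) l.2 - t) ^+ 2.
  transitivity (dot (offset l p) (offset l p) +
     2 * (dot (p - l.1) l.2 - t) * dot (offset l p) l.2 +
     (dot (p - l.1) l.2 - t) ^+ 2 * dot l.2 l.2); last by rewrite ov v1; ring.
  by rewrite /offset; move: (dot (p - l.1) l.2) => s; vec3.
have oE : p - (l.1 + dot (p - l.1) l.2 *: l.2) = offset l p.
  by rewrite /offset opprD addrA.
split.
  move=> [[t _ <-] hq]; have := hq (l.1 + dot (p - l.1) l.2 *: l.2).
  have pt : points l (l.1 + dot (p - l.1) l.2 *: l.2) by exists (dot (p - l.1) l.2).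
  move=> /(_ pt); rewrite /enorm ler_sqrt ?dot_ge0// !E subrr expr0n addr0 gerDl => h.
  have /eqP : (dot (p - l.1) l.2 - t) ^+ 2 = 0 by apply/eqP; rewrite eq_le h sqr_ge0.
  by rewrite sqrf_eq0 subr_eq0 => /eqP <-.
move=> pq; have qE : q = l.1 + dot (p - l.1) l.2 *: l.2.
  by apply: (addrI (- p)); apply: oppr_inj; rewrite !opprD opprK pq -oE opprD.
split; first by exists (dot (p - l.1) l.2).
move=> _ [t _ <-]; rewrite pq /enorm ler_sqrt ?dot_ge0// E lerDl sqr_ge0 //.
Qed.

(** The tangent plane is given by an inner normal, so containing the line amounts to two linear
    conditions on it. *)
Lemma tangencyP l p d W : olines l -> avoids S l.1 l.2 ->
  tangency S l p d W <-> [/\ S p, d = enorm (offset l p), W = d^-1 *: offset l p &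
    exists n, [/\ inner_normal S p n, dot n l.2 = 0 & dot n (p - l.1) = 0]].
Proof.
move=> ol av; have /enormK v1 := ol.1; split.
  move=> [Sp lp [q [/(closest_pointP _ _ v1) pq -> ->]]]; rewrite pq; split => //.
  have [n hn] := exists_inner_normal hS hconv Sp; exists n; split => //.
    have h t : dot n (l.1 + t *: l.2 - p) = 0.
      have : tangent_plane S p (l.1 + t *: l.2) by apply: lp; exists t.
      by move/(tangent_spaceE hS _ Sp hn).
    transitivity (dot n (l.1 + 1 *: l.2 - p) - dot n (l.1 + 0 *: l.2 - p)); first by vec3.
    by rewrite !h subrr.
  have : tangent_plane S p l.1 by apply: lp; exists 0 => //; rewrite scale0r addr0.
  move/(tangent_spaceE hS _ Sp hn) => h.
  by rewrite -opprB dotNr h oppr0.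
move=> [Sp -> -> [n [hn nv np]]]; split => //.
  move=> _ [t _ <-]; apply/(tangent_spaceE hS _ Sp hn).
  transitivity (t * dot n l.2 - dot n (p - l.1)); first by vec3.
  by rewrite nv np mulr0 subrr.
exists (p - offset l p); have pq : p - (p - offset l p) = offset l p by rewrite subKr.
by split; rewrite ?pq//; apply/closest_pointP.
Qed.

Lemma enorm_gt0 X : (0 < enorm X) = (X != 0).
Proof. by rewrite sqrtr_gt0 dot_gt0. Qed.

Lemma trip_offset l p q : trip l.2 (offset l p) (offset l q) = trip l.2 (p - l.1) (q - l.1).
Proof.
by rewrite /offset; move: (dot (p - l.1) l.2) (dot (q - l.1) l.2) => s t; vec3.
Qed.

Lemma orientedP l p q : avoids S l.1 l.2 -> S p -> S q ->
  positively_oriented ((enorm (offset l p))^-1 *: offset l p)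
    ((enorm (offset l q))^-1 *: offset l q) l.2 <->
  0 < trip l.2 (p - l.1) (q - l.1).
Proof.
move=> av Sp Sq; rewrite /positively_oriented det_rows3.
have Z a b u w : trip l.2 (a *: u) (b *: w) = a * (b * trip l.2 u w) by vec3.
by rewrite Z trip_offset !pmulr_rgt0// invr_gt0 enorm_gt0 offset_neq0.
Qed.

Lemma line_of_shift x y v (t : R) : enorm v = 1 -> y = x + t *: v ->
  line_of (x, v) = line_of (y, v).
Proof. by move=> v1 ->; apply/line_of_eq => //; split=> //; exists t. Qed.

Lemma supportsN_neq l p q : avoids S l.1 l.2 -> supports S l.1 l.2 p ->
  supports S l.1 (- l.2) q -> q <> p.
Proof.
move=> av hp [Sq hq] qp; subst q; have [y Sy yp] := other_point hS Sq.
have := supports_strict hS hconv av hp Sy yp; rewrite ltNge => /negP; apply.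
by have := hq y Sy; rewrite tripNl oppr_ge0.
Qed.

Lemma supports_tangency l p : olines l -> avoids S l.1 l.2 ->
  supports S l.1 l.2 p \/ supports S l.1 (- l.2) p ->
  tangency S l p (enorm (offset l p)) ((enorm (offset l p))^-1 *: offset l p).
Proof.
move=> ol av hp; apply/(tangencyP _ _ _ ol av).
have [v [Sp hn vv]] : exists v, [/\ S p, inner_normal S p (cross v (p - l.1)) &
    v = l.2 \/ v = - l.2].
  have [hp'|hp'] := hp.
    by exists l.2; split; [case: hp'|exact: (supports_inner_normal hS hconv av)|left].
  exists (- l.2); split; [by case: hp'| |by right].
  exact: (supports_inner_normal hS hconv (avoidsN av)).
split=> //; exists (cross v (p - l.1)); split=> //; last exact: dot_crossr.
by case: vv => ->; vec3.
Qed.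

(** An inner normal at [p_+] is a multiple of [cross l.2 (pp - l.1)], and the orientation condition
    says that the multiple is positive, so that [p_+] is the supporting point. Conversely [p_-] is
    the supporting point of the reversed line. *)
Lemma is_outer_billiardP l l' p : olines l -> avoids S l.1 l.2 -> supports S l.1 l.2 p ->
  is_outer_billiard S l l' <-> l' = line_of (2 *: p - l.1, l.2).
Proof.
move=> ol av hp; have [v1 _] := ol; have vv := (enormK _).1 v1.
(* Adding twice the offset to [l.1] differs from the point reflection [2 *: p - l.1] by a multiple
   of the direction. *)
have target q d : q = p -> d = enorm (offset l q) ->
    line_of (l.1 + (2 * d) *: (d^-1 *: offset l q), l.2) = line_of (2 *: p - l.1, l.2).
  move=> -> ->; apply: (line_of_shift (t := 2 * dot (p - l.1) l.2)) => //.
  rewrite scalerA mulfK; last by rewrite gt_eqF// enorm_gt0 offset_neq0//; case: hp.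
  by rewrite /offset; apply: eqrV3; rewrite !mxE; ring.
split.
  move=> [pp [dp [Wp [pm [dm [Wm [Tp Tm pos ->]]]]]]].
  move/(tangencyP _ _ _ ol av): Tp => [Spp dpE WpE [n [hn nv np]]].
  move/(tangencyP _ _ _ ol av): Tm => [Spm dmE WmE _].
  move: pos; rewrite WpE WmE dpE dmE => /(orientedP av Spp Spm) pos.
  apply: target => //.
  apply: (supports_unique hS hconv av _ hp); split=> // y Sy.
  pose m := cross l.2 (pp - l.1).
  have m0 : 0 < dot m m by rewrite dot_gt0 av.
  have mE z : trip l.2 (pp - l.1) (z - l.1) = dot m (z - pp) by rewrite /m; vec3.
  have nE z : dot m m * dot n (z - pp) = dot n m * dot m (z - pp).
    by rewrite -dotZl /m (perp_cross_parallel nv np) dotZl.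
  have nz z : S z -> 0 <= dot n (z - pp).
    by move=> Sz; rewrite dotBr subr_ge0; exact: inner_normal_le hn Sz.
  have ppm : pm <> pp by move=> e; move: pos; rewrite e trip_aa ltxx.
  have npm : 0 < dot n (pm - pp) by rewrite dotBr subr_gt0; apply: hn.2.
  (* Both [n] and [m] are positive on [pm - pp], which fixes the sign of the factor between them. *)
  have nm : 0 < dot n m.
    by rewrite -(pmulr_lgt0 _ (_ : 0 < dot m (pm - pp))) -?nE ?mulr_gt0// -mE.
  by rewrite mE -(pmulr_rge0 _ nm) -nE mulr_ge0 ?nz// ltW.
move=> ->; have v0 : - l.2 != 0 by rewrite oppr_eq0 -dot_eq0 vv oner_neq0.
have [q hq] := supports_exists_direction hS hconv v0 (avoidsN av).
exists p, (enorm (offset l p)), ((enorm (offset l p))^-1 *: offset l p).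
exists q, (enorm (offset l q)), ((enorm (offset l q))^-1 *: offset l q); split.
- by apply: supports_tangency => //; left.
- by apply: supports_tangency => //; right.
- apply/orientedP => //; [by case: hp|by case: hq|].
  apply: (supports_strict hS hconv av hp); first by case: hq.
  exact: supportsN_neq hp hq.
- by rewrite (target p).
Qed.

Lemma outer_billiardE l p : olines l -> avoids S l.1 l.2 -> supports S l.1 l.2 p ->
  outer_billiard S l = line_of (2 *: p - l.1, l.2).
Proof.
move=> ol av hp; apply/(is_outer_billiardP _ ol av hp).
by apply: xgetPex; exists (line_of (2 *: p - l.1, l.2)); apply/(is_outer_billiardP _ ol av hp).
Qed.

End BilliardMap.

Lemma is_derive_crossr (R : realType) (w : 'rV[R]_3) (f : R -> 'rV[R]_3) (t : R) df :
  is_derive t 1 f df -> is_derive t 1 (fun s => cross w (f s)) (cross w df).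
Proof.
move=> /is_derive_rV hf; apply/is_derive_rV => i.
rewrite (_ : (fun s => _) = (w 0 (i + 1) \*: (fun s => f s 0 (i + 2) : R)) -
    (w 0 (i + 2) \*: (fun s => f s 0 (i + 1) : R))); last first.
  by apply/funext => s; rewrite mxE.
by apply: is_derive_eq; rewrite mxE.
Qed.

(** * Smooth dependence of the supporting point on the line *)

Section SupportMap.
Context {R : realType}.
Variables (S : set 'rV[R]_3).
Hypotheses (hS : closed_surface S) (hconv : quadratically_convex S).
Local Notation V3 := 'rV[R]_3.
Local Notation E := (V3 * V3)%type.
Implicit Types (n p y v w X : V3) (z l : E).

Definition support_point z : V3 := xget 0 (supports S z.1 z.2).

(** An open set of pairs rather than the submanifold of unit pairs: differentials and [smooth_at]
    live on open sets. *)
Definition avoiding_pairs : set E := [set z | z.2 != 0 /\ avoids S z.1 z.2].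

Lemma support_pointP z : avoiding_pairs z -> supports S z.1 z.2 (support_point z).
Proof.
move=> [z0 av]; apply: xgetPex.
exact: (supports_exists_direction hS hconv z0 av).
Qed.

Lemma support_pointE z p : avoiding_pairs z -> supports S z.1 z.2 p -> support_point z = p.
Proof.
move=> Az hp; apply: (supports_unique hS hconv Az.2 _ hp); exact: support_pointP.
Qed.

Section PairCalculus.
Context {V : normedModType R}.
Implicit Types (k : nat) (D : set (E * V)).

Lemma Ck_position k D : open D -> Ck k D (fun q : E * V => q.1.1).
Proof.
move=> oD; apply: (@Ck_linear R _ _ _ k D fst fst) => //; last exact: Ck_fst.
by move=> x; exact: cvg_fst.
Qed.

Lemma Ck_direction k D : open D -> Ck k D (fun q : E * V => q.1.2).
Proof.
move=> oD; apply: (@Ck_linear R _ _ _ k D fst snd) => //; last exact: Ck_fst.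
by move=> x; exact: cvg_snd.
Qed.

Lemma Ck_comp_snd (W : normedModType R) k (D : set V) (f : V -> W) : open D ->
  Ck k D f -> Ck k [set q : E * V | D q.2] (fun q : E * V => f q.2).
Proof.
move=> oD Cf; have cs : continuous (snd : E * V -> V) by move=> t; exact: cvg_snd.
have := @Ck_comp_affine R (E * V)%type V W k D f snd 0 oD cs Cf.
rewrite (_ : [set x | _] = [set q : E * V | D q.2]); last first.
  by apply/seteqP; split=> q /=; rewrite add0r.
by rewrite (_ : (fun x => _) = (fun q : E * V => f q.2)) //; apply/funext => q; rewrite add0r.
Qed.

End PairCalculus.

Lemma support_trip_continuous y (q : E * V3) :
  {for q, continuous (fun q : E * V3 => trip q.1.2 (q.2 - q.1.1) (y - q.1.1) : R)}.
Proof.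
have oT : open [set: E * V3] by exact: openT.
have Cp : Ck 0 setT (fun q : E * V3 => q.1.1) by exact: (@Ck_position V3).
have Cd : Ck 0 setT (fun q : E * V3 => q.1.2) by exact: (@Ck_direction V3).
have Cs : Ck 0 setT (fun q : E * V3 => q.2) by exact: (@Ck_snd R E V3).
have Cy : Ck 0 setT (cst y : E * V3 -> V3) by exact: Ck_cst.
have C := Ck_trip oT Cd (CkB oT Cs Cp) (CkB oT Cy Cp).
exact: (C q I).
Qed.

Lemma open_avoiding_pairs : open avoiding_pairs.
Proof.
have [_ cS _ _] := hS.
rewrite (_ : avoiding_pairs = [set z | z.2 != 0] `&`
   ~` [set z : E | exists2 y, S y & cross z.2 (y - z.1) = 0]).
  apply: openI; first exact: open_snd_neq0.
  apply: closed_openC; apply: compact_projection_closed => // z y Sy /eqP nz.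
  have oT : open [set: E * V3] by exact: openT.
  have Cp : Ck 0 setT (fun q : E * V3 => q.1.1) by exact: (@Ck_position V3).
  have Cd : Ck 0 setT (fun q : E * V3 => q.1.2) by exact: (@Ck_direction V3).
  have Cs : Ck 0 setT (fun q : E * V3 => q.2) by exact: (@Ck_snd R E V3).
  have Cc := Ck_cross oT Cd (CkB oT Cs Cp).
  have c := CkB oT (Ck_cst 0 setT (0 : R)) (Ck_dot oT Cc Cc).
  have c' : {for (z, y), continuous (fun q : E * V3 =>
      0 - dot (cross q.1.2 (q.2 - q.1.1)) (cross q.1.2 (q.2 - q.1.1)) : R)} := c (z, y) I.
  have := near_pair_neg c'; rewrite /= sub0r oppr_lt0 dot_gt0 => /(_ nz).
  by apply: filterS => -[y' z'] /=; rewrite sub0r oppr_lt0 dot_gt0 => /eqP.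
apply/seteqP; split=> z [z0 h]; split=> //.
  by move=> [y Sy /eqP]; apply/negP; exact: h.
by move=> y Sy; apply/eqP => c0; apply: h; exists y.
Qed.

(** By compactness, the lines with a supporting point outside a neighborhood of [support_point z]
    form a closed set; by uniqueness it does not contain [z]. *)
Lemma support_point_continuous z : avoiding_pairs z -> {for z, continuous support_point}.
Proof.
have [_ cS _ _] := hS.
move=> Az B; rewrite nbhsE => -[Om [oO Oz] OB].
have cK : compact (S `&` ~` Om) by apply: compact_closedI => //; exact: open_closedC.
have cl : closed [set z | exists2 p, (S `&` ~` Om) p &
    forall y, S y -> 0 <= trip z.2 (p - z.1) (y - z.1)].
  apply: compact_projection_closed => // z' p [Sp _] /existsNP[y /not_implyP[Sy /negP]].
  rewrite -ltNge => h.
  have := near_pair_neg (@support_trip_continuous y (z', p)) h.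
  by apply: filterS => -[p' z2] /= h' /(_ y Sy); rewrite leNgt h'.
have nA : nbhs z avoiding_pairs by apply: open_nbhs_nbhs; split=> //; exact: open_avoiding_pairs.
have nz : (~` [set z | exists2 p, (S `&` ~` Om) p &
    forall y, S y -> 0 <= trip z.2 (p - z.1) (y - z.1)]) z.
  by move=> [p [Sp nOp] hp]; apply: nOp; rewrite -(support_pointE Az (conj Sp hp)).
have nC := open_nbhs_nbhs (conj (closed_openC cl) nz).
apply: filterS2 nA nC => z' Az' nz'; apply: OB; apply: contrapT => nO; apply: nz'.
by have [Sp hp] := support_pointP Az'; exists (support_point z').
Qed.

(** Three vectors of the plane orthogonal to [n] are dependent; the identity is Cramer's rule paired
    with [n]. *)
Lemma trip_perp n a b w : n != 0 -> dot n a = 0 -> dot n b = 0 -> dot n w = 0 ->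
  trip w a b = 0.
Proof.
move=> n0 na nb nw.
have nn : dot n n != 0 by rewrite dot_eq0.
apply/eqP; rewrite -(mulrI_eq0 _ (mulfI nn)); apply/eqP.
transitivity (dot n w * trip n a b + dot n a * trip n b w + dot n b * trip n w a).
  by vec3.
by rewrite na nb nw !mul0r !addr0.
Qed.

(** In a chart, the plane through the line and [phi u] is tangent at [phi u] when the gradient of
    the height along [cross w (phi u - x)] vanishes: two equations [F] for two unknowns. *)
Lemma support_point_smooth z0 : avoiding_pairs z0 -> smooth_at support_point z0.
Proof.
move=> Az0; have [_ _ _ charts] := hS.
have [Sp0 _] := support_pointP Az0.
have [D [phi [chart [u0 Du0 pE]]]] := charts _ Sp0.
have [oD Cphi _ [Om oO SO] [psi cpsi phiK]] := chart.
pose W : set E := avoiding_pairs `&` support_point @^-1` Om.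
have oW : open W.
  rewrite openE => z [Az Oz]; apply: filterI.
    by apply: open_nbhs_nbhs; split=> //; exact: open_avoiding_pairs.
  by apply: support_point_continuous => //; apply: open_nbhs_nbhs.
have Wz0 : W z0.
  split=> //; have : (S `&` Om) (support_point z0) by rewrite -SO -pE; exists u0.
  by case.
pose U z := psi (support_point z).
have WU z : W z -> D (U z) /\ phi (U z) = support_point z.
  move=> [Az Oz]; have [Sp _] := support_pointP Az.
  have [u Du uE] : (phi @` D) (support_point z) by rewrite SO.
  by rewrite /U -uE phiK ?inE.
have cU z : W z -> {for z, continuous U}.
  move=> Wz B nB; have [Az Oz] := Wz; have [Du uE] := WU z Wz.
  have nN : nbhs (support_point z) [set q | (phi @` D) q -> B (psi q)].
    apply: (iffLR (subspace_continuousP _ _) cpsi _ _ _ nB).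
    by exists (U z).
  have nP : \forall z' \near z, (phi @` D) (support_point z') -> B (psi (support_point z')) :=
    support_point_continuous Az nN.
  have nW : \forall z' \near z, W z' by exact: open_nbhs_nbhs.
  have : \forall z' \near z, B (U z'); last by [].
  move: nP nW; apply: filterS2 => z' hz' Wz'.
  by apply: hz'; have [Du' uE'] := WU z' Wz'; exists (U z').
pose Dom : set (E * 'rV[R]_2) := [set q : E * 'rV[R]_2 | D q.2].
have oDom : open Dom by apply: open_comp => // q _; exact: cvg_snd.
pose F (q : E * 'rV[R]_2) : 'rV[R]_2 :=
  gradient phi (cross q.1.2 (phi q.2 - q.1.1)) q.2.
pose dphi (i : 'I_2) (u : 'rV[R]_2) : V3 := 'd phi u (delta_mx 0 i).
have CF : smooth_on Dom F.
  move=> k; apply: Ck_row => // i.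
  rewrite (_ : (fun x => _) = fun q : E * 'rV[R]_2 =>
    trip q.1.2 (phi q.2 - q.1.1) (dphi i q.2)); last first.
    by apply/funext => q; rewrite mxE.
  apply: Ck_trip => //; first exact: Ck_direction.
    apply: CkB => //; last exact: Ck_position.
    exact: (Ck_comp_snd oD (Cphi k)).
  exact: (Ck_comp_snd oD (Ck_partial chart k (delta_mx 0 i))).
have normal z (n := cross z.2 (support_point z - z.1)) : W z ->
    [/\ n != 0, dot n z.2 = 0 & forall h, dot n ('d phi (U z) h) = 0].
  move=> Wz; have [Az Oz] := Wz; have [Du uE] := WU z Wz.
  have hp := support_pointP Az.
  have hn := supports_inner_normal hS hconv Az.2 hp.
  split; [by case: hn|exact: dot_crossl|].
  apply: (min_critical chart Du) => y Sy; rewrite uE; exact: (inner_normal_le hn).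
have SU : smooth_on W U.
  apply: (implicit_smooth (Om := Dom) (F := F)) => //.
  - by move=> z Wz; have [] := WU z Wz.
  - move=> z Wz; have [n0 nz nd] := normal z Wz; have [Du uE] := WU z Wz.
    by apply/rowP => i; rewrite !mxE /= uE; exact: nd.
  move=> z h Wz; have [n0 nz nd] := normal z Wz; have [Du uE] := WU z Wz.
  set n := cross z.2 _ in n0 nz nd.
  (* The normal moves with [u] too, but this contributes a triple product of the direction of the
     line and two tangent vectors, all in the tangent plane. The derivative at fixed normal
     remains. *)
  have key i : 'd F (z, U z) (0, h) 0 i = 'd (gradient phi n) (U z) h 0 i.
    have qE s : (z, U z) + s *: (0, h) = (z, U z + s *: h) :> E * 'rV[R]_2.
      by congr pair; rewrite /= scaler0 addr0.
    have dP : differentiable phi (U z) by exact: (chart_diff chart).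
    have dPi : differentiable (dphi i) (U z).
      by have [+ _] := Ck_partial chart 1 (delta_mx 0 i); apply.
    have dF : differentiable F (z, U z) by have [+ _] := CF 1%N; apply.
    have [dc ec] := diff_coordinate i dF.
    have [_ e1] := is_derive_line0 (0, h) dc.
    have E1 := etrans e1 (congr1 (@^~ (0, h)) ec).
    have d2 := is_deriveB (is_derive_line0 h dP) (is_derive_cst z.1 (0 : R) 1).
    rewrite subr0 in d2.
    have [_ e2] := is_derive_dot (is_derive_crossr z.2 d2) (is_derive_line0 h dPi).
    apply: (etrans (esym E1)); apply: etrans (esym (gradient_derivative chart n h i Du)).
    have -> : (fun s : R => F ((z, U z) + s *: (0, h)) 0 i) =
        fun s : R => dot (cross z.2 (phi (U z + s *: h) - z.1)) (dphi i (U z + s *: h)).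
      by apply/funext => s; rewrite qE mxE.
    apply: (etrans e2); rewrite -[dot (cross _ ('d phi _ _)) _]/(trip _ _ _).
    rewrite (trip_perp n0 (nd h) _ nz) ?add0r; last by rewrite scale0r addr0; exact: nd.
    have cE : cross z.2 (phi (U z + (0 : R) *: h) - z.1) = n by rewrite scale0r addr0 uE.
    exact: (congr1 (fun m => dot m ('d (dphi i) (U z) h)) cE).
  move=> Fh; apply/eqP; apply: contraT => hn0; exfalso.
  have h0 : hessian_form phi n (U z) h = 0.
    by rewrite /hessian_form big1// => i _; rewrite -key Fh mxE mulr0.
  have [def|def] := hessian_definite chart Du n0 (hconv chart Du) nd.
    by have := def h hn0; rewrite h0 ltxx.
  by have := def h hn0; rewrite (hessian_formN chart)// h0 oppr0 ltxx.
exists W; split=> // k.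
apply: (Ck_ext oW (f := phi \o U)); first by move=> z /set_mem/WU[].
apply: Ck_row => // i.
apply: (Ck_comp_row (g := fun u => phi u 0 i) oW oD) => //.
  by move=> z /WU[].
by apply: Ck_coordinate.
Qed.

End SupportMap.

(** * The billiard map *)

Section SmoothAt.
Context {R : realType}.
Implicit Types (V W Z : normedModType R).

Lemma smooth_at_linear V W Z (L : {linear W -> Z}) (f : V -> W) x : continuous L ->
  smooth_at f x -> smooth_at (L \o f) x.
Proof.
move=> cL [D [oD Dx Cf]]; exists D; split=> // k; exact: Ck_linear.
Qed.

Lemma smooth_at_affine_comp V W Z (L : {linear V -> W}) (c : W) (f : W -> Z) x :
  continuous L -> smooth_at f (c + L x) -> smooth_at (fun y => f (c + L y)) x.
Proof.
move=> cL [D [oD Dx Cf]]; exists [set y | D (c + L y)]; split=> //.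
  apply: open_comp => // y _; apply: continuousD; [exact: cst_continuous|exact: cL].
by move=> k; exact: Ck_comp_affine.
Qed.

Lemma smooth_at_near V W (D : set V) (f g : V -> W) x : open D -> D x ->
  {in D, f =1 g} -> smooth_at f x -> smooth_at g x.
Proof.
move=> oD Dx fg [D' [oD' Dx' Cf]]; exists (D `&` D'); split=> //; first exact: openI.
move=> k; apply: (Ck_ext (f := f)); first exact: openI.
  by move=> y /set_mem[Dy _]; apply: fg; exact: mem_set.
by apply: Ck_sub (Cf k) => y [].
Qed.

Lemma smooth_at_diff V W (f : V -> W) x : smooth_at f x -> differentiable f x.
Proof. by move=> [D [_ Dx /(_ 1%N)[df _]]]; exact: df. Qed.

End SmoothAt.

(** * Reversing the orientation of lines *)

Section Reversal.
Context {R : realType}.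
Local Notation V3 := 'rV[R]_3.
Local Notation E := (V3 * V3)%type.
Implicit Types (x y v w : V3) (z l : E).

Definition reverse z : E := (z.1, - z.2).

Lemma reverse_is_linear : linear reverse.
Proof. by move=> a z z'; congr pair; rewrite /= scalerN opprD. Qed.

HB.instance Definition _ :=
  GRing.isLinear.Build R E E *:%R reverse reverse_is_linear.

Lemma reverse_continuous : continuous reverse.
Proof.
move=> z; apply: cvg_to_pair; first exact: cvg_fst.
by apply: (continuous_comp (f := snd)); [exact: cvg_snd|exact: opp_continuous].
Qed.

Lemma reverseK z : reverse (reverse z) = z.
Proof. by case: z => x v; rewrite /reverse /= opprK. Qed.

Lemma normalizeN w : normalize (- w) = - normalize w.
Proof. by rewrite /normalize /enorm dotNl dotNr opprK scalerN. Qed.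

Lemma line_of_reverse z : line_of (reverse z) = reverse (line_of z).
Proof.
case: z => x w; rewrite /line_of /reverse /= normalizeN; congr pair.
by rewrite dotNr scaleNr scalerN opprK.
Qed.

Lemma olines_reverse l : olines l -> olines (reverse l).
Proof.
by move=> [l1 l2]; split; [rewrite /enorm dotNl dotNr opprK|rewrite dotNr l2 oppr0].
Qed.

Definition first_component (x : V3) : E := (x, 0).

Lemma first_component_is_linear : linear first_component.
Proof. by move=> a z z'; congr pair; rewrite /= scaler0 addr0. Qed.

HB.instance Definition _ :=
  GRing.isLinear.Build R V3 E *:%R first_component first_component_is_linear.

Lemma first_component_continuous : continuous first_component.
Proof. exact: row_linear_continuous. Qed.

End Reversal.

(** * The billiard map as a diffeomorphism, with its inverse *)

Section BilliardDynamics.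
Context {R : realType}.
Variables (S : set 'rV[R]_3).
Hypotheses (hS : closed_surface S) (hconv : quadratically_convex S).
Local Notation V3 := 'rV[R]_3.
Local Notation E := (V3 * V3)%type.
Implicit Types (n p y v w X : V3) (z l : E).
Local Notation B := (outer_billiard S).

Lemma line_neq0 l : olines l -> l.2 != 0.
Proof. by move=> [/enormK v1 _]; rewrite -dot_eq0 v1 oner_neq0. Qed.

Lemma avoiding_avoiding_pairs l : avoiding S l -> avoiding_pairs S l.
Proof.
by move=> al; have [ol _] := al; split; [exact: line_neq0|exact/avoidingP].
Qed.

Lemma avoiding_line_of z : avoiding_pairs S z -> avoiding S (line_of z).
Proof.
case: z => x w [/= w0 av]; apply/avoidingP; first exact: olines_line_of.
exact/(avoids_line_of _ _ w0).
Qed.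

Lemma avoiding_reverse l : avoiding S l -> avoiding S (reverse l).
Proof.
move=> al; have [ol _] := al; apply/avoidingP; first exact: olines_reverse.
by apply: avoidsN; exact/avoidingP.
Qed.

(** The reflected line lies in the same plane, which meets [S] only at [p], and does not contain
    [p]. Seen from it, [p] supports the opposite direction. *)
Lemma supports_step x w p : avoids S x w -> supports S x w p ->
  avoids S (2 *: p - x) w /\ supports S (2 *: p - x) (- w) p.
Proof.
move=> av hp; have [Sp hp'] := hp; split; last first.
  split=> // y /hp'; rewrite (_ : trip (- w) _ _ = trip w (p - x) (y - x) -
    2 * trip w (p - x) (p - x)) ?trip_aa ?mulr0 ?subr0//.
  by vec3.
move=> y Sy; apply/eqP => c0.
have tE : trip w (p - x) (y - x) = - dot (cross w (y - (2 *: p - x))) (p - x).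
  by vec3.
have yp : y = p.
  apply: contrapT => yp; have := supports_strict hS hconv av hp Sy yp.
  by rewrite tE c0 dot0l oppr0 ltxx.
subst y; move: (av p Sp) => /negP; apply; apply/eqP.
have -> : cross w (p - x) = - cross w (p - (2 *: p - x)) by apply: eqrV3; vec3.
by rewrite c0 oppr0.
Qed.

Lemma line_of_line_of y z (t : R) : z.2 != 0 ->
  line_of (y + t *: (line_of z).2, (line_of z).2) = line_of (y, z.2).
Proof.
move=> z0; have [n1 _] := olines_line_of z0.
have -> : line_of (y, z.2) = line_of (y, (line_of z).2).
  by rewrite /line_of /= [in RHS]normalize1.
by apply/esym/line_of_eq => //; split=> //; exists t.
Qed.

(** Valid for any base point and any nonzero direction, hence the form in which the billiard map is
    differentiated. *)
Lemma outer_billiard_line_of z : avoiding_pairs S z ->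
  B (line_of z) = line_of (2 *: support_point S z - z.1, z.2).
Proof.
move=> Az; have [z0 av] := Az; have hp := support_pointP hS hconv Az.
have al := avoiding_line_of Az; have [ol _] := al.
rewrite (outer_billiardE hS hconv (p := support_point S z) ol); last 2 first.
- exact/avoidingP.
- by case: z z0 hp {Az av al ol} => x w z0 hp; apply/supports_line_of.
rewrite -(line_of_line_of _ (dot z.1 (line_of z).2) z0); congr (line_of (_, _)).
by rewrite /line_of /= opprB addrA addrAC.
Qed.

Lemma outer_billiard_line l : avoiding S l ->
  B l = line_of (2 *: support_point S l - l.1, l.2).
Proof.
move=> al; rewrite -outer_billiard_line_of; last exact: avoiding_avoiding_pairs.
by rewrite line_of_id//; case: al.
Qed.

Lemma outer_billiard_direction l : avoiding S l -> (B l).2 = l.2.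
Proof.
move=> al; rewrite outer_billiard_line//= normalize1//.
by case: al => -[].
Qed.

Lemma outer_billiard_avoiding l : avoiding S l -> avoiding S (B l).
Proof.
move=> al; rewrite outer_billiard_line//; apply: avoiding_line_of.
have [l0 av] := avoiding_avoiding_pairs al; split=> //=.
by have [] := supports_step av (support_pointP hS hconv (avoiding_avoiding_pairs al)).
Qed.

(** The reflection in [p_-], inverse to the billiard map. *)
Definition reverse_billiard l : E := reverse (B (reverse l)).

Lemma reverse_billiard_avoiding l : avoiding S l -> avoiding S (reverse_billiard l).
Proof.
by move=> al; apply/avoiding_reverse/outer_billiard_avoiding/avoiding_reverse.
Qed.

Lemma reverse_billiard_direction l : avoiding S l -> (reverse_billiard l).2 = l.2.
Proof.
move=> al; rewrite /= outer_billiard_direction; last exact: avoiding_reverse.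
by rewrite /= opprK.
Qed.

Lemma outer_billiardK l : avoiding S l -> reverse_billiard (B l) = l.
Proof.
move=> al; have Al := avoiding_avoiding_pairs al.
have hp := support_pointP hS hconv Al.
set p := support_point S l in hp.
have [av' hp'] := supports_step Al.2 hp.
rewrite /reverse_billiard (outer_billiard_line al) -/p -line_of_reverse.
have A' : avoiding_pairs S (reverse (2 *: p - l.1, l.2)).
  split=> /=; first by rewrite oppr_eq0; case: Al.
  exact: avoidsN.
rewrite outer_billiard_line_of//= (support_pointE hS hconv A' hp').
rewrite subKr -line_of_reverse /reverse /= opprK -[(_, _)]surjective_pairing.
by rewrite line_of_id//; case: al.
Qed.

Lemma reverse_billiardK l : avoiding S l -> B (reverse_billiard l) = l.
Proof.
move=> al; have := outer_billiardK (avoiding_reverse al).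
by rewrite /reverse_billiard => /(congr1 reverse); rewrite !reverseK.
Qed.

Lemma outer_billiard_smooth z : avoiding_pairs S z -> smooth_at (B \o line_of) z.
Proof.
move=> Az; have [D [oD Dz Cp]] := support_point_smooth hS hconv Az.
have oA := open_avoiding_pairs hS.
have oDA : open (D `&` avoiding_pairs S) by exact: openI.
exists (D `&` avoiding_pairs S); split=> // k.
apply: (Ck_ext oDA (f := fun z => line_of (2 *: support_point S z - z.1, z.2))).
  by move=> z' /set_mem[_ Az'] /=; rewrite outer_billiard_line_of.
apply: Ck_line_of => //; first by move=> z' [_ []].
  apply: CkB => //; last exact: Ck_fst.
  apply: (@Ck_scale R E k 3 _ (cst 2)) => //; first exact: Ck_cst.
  by apply: Ck_sub (Cp k) => z' [].
exact: Ck_snd.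
Qed.

Lemma reverse_billiard_smooth l : avoiding S l -> smooth_at (reverse_billiard \o line_of) l.
Proof.
move=> al; have Ar := avoiding_avoiding_pairs (avoiding_reverse al).
have s1 := outer_billiard_smooth Ar; rewrite -[reverse l]add0r in s1.
have s2 := smooth_at_linear (@reverse_continuous R)
   (smooth_at_affine_comp (@reverse_continuous R) s1).
apply: (smooth_at_near openT) s2 => // z _ /=.
by rewrite /reverse_billiard add0r line_of_reverse.
Qed.

Lemma smooth_leaf_smooth v (A : set E) (f : E -> E) : (forall l, A l -> l.2 = v) ->
  (forall l, A l -> smooth_at (f \o line_of) l) -> leaf_smooth v A f.
Proof.
move=> Av sf l Al; have vl := Av l Al.
have E1 x : (0, v) + first_component x = (x, v) :> E.
  by congr pair; rewrite /= ?add0r ?addr0.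
have := sf l Al; rewrite [l]surjective_pairing vl /= -E1.
move=> /(smooth_at_affine_comp (@first_component_continuous R)).
by apply: (smooth_at_near openT) => // x _ /=; rewrite E1.
Qed.

End BilliardDynamics.

(** * The differential of the billiard map along a leaf *)

Section LeafDerivative.
Context {R : realType}.
Variables (S : set 'rV[R]_3).
Hypotheses (hS : closed_surface S) (hconv : quadratically_convex S).
Local Notation V3 := 'rV[R]_3.
Local Notation E := (V3 * V3)%type.
Implicit Types (n p y v w X : V3) (z l : E).
Local Notation B := (outer_billiard S).
Local Notation P := (support_point S).

Lemma enorm_normalize w : w != 0 -> enorm (normalize w) = 1.
Proof. by move=> w0; have [] := @olines_line_of R (0, w) w0. Qed.

Lemma unit_frame v a X : dot v v = 1 -> dot a a = 1 -> dot a v = 0 ->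
  X = dot X a *: a + dot X (cross v a) *: cross v a + dot X v *: v.
Proof.
move=> v1 a1 av.
have c1 : cross (cross v a) v = a.
  transitivity (dot v v *: a - dot a v *: v); first by apply: eqrV3; vec3.
  by rewrite v1 av scale1r scale0r subr0.
have c2 : cross a (cross v a) = v.
  transitivity (dot a a *: v - dot a v *: a); first by apply: eqrV3; vec3.
  by rewrite a1 av scale1r scale0r subr0.
have nn : dot (cross v a) (cross v a) = 1 by rewrite dot_cross_unit// a1 av expr0n subr0.
have := cross_frame v a X; rewrite /= nn scale1r c1 c2 => {1}->.
by rewrite [X in X + _]addrC addrAC.
Qed.

Lemma first_component_line (l : E) X (s : R) : l + s *: (X, 0) = (l.1 + s *: X, l.2).
Proof. by case: l => x v; congr pair; rewrite /= scaler0 addr0. Qed.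

Lemma near_first_component (l : E) X (A : set E) : open A -> A l ->
  \forall s \near (0 : R), A (l.1 + s *: X, l.2).
Proof.
move=> oA Al.
have : \forall s \near (0 : R), A (l + s *: (X, 0)).
  apply: (@line_continuous R _ l (X, 0) 0); rewrite scale0r addr0.
  exact: open_nbhs_nbhs.
by apply: filterS => s; rewrite first_component_line.
Qed.

Lemma support_point_diff l : avoiding_pairs S l -> differentiable P l.
Proof. by move=> Al; apply: smooth_at_diff; exact: support_point_smooth. Qed.

(* [P] takes its values in [S], which lies on one side of the tangent plane. *)
Lemma support_point_derive_tangent l X : avoiding_pairs S l ->
  dot (cross l.2 (P l - l.1)) ('d P l (X, 0)) = 0.
Proof.
move=> Al; have hp := support_pointP hS hconv Al.
have hn := supports_inner_normal hS hconv Al.2 hp; set n := cross l.2 _ in hn *.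
have nA := near_first_component X (open_avoiding_pairs hS) Al.
have d s : avoiding_pairs S (l.1 + s *: X, l.2) ->
    is_derive s 1 (fun s : R => dot n (P (l + s *: (X, 0))) : R)
    (dot n ('d P (l + s *: (X, 0)) (X, 0))).
  rewrite -first_component_line => /support_point_diff dP.
  by have := is_derive_dot (is_derive_cst n (s : R) 1) (is_derive_line dP); rewrite dot0l add0r.
have dP := support_point_diff Al.
have d0 := is_derive_dot (is_derive_cst n (0 : R) 1) (is_derive_line0 (X, 0) dP).
rewrite dot0l add0r in d0.
apply: (derive_local_min_eq0 d0); last by apply: filterS nA => s /d[].
apply: filterS nA => s As; rewrite scale0r addr0 first_component_line.
by apply: (inner_normal_le hn); have [] := support_pointP hS hconv As.
Qed.

Lemma support_point_derive_offset l : avoiding S l ->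
  'd P l (offset l (P l), 0) = 0.
Proof.
move=> al; have Al := avoiding_avoiding_pairs al.
set tau := offset l (P l); have hp := support_pointP hS hconv Al.
have dP := support_point_diff Al.
have nA := near_first_component tau (open_avoiding_pairs hS) Al.
have [_ <-] := is_derive_line0 (tau, 0) dP.
rewrite (@near_eq_derive R _ _ _ (cst (P l))) ?derive_cst//.
(* At [s = 1] the moved line reaches the point of tangency; before that, the support inequality is
   only multiplied by [1 - s > 0]. *)
have n1 : \forall s \near (0 : R), s < 1 by exact: lt_nbhsl.
apply: filterS2 nA n1 => s As s1; rewrite first_component_line.
apply: (support_pointE hS hconv As); split=> /=; first by case: hp.
move=> y Sy; have := hp.2 y Sy.
have -> : trip l.2 (P l - (l.1 + s *: tau)) (y - (l.1 + s *: tau)) =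
    (1 - s) * trip l.2 (P l - l.1) (y - l.1).
  rewrite /tau /offset; move: (dot (P l - l.1) l.2) => c; move: (P l) => p.
  by vec3.
by move=> h; rewrite mulr_ge0// subr_ge0 ltW.
Qed.

Lemma outer_billiard_derive l X : avoiding S l -> dot X l.2 = 0 ->
  let q := 'd P l (X, 0) in
  'd (B \o line_of) l (X, 0) = (2 *: (q - dot q l.2 *: l.2) - X, 0).
Proof.
move=> al Xv q; have Al := avoiding_avoiding_pairs al.
have [[v1 _] _] := al.
have dB := smooth_at_diff (outer_billiard_smooth hS hconv Al).
have [_ <-] := is_derive_line0 (X, 0) dB.
have nA := near_first_component X (open_avoiding_pairs hS) Al.
have dP := is_derive_line0 (X, 0) (support_point_diff Al).
have dY := is_deriveB (is_deriveZ 2 dP) (is_derive_affine l.1 X (0 : R)).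
rewrite -/q in dY.
pose Y (s : R) := 2 *: P (l + s *: (X, 0)) - (l.1 + s *: X).
have {}dY : is_derive (0 : R) 1 Y (2 *: q - X) := dY.
have dd := is_derive_dot dY (is_derive_cst l.2 (0 : R) 1).
rewrite dot0r addr0 in dd.
have dZ : is_derive (0 : R) 1 (fun s => dot (Y s) l.2 *: l.2) (dot (2 *: q - X) l.2 *: l.2).
  apply/is_derive_rV => i.
  rewrite (_ : (fun s => _) = l.2 0 i \*: (fun s => dot (Y s) l.2 : R)); last first.
    by apply/funext => s; rewrite mxE mulrC.
  by have := is_deriveZ (l.2 0 i) dd => /is_derive_eq; apply; rewrite mxE mulrC.
have dpair := is_derive_pair (is_deriveB dY dZ) (is_derive_cst l.2 (0 : R) 1).
have [_ e] := dpair.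
rewrite (@near_eq_derive R _ _ _ (fun s => (Y s - dot (Y s) l.2 *: l.2, l.2))).
  rewrite e; congr pair; rewrite dotDl dotNl Xv oppr0 addr0 dotZl.
  by rewrite scalerBr scalerA addrAC.
apply: filterS nA => s As; rewrite /= first_component_line.
rewrite (outer_billiard_line_of hS hconv As) /Y first_component_line.
by rewrite /line_of /= normalize1.
Qed.

(* On the tangent plane of the leaf, with oriented orthonormal basis
   [(a, cross l.2 a)], the differential is [[-1, 2 k], [0, -1]], of determinant 1. *)
Lemma outer_billiard_leaf_frame l : avoiding S l -> exists a k,
  [/\ enorm a = 1, dot a l.2 = 0,
      'd (B \o line_of) l (a, 0) = - (a, 0)
    & 'd (B \o line_of) l (cross l.2 a, 0) = (2 * k) *: (a, 0) - (cross l.2 a, 0)].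
Proof.
move=> al; have Al := avoiding_avoiding_pairs al; have [[/enormK v1 _] _] := al.
have [Sp _] := support_pointP hS hconv Al.
set tau := offset l (P l).
have t0 : tau != 0 by exact: offset_neq0 Al.2 Sp.
pose a := normalize tau; pose n := cross l.2 a.
have a1 : enorm a = 1 by exact: enorm_normalize.
have av : dot a l.2 = 0 by rewrite /a /normalize dotZl offset_perp// mulr0.
have nv : dot n l.2 = 0 by rewrite dotC; vec3.
have aa := (enormK _).1 a1.
exists a, (dot ('d P l (n, 0)) a); split=> //.
  rewrite outer_billiard_derive//.
  have -> : 'd P l (a, 0) = 0.
    have -> : (a, 0) = (enorm tau)^-1 *: (tau, 0) :> E.
      by congr pair; rewrite /= scaler0.
    by rewrite linearZ /= support_point_derive_offset// scaler0.
  by congr pair; rewrite /= ?oppr0// dot0l scale0r subrr scaler0 sub0r.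
rewrite outer_billiard_derive// -/n; set q := 'd P l (n, 0).
(* The velocity of the supporting point stays in the tangent plane, spanned by [l.2] and [a]; modulo
   [l.2] only its component along [a] remains. *)
have qn : dot q n = 0.
  have := support_point_derive_tangent n Al; rewrite -/q -cross_offset -/tau.
  have -> : cross l.2 tau = enorm tau *: n.
    rewrite /n /a /normalize.
    have -> : cross l.2 ((enorm tau)^-1 *: tau) = (enorm tau)^-1 *: cross l.2 tau.
      by apply: eqrV3; vec3.
    by rewrite scalerA divff ?scale1r// gt_eqF// enorm_gt0.
  rewrite dotZl => /eqP; rewrite mulf_eq0 gt_eqF ?enorm_gt0//= dotC => /eqP //.
have qE : q - dot q l.2 *: l.2 = dot q a *: a.
  rewrite {1}(unit_frame q v1 aa av) -/n qn scale0r addr0 addrK //.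
by congr pair; rewrite /= ?scaler0 ?subr0 ?oppr0 ?addr0// qE scalerA.
Qed.

End LeafDerivative.

(** * Poisson geometry *)

Section PoissonFrames.
Context {R : realType}.
Local Notation V3 := 'rV[R]_3.
Local Notation E := (V3 * V3)%type.
Implicit Types (n u v w a b : V3) (l A N X Y : E) (al be : @covector R).

Definition dual_form (Z Y : E) : R^o := dot Z.1 Y.1 + dot Z.2 Y.2.

Lemma dual_form_is_linear Z : linear (dual_form Z).
Proof. by move=> r Y Y'; rewrite /dual_form !dotDr !dotZr scalerDr -addrACA. Qed.

HB.instance Definition _ Z :=
  GRing.isLinear.Build R E R^o *:%R (dual_form Z) (dual_form_is_linear Z).

Lemma covector_separates X Y : (forall al, al X = al Y) -> X = Y.
Proof.
case: X Y => x1 x2 [y1 y2] h.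
have H : dot (x1 - y1) x1 + dot (x2 - y2) x2 = dot (x1 - y1) y1 + dot (x2 - y2) y2 :=
  h (dual_form (x1 - y1, x2 - y2)).
have : dot (x1 - y1) (x1 - y1) + dot (x2 - y2) (x2 - y2) == 0.
  by rewrite !dotBr addrACA -opprD H subrr.
by rewrite paddr_eq0 ?dot_ge0// !dot_eq0 !subr_eq0 => /andP[/eqP -> /eqP ->].
Qed.

Lemma is_sharp_wedge A N al X :
  is_sharp (wedge A N) al X <-> X = al A *: N - al N *: A.
Proof.
have comb (be : @covector R) (r s : R) : be (r *: N - s *: A) = r * be N - s * be A.
  by rewrite linearB linearZ linearZ.
split=> [h|-> be]; last exact: comb.
by apply: covector_separates => be; rewrite h comb.
Qed.

Section Shear.
Variables (T : {linear E -> E}) (A N : E) (k : R).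
Hypotheses (TA : T A = - A) (TN : T N = (2 * k) *: A - N).

Lemma pushforward_shear : Defs.pushforward T (wedge A N) = wedge A N.
Proof.
apply/funext => al; apply/funext => be; rewrite /Defs.pushforward /wedge /= TA TN.
by rewrite !linearN !linearB !linearZ /= !linearN /= /GRing.scale /=; ring.
Qed.

Lemma leaf_form_shear (P : E -> @bivector R) l l' X Y r :
  P l = wedge A N -> P l' = wedge A N ->
  (forall r s, exists al, al A = r /\ al N = s) ->
  leaf_form P l X Y r -> leaf_form P l' (T X) (T Y) r.
Proof.
move=> Pl Pl' ex [al [be []]]; rewrite Pl => /is_sharp_wedge -> /is_sharp_wedge -> ->.
(* The values on [A] and [N] are those for which the Hamiltonian vector of [al'] is the image under
   [T] of that of [al]. *)
have [al' [alA alN]] := ex (- al A) (- (2 * k) * al A - al N).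
have [be' [beA beN]] := ex (- be A) (- (2 * k) * be A - be N).
have key (ga ga' : @covector R) : ga' A = - ga A -> ga' N = - (2 * k) * ga A - ga N ->
    is_sharp (P l') ga' (T (ga A *: N - ga N *: A)).
  move=> gA gN; rewrite Pl'; apply/is_sharp_wedge.
  rewrite linearB !linearZ /= TA TN gA gN; move: (ga A) (ga N) => x y.
  by congr pair; apply: eqrV3; rewrite !mxE /=; ring.
exists al', be'; rewrite Pl'; split; [rewrite -Pl'; exact: key|rewrite -Pl'; exact: key|].
by rewrite /wedge alA alN beA beN; ring.
Qed.

End Shear.

Lemma exists_unit_perp v : enorm v = 1 -> exists2 a, enorm a = 1 & dot a v = 0.
Proof.
move=> /enormK v1.
have key w : cross v w != 0 -> exists2 a, enorm a = 1 & dot a v = 0.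
  move=> w0; exists (normalize (cross v w)); first exact: enorm_normalize.
  by rewrite /normalize dotZl dot_crossl mulr0.
have [e0|] := eqVneq (cross v (delta_mx 0 0)) 0; last exact: key.
have [e1|] := eqVneq (cross v (delta_mx 0 1)) 0; last exact: key.
have z i j : cross v (delta_mx 0 i) = 0 -> cross v (delta_mx 0 i) 0 j = 0 by move=> ->; rewrite mxE.
have v0 : v 0 0 = 0 by rewrite -(z 1 2 e1) crossE2 !mxE /=; ring.
have v2 : v 0 2 = 0 by rewrite -(z 0 1 e0) crossE1 !mxE /=; ring.
have v1' : v 0 1 = 0 by apply: oppr_inj; rewrite oppr0 -(z 0 2 e0) crossE2 !mxE /=; ring.
by move/eqP: v1; rewrite dotE v0 v1' v2 !mulr0 !addr0 eq_sym oner_eq0.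
Qed.

Lemma dual_frame v a r s : dot v v = 1 -> enorm a = 1 -> dot a v = 0 ->
  exists al : @covector R, al (a, 0) = r /\ al (cross v a, 0) = s.
Proof.
move=> v1 /enormK a1 av; have nn : dot (cross v a) (cross v a) = 1.
  by rewrite dot_cross_unit// a1 av expr0n subr0.
exists (dual_form (r *: a + s *: cross v a, 0)); rewrite /= /dual_form /= !dot0l !addr0.
rewrite !dotDl !dotZl a1 nn dot_crossr (dotC a) dot_crossr.
by split; ring.
Qed.

Lemma poisson_frame l : olines l -> exists2 a, enorm a = 1 /\ dot a l.2 = 0 &
  poisson l = wedge (a, 0) (cross l.2 a, 0).
Proof.
move=> ol; have [a a1 av] := exists_unit_perp ol.1.
by exists a => //; exact: poissonE.
Qed.

Lemma is_derive_linear (V W : normedModType R) (L : {linear V -> W}) (f : R -> V) (t : R) df :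
  continuous L -> is_derive t 1 f df -> is_derive t 1 (L \o f) (L df).
Proof.
move=> cL [d e]; have dft := differentiableP ((derivable1_diffP _ _).1 d).
have dL : is_diff (f t) L L by split; [exact: linear_differentiable | exact: diff_lin].
have [dd ed] := is_diff_comp dft dL; split; first exact: diff_derivable.
by rewrite deriveE// ed /= -deriveE ?e//; exact/derivable1_diffP.
Qed.

(** Hamiltonian vectors are combinations of [(a, 0)] and [(cross l.2 a, 0)], so the direction is
    constant along an integral curve. *)
Lemma hamiltonian_arc_parallel l l' : hamiltonian_arc poisson l l' ->
  [/\ olines l, olines l' & l.2 = l'.2].
Proof.
move=> [f [c [_ <- <- hc]]].
have i0 : 0 <= (0 : R) <= 1 by rewrite lexx ler01.
have i1 : 0 <= (1 : R) <= 1 by rewrite lexx ler01.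
split; [by have [] := hc 0 i0|by have [] := hc 1 i1|].
have csnd : continuous (snd : E -> V3) by move=> z; exact: cvg_snd.
have dc (t : R) : 0 <= t <= 1 -> is_derive t 1 (fun s => (c s).2) 0.
  move=> t01; have [ol [X dX]] := hc t t01.
  have [a _ ->] := poisson_frame ol => /is_sharp_wedge XE.
  have := is_derive_linear csnd dX; rewrite XE /= !scaler0 subr0; exact.
apply/rowP => i.
have [| |t _] := @MVT_segment R (fun s : R => (c s).2 0 i) (fun=> 0) 0 1 ler01.
- move=> t; rewrite in_itv /= => /andP[t0 t1].
  have /dc/is_derive_rV/(_ i) : 0 <= t <= 1 by rewrite !ltW.
  by rewrite mxE.
- apply: derivable_within_continuous => t; rewrite in_itv /= => /dc/is_derive_rV/(_ i)[] //.
by rewrite mul0r => /subr0_eq.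
Qed.

(** On a leaf the Hamiltonian vector is the gradient turned by a right angle about [l.2]. The linear
    function with gradient [u = cross d l.2] thus generates the translation by [d]. *)
Lemma parallel_hamiltonian_arc l l' : olines l -> olines l' -> l'.2 = l.2 ->
  hamiltonian_arc poisson l l'.
Proof.
move=> ol ol' l2; have /enormK v1 := ol.1.
pose d := l'.1 - l.1; have dv : dot d l.2 = 0.
  by rewrite /d dotDl dotNl ol.2 -l2 ol'.2 subrr.
pose u := cross d l.2.
exists (fun z : E => dot u z.1), (fun t => (l.1 + t *: d, l.2)).
have oD : open [set x : E | x.2 != 0] by exact: open_snd_neq0.
have sm (z : E) : z.2 != 0 -> smooth_at ((fun z : E => dot u z.1 : R^o) \o line_of) z.
  move=> z0; exists [set x : E | x.2 != 0]; split=> // k.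
  apply: (@Ck_dot R E k _ (cst u) (fun z => (line_of z).1)) => //; first exact: Ck_cst.
  have Cn : Ck k [set x : E | x.2 != 0] (fun x : E => normalize x.2).
    by apply: Ck_normalize => //; exact: Ck_snd.
  apply: (CkB oD (f := fst)); first exact: Ck_fst.
  by apply: Ck_scale => //; apply: Ck_dot => //; exact: Ck_fst.
split.
- by move=> z oz; apply: sm; exact: line_neq0.
- by rewrite scale0r addr0 -surjective_pairing.
- by rewrite scale1r addrC subrK -l2 -surjective_pairing.
move=> t _; have oc : olines (l.1 + t *: d, l.2).
  by split; [exact: ol.1|rewrite /= dotDl dotZl dv ol.2 mulr0 addr0].
split=> //; exists (d, 0).
  by apply: is_derive_pair; exact: is_derive_affine.
have [a [a1 av] ->] := poisson_frame oc; rewrite /= in av *.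
have dE (w : V3) : dot w l.2 = 0 ->
    'd ((fun z : E => dot u z.1 : R^o) \o line_of) (l.1 + t *: d, l.2) (w, 0) = dot u w.
  move=> wv; have df := smooth_at_diff (sm (l.1 + t *: d, l.2) (line_neq0 ol)).
  have [_ <-] := is_derive_line0 (w, 0) df.
  have -> : (fun s : R => ((fun z : E => dot u z.1 : R^o) \o line_of)
      ((l.1 + t *: d, l.2) + s *: (w, 0))) = fun s : R => dot u (l.1 + t *: d + s *: w).
    apply/funext => s; rewrite first_component_line.
    have os : olines (l.1 + t *: d + s *: w, l.2).
      by split; [exact: ol.1|rewrite /= dotDl dotZl wv mulr0 addr0; exact: oc.2].
    exact: (congr1 (fun z : E => dot u z.1) (line_of_id os)).
  have [_ ->] := is_derive_dot (is_derive_cst u (0 : R) 1)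
    (is_derive_affine (l.1 + t *: d) w (0 : R)).
  by rewrite dot0l add0r.
apply/is_sharp_wedge; rewrite (dE a av) dE ?dot_crossl//.
have /enormK aa := a1.
have un : dot u (cross l.2 a) = - dot d a.
  transitivity (dot d l.2 * dot l.2 a - dot l.2 l.2 * dot d a); first by rewrite /u; vec3.
  by rewrite dv v1; ring.
have ua : dot u a = dot d (cross l.2 a) by rewrite /u; vec3.
congr pair; rewrite /= ?scaler0 ?subr0// un ua scaleNr opprK.
by rewrite {1}(unit_frame d v1 aa av) dv scale0r addr0 addrC.
Qed.

Lemma symplectic_leaf_parallel l : olines l ->
  symplectic_leaf poisson l = parallel_lines l.2.
Proof.
move=> ol; apply/seteqP; split=> l'; last first.
  by move=> [ol' l2]; apply: rst_step; exact: parallel_hamiltonian_arc.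
(* An equivalence is carried through the induction because arcs may be traversed backwards and
   reflexivity holds outside [olines] too. *)
move=> h; suff [ih ->] : (olines l <-> olines l') /\ l.2 = l'.2 by split=> //; exact/ih.
elim: h => {ol} [x y|x|x y _ [xy e]|x y z _ [xy e] _ [yz e']].
- by move=> /hamiltonian_arc_parallel[ox oy].
- by [].
- by split; [split=> /xy|].
- by split; [split=> [/xy/yz|/yz/xy]|rewrite e].
Qed.

End PoissonFrames.

Theorem proposition1p7 (R : realType) (S : set 'rV[R]_3)
  (hS : closed_surface S) (hconv : quadratically_convex S) :
  [/\ preserves_bivector poisson (avoiding S) (outer_billiard S),
      forall l : 'rV[R]_3 * 'rV[R]_3, olines l ->
        symplectic_leaf poisson l = parallel_lines l.2,
      forall l : 'rV[R]_3 * 'rV[R]_3, olines l ->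
        outer_billiard S @` (symplectic_leaf poisson l `&` avoiding S) =
        symplectic_leaf poisson l `&` avoiding S
    & forall v : 'rV[R]_3, enorm v = 1 ->
        leaf_symplectomorphism poisson v (parallel_lines v `&` avoiding S)
          (outer_billiard S)].
Proof.
have Bav := outer_billiard_avoiding hS hconv.
have B2 := outer_billiard_direction hS hconv.
(* The image line has the same direction, so [A] and [N] give the bivector at both lines and the
   differential is compared in one frame. *)
have frame l (al : avoiding S l) : exists A N k,
    [/\ 'd (outer_billiard S \o line_of) l A = - A,
        'd (outer_billiard S \o line_of) l N = (2 * k) *: A - N,
        poisson l = wedge A N, poisson (outer_billiard S l) = wedge A N
      & forall r s, exists be : @covector R, be A = r /\ be N = s].
  have [a [k [a1 av TA TN]]] := outer_billiard_leaf_frame hS hconv al.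
  have [ol _] := al; have [oBl _] := Bav l al; have /enormK v1 := ol.1.
  exists (a, 0), (cross l.2 a, 0), k; split=> //; first exact: poissonE.
    by rewrite -(B2 l al); apply: poissonE => //; rewrite B2.
  by move=> r s; exact: dual_frame.
have smB l : avoiding S l -> smooth_at (outer_billiard S \o line_of) l.
  by move=> al; apply: outer_billiard_smooth => //; exact: avoiding_avoiding_pairs.
split.
- split=> // l al; have [A [N [k [TA TN -> -> _]]]] := frame l al.
  exact: (pushforward_shear TA TN).
- exact: symplectic_leaf_parallel.
- move=> l ol; rewrite symplectic_leaf_parallel//; apply/seteqP; split=> m.
    move=> [l' [[ol' l'2] al'] <-]; split; last exact: Bav.
    by split; [have [] := Bav l' al'|rewrite B2].
  move=> [[om m2] am]; exists (reverse_billiard S m); last exact: reverse_billiardK.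
  have ar := reverse_billiard_avoiding hS hconv am.
  split=> //; split; first by case: ar.
  by rewrite reverse_billiard_direction.
move=> v v1; split.
  exists (reverse_billiard S); split.
  - move=> l [[ol l2] al]; have ar := reverse_billiard_avoiding hS hconv al.
    split; (split; last by [exact: Bav|]); split; [by case: (Bav l al)|by rewrite B2| |].
      by case: ar.
    by rewrite reverse_billiard_direction.
  - by move=> l [_ al]; rewrite outer_billiardK// reverse_billiardK.
  - by apply: smooth_leaf_smooth => l [[_ l2] al] //; exact: smB.
  - by apply: smooth_leaf_smooth => l [[_ l2] al] //; exact: reverse_billiard_smooth.
move=> l X Y r [_ al] h; have [A [N [k [TA TN Pl PBl ex]]]] := frame l al.
have dB := smooth_at_diff (smB l al).
rewrite !deriveE//; exact: (leaf_form_shear TA TN Pl PBl ex h).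
Qed.
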